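(* Let $T>0$ and let $\mathfrak{S}=(\mathfrak{A},\mathfrak{B},\mathfrak{C})$ be a boundary control system (BCS) which satisfies the system assumptions (S1), (S2), (S3) stated in the context. Assume further that the initial value $x_0$ and the functions $y_{\rm ref}$, $p$, $\varphi$ fulfill the controller assumptions (C1), (C2), (C3) stated in the context. Then the closed-loop system (CL) stated in the context possesses a unique solution $x\in W^{1,\infty}([0,T];X)$ in the sense that for almost all $t\in[0,T]$ it holds that $\dot x$ is continuous at $t$, $x(t)\in\mathcal{D}(\mathfrak{A})$, and (CL) is satisfied (including $x(0)=x_0$). Furthermore, the set $\{x_0\in\mathcal{D}(\mathfrak{A}) : \varphi(0)\|\mathfrak{C}x_0-y_{\rm ref}(0)\|_U<1\}$ is dense in $X$.
   Context: All spaces are over the same field $\mathbb{K}\in\{\mathbb{R},\mathbb{C}\}$; scalar products are linear in the first argument. $\mathcal{L}(Y,Z)$ denotes bounded linear operators, $\mathcal{R}(\cdot)$ the range. $W^{k,\infty}(J;B)$ denotes the functions $f\in L^\infty(J;B)$ whose (weak) derivatives up to order $k$ are in $L^\infty(J;B)$ (Bochner sense). BCS: $X$ and $U$ are Hilbert spaces; $\mathcal{D}(\mathfrak{A})$ is a Hilbert space with norm $\|\cdot\|_{\mathcal{D}(\mathfrak{A})}$, continuously embedded in $X$; $\mathfrak{A}:\mathcal{D}(\mathfrak{A})\to X$ is linear and bounded (with respect to $\|\cdot\|_{\mathcal{D}(\mathfrak{A})}$), and $\mathfrak{B},\mathfrak{C}\in\mathcal{L}(\mathcal{D}(\mathfrak{A}),U)$.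 The triple $\mathfrak{S}=(\mathfrak{A},\mathfrak{B},\mathfrak{C})$, with associated system $\dot x(t)=\mathfrak{A}x(t)$, $x(0)=x_0$, $u(t)=\mathfrak{B}x(t)$, $y(t)=\mathfrak{C}x(t)$, is called a boundary control system. System assumptions: (S1) there exists $\alpha\in\mathbb{R}$ with $\operatorname{Re}\langle\mathfrak{A}x,x\rangle_X\le\operatorname{Re}\langle\mathfrak{B}x,\mathfrak{C}x\rangle_U+\alpha\|x\|_X^2$ for all $x\in\mathcal{D}(\mathfrak{A})$; (S2) there exists $\beta\ge\alpha$ such that $\mathcal{R}(\mathfrak{A}|_{\ker\mathfrak{C}}-\beta I)=X$; (S3) the operator $\begin{bmatrix}\mathfrak{B}\\ \mathfrak{C}\end{bmatrix}:\mathcal{D}(\mathfrak{A})\to U\times U$ is surjective. Controller assumptions: (C1) $y_{\rm ref}\in W^{2,\infty}([0,\infty);U)$; (C2) $p\in W^{2,\infty}([0,\infty))$ has compact support and $p(0)=1$; (C3) $x_0\in\mathcal{D}(\mathfrak{A})$ and $\varphi\in\Phi$ with $\varphi(0)\|\mathfrak{C}x_0-y_{\rm ref}(0)\|_U<1$, where $\Phi$ is the set of real-valued $\varphi\in W^{2,\infty}([0,\infty))$ with $\inf_{t\ge0}\varphi(t)>0$. Closed-loop system (CL): $\dot x(t)=\mathfrak{A}x(t)$, $x(0)=x_0$, $\mathfrak{B}x(t)=u(t)$, $\mathfrak{C}x(t)=y(t)$, $e(t)=y(t)-y_{\rm ref}(t)$, $e_0=\mathfrak{C}x_0-y_{\rm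 ref}(0)$, $\varphi_0=\varphi(0)$, $u(t)=(\mathfrak{B}x_0+\psi(\varphi_0,e_0))\,p(t)-\psi(\varphi(t),e(t))$, where $\psi(\varphi,e)=\frac{1}{1-\varphi^2\|e\|^2}e$ with domain $\mathcal{D}(\psi)=\{(\varphi,e)\in(0,\infty)\times U : \varphi\|e\|<1\}$ (so satisfaction of (CL) at $t$ includes $\varphi(t)\|e(t)\|<1$). *)

(* Defs.v *)
From HB Require Import structures.
From mathcomp Require Import all_boot all_order all_algebra.
From mathcomp Require Import sesquilinear complex.
From mathcomp Require Import all_classical all_reals all_analysis.

Set Implicit Arguments.
Unset Strict Implicit.
Unset Printing Implicit Defensive.

Import Order.TTheory GRing.Theory Num.Theory.
Import numFieldNormedType.Exports.

Local Open Scope classical_set_scope.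
Local Open Scope ring_scope.

(* [scalar_field R K] says that the field K is either R or R[i]. *)
Variant scalar_field (R : realType) : numFieldType -> Type :=
| RealScalars : scalar_field R R
| ComplexScalars : scalar_field R R[i].

Arguments RealScalars {R}.
Arguments ComplexScalars {R}.

Section Scalars.
Context {R : realType} {K : numFieldType} (F : scalar_field R K).

Definition conjK : K -> K :=
  match F in scalar_field _ K return K -> K with
  | RealScalars => idfun
  | ComplexScalars => @conjc R
  end.

Definition ReK : K -> R :=
  match F in scalar_field _ K return K -> R with
  | RealScalars => idfun
  | ComplexScalars => @complex.Re R
  end.

Definition ofR : R -> K :=
  match F in scalar_field _ K return R -> K with
  | RealScalars => idfun
  | ComplexScalars => real_complex R
  end.

(* The norm of a [normedModType K] takes its values in K (where it is a
   nonnegative real); [rnorm] is the same number seen in R. *)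
Definition rnorm (V : normedModType K) (x : V) : R := ReK `|x|.

Definition bounded_op (V W : normedModType K) (f : V -> W) : Prop :=
  exists M : R, forall x, rnorm (f x) <= M * rnorm x.

(* In the library, [{dot V for theta}] is linear in its first argument. *)
Record hilbert : Type := Hilbert {
  hilbert_carrier :> completeNormedModType K;
  inner : {dot hilbert_carrier for conjK};
  inner_norm : forall x : hilbert_carrier, inner x x = `|x| ^+ 2
}.

End Scalars.

Arguments inner {R K F} h.

Section Bochner.
Context {R : realType} {K : numFieldType} (F : scalar_field R K).
Variable V : normedModType K.
Implicit Types (J : set R) (f g s : R -> V).

Local Notation mu := (@lebesgue_measure R).

Definition simple s : Prop :=
  finite_set (range s) /\
  forall v, v != 0 ->
    measurable (s @^-1` [set v]) /\ (mu (s @^-1` [set v]) < +oo)%E.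

(* [fine +oo = 0] is harmless: only v = 0 may have infinite measure. *)
Definition simple_integral J s : V :=
  \sum_(v \in [set: V]) ofR F (fine (mu (J `&` s @^-1` [set v]))) *: v.

Definition strongly_measurable J f : Prop :=
  exists s : nat -> R -> V,
    (forall n, simple (s n)) /\
    {ae mu, forall t, J t -> s n t @[n --> \oo] --> f t}.

(* f is Bochner integrable over J, with integral I *)
Definition bochner_integral J f (I : V) : Prop :=
  strongly_measurable J f /\
  exists s : nat -> R -> V,
    [/\ forall n, simple (s n),
        (\int[mu]_(t in J) (rnorm F (f t - s n t))%:E)%E @[n --> \oo] --> 0%E &
        simple_integral J (s n) @[n --> \oo] --> I].

Definition Linfty J f : Prop :=
  strongly_measurable J f /\
  exists M : R, {ae mu, forall t, J t -> rnorm F (f t) <= M}.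

Definition test_function J (eta : R -> R) : Prop :=
  [/\ forall n t, derivable (derive1n n eta) t 1,
      compact (closure [set t | eta t != 0]) &
      closure [set t | eta t != 0] `<=` interior J].

Definition weak_derivative (k : nat) J f g : Prop :=
  forall eta, test_function J eta ->
    exists I : V,
      bochner_integral J (fun t => ofR F (derive1n k eta t) *: f t) I /\
      bochner_integral J (fun t => ofR F (eta t) *: g t) ((-1) ^+ k *: I).

(* Elements of W^{k,oo}(J; V), as functions rather than almost-everywhere
   classes; when k >= 1, values at points are those of the continuous
   representative, whose continuity is therefore required separately below. *)
Definition Winfty (k : nat) J f : Prop :=
  Linfty J f /\
  forall j, (j <= k)%N -> exists g, Linfty J g /\ weak_derivative j J f g.

End Bochner.

Section BoundaryControl.
Context {R : realType} {K : numFieldType} {F : scalar_field R K}.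

(* D is the domain of the main operator, as a Hilbert space of its own; [emb]
   is its inclusion in X. *)
Record bcs (X D U : hilbert F) : Type := Bcs {
  emb : {linear D -> X};
  emb_inj : injective emb;
  emb_bounded : bounded_op F emb;
  opA : {linear D -> X};
  opA_bounded : bounded_op F opA;
  opB : {linear D -> U};
  opB_bounded : bounded_op F opB;
  opC : {linear D -> U};
  opC_bounded : bounded_op F opC
}.

Context {X D U : hilbert F}.
Variable S : bcs X D U.

Local Notation A := (opA S).
Local Notation B := (opB S).
Local Notation C := (opC S).
Local Notation iota := (emb S).

Definition system_S1 (alpha : R) : Prop :=
  forall x : D,
    ReK F (inner X (A x) (iota x))
      <= ReK F (inner U (B x) (C x)) + alpha * rnorm F (iota x) ^+ 2.

Definition system_S2 (alpha : R) : Prop :=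
  exists beta : R, alpha <= beta /\
    forall z : X, exists x : D, C x = 0 /\ A x - ofR F beta *: iota x = z.

Definition system_S3 : Prop :=
  forall v w : U, exists x : D, B x = v /\ C x = w.

Definition system_assumptions : Prop :=
  (exists alpha : R, system_S1 alpha /\ system_S2 alpha) /\ system_S3.

Local Notation halfline := (`[0, +oo[%classic : set R).

Definition controller_C1 (yref : R -> U) : Prop :=
  Winfty F 2 halfline yref /\ {within halfline, continuous yref}.

Definition controller_C2 (p : R -> K^o) : Prop :=
  [/\ Winfty F 2 halfline p, {within halfline, continuous p},
      compact (closure [set t | 0 <= t /\ p t != 0]) & p 0 = 1].

(* [inf] is 0 on sets that are not bounded below. *)
Definition funnel_class (phi : R -> R^o) : Prop :=
  [/\ Winfty RealScalars 2 halfline phi, {within halfline, continuous phi} &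
      0 < inf [set (phi t : R) | t in halfline]].

Definition admissible_initial (yref : R -> U) (phi : R -> R) : set D :=
  [set x0 | phi 0 * rnorm F (C x0 - yref 0) < 1].

Definition controller_assumptions
    (yref : R -> U) (p : R -> K) (phi : R -> R) (x0 : D) : Prop :=
  [/\ controller_C1 yref, controller_C2 p, funnel_class phi &
      admissible_initial yref phi x0].

Definition psi (a : R) (e : U) : U :=
  ofR F (1 / (1 - a ^+ 2 * rnorm F e ^+ 2)) *: e.

Definition psi_domain : set (R * U) :=
  [set ae | 0 < ae.1 /\ ae.1 * rnorm F ae.2 < 1].

(* The closed-loop equations at time t, for a state with value xt and
   derivative dxt at time t. *)
Definition closed_loop_at (yref : R -> U) (p : R -> K) (phi : R -> R) (x0 : D)
    (t : R) (xt : D) (dxt : X) : Prop :=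
  exists u y e : U,
    let e0 := C x0 - yref 0 in
    [/\ dxt = A xt, B xt = u, C xt = y, e = y - yref t &
        [/\ psi_domain (phi 0, e0), psi_domain (phi t, e) &
            u = p t *: (B x0 + psi (phi 0) e0) - psi (phi t) e]].

(* x is the continuous representative, and xdot a representative of its weak
   derivative; at a point where xdot is continuous, x is then classically
   differentiable with derivative xdot t. *)
Definition closed_loop_solution (yref : R -> U) (p : R -> K) (phi : R -> R)
    (x0 : D) (T : R) (x : R -> X) : Prop :=
  [/\ Winfty F 1 `[0, T]%classic x,
      {within `[0, T], continuous x},
      x 0 = iota x0 &
      exists xdot : R -> X,
        weak_derivative F 1 `[0, T]%classic x xdot /\
        {ae @lebesgue_measure R, forall t, t \in `[0, T] ->
          {for t, continuous xdot} /\
          exists xt : D, iota xt = x t /\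
            closed_loop_at yref p phi x0 t xt (xdot t)}].

End BoundaryControl.

(* Main.v *)
Require Import Defs.
From HB Require Import structures.
From mathcomp Require Import all_boot all_order all_algebra.
From mathcomp Require Import sesquilinear complex.
From mathcomp Require Import all_classical all_reals all_analysis.
From mathcomp Require Import measurable_realfun.
From mathcomp Require Import ring lra.

Set Implicit Arguments.
Unset Strict Implicit.
Unset Printing Implicit Defensive.
Import Order.TTheory GRing.Theory Num.Theory.
Import numFieldNormedType.Exports.
Local Open Scope classical_set_scope.
Local Open Scope ring_scope.

(** The feedback law becomes autonomous after a change of variables.  Let [P] be
    a bounded right inverse of [C] on the kernel of [B], let [q0] be a state with
    [C q0 = 0] whose input [B q0] is the feedforward coefficient, and put
    [l = P yref + p q0].  Then [w = phi (x - l)] solves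
    [w' = A w + (phi'/phi) w + phi (A l - l')] under the boundary condition
    [B w = - psi(1, C w)], [|C w| < 1], which does not depend on time
    ([closed_loop_atP]).

    The operator [alpha - A] restricted by this boundary condition is monotone,
    by the dissipation inequality and because [psi(1, .)] is monotone
    ([funnel_mono]).  It is maximal ([closed_loop_maximal_monotone]): to reach a given right-hand side,
    one solves for the output [e = C w], which satisfies an equation
    [K e + psi(1, e) = b] where [K] is bounded and linear, and monotone by the
    dissipation inequality; it is solved by forward-backward splitting
    ([funnel_perturbed]), the gain of [psi] being infinite at the boundary of the
    unit ball.

    The solution [w] comes from Kato's theorem for a maximal monotone operator
    with a Lipschitz perturbation ([strong_solution_exists]).  A semi-implicit
    Euler scheme converges to a Lipschitz function which stays in the domain of
    the operator and has everywhere a right derivative, the expected one.  The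
    speed is decreasing up to a Lipschitz term, hence continuous almost
    everywhere, and where the speed is continuous so is the velocity, because
    in a Hilbert space the convergence of the norms of Yosida approximations
    forces strong convergence ([strong_value]).

    Real and complex spaces are treated together by restriction of the scalars
    to the reals ([realify]).  What Sobolev regularity means for the data is
    extracted by pairing weak derivatives with real functionals and testing
    them against smooth steps and ramps: a function with a bounded second weak
    derivative has second differences of second order, hence a Lipschitz
    derivative ([second_difference_c11]), and a function with a bounded weak
    derivative is Lipschitz, and differentiable where the derivative is
    continuous ([weak_derivative_pointwise]).  In the other direction, a
    Lipschitz function whose right derivative is bounded and right-continuous
    has it as weak derivative, by dominated convergence for step functions and
    the fundamental theorem of calculus for right derivatives
    ([weak_derivative_right]).

    Two solutions differ by a function whose squared norm [r] satisfies
    [r' <= 2 alpha r] almost everywhere, by monotonicity of the feedback;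
    Gronwall's lemma tolerates the null set because [r] is Lipschitz
    ([gronwall_ae]).  Density of the admissible initial values follows from that
    of the kernel of [C] ([kernel_dense]), after subtraction of [P (yref 0)]. *)

(** The cost of [lra] grows with the number of comparisons in the context:
    [goal_lra] sees only those that are premises of the goal. *)
Ltac hide_comparisons :=
  repeat match goal with
  | H : is_true ?b |- _ => change (@hide Prop (is_true b)) in H
  end.
Tactic Notation "goal_lra" := hide_comparisons; move=> *; lra.

(** * Real Hilbert spaces *)

Definition vcvg (R : realType) (V : zmodType) (nm : V -> R)
    (u : nat -> V) (l : V) : Prop :=
  forall e : R, 0 < e -> exists N, forall n, (N <= n)%N -> nm (u n - l) < e.

Definition vcauchy (R : realType) (V : zmodType) (nm : V -> R)
    (u : nat -> V) : Prop :=
  forall e : R, 0 < e -> exists N, forall m n, (N <= m)%N -> (N <= n)%N ->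
    nm (u m - u n) < e.

Record rhilbert (R : realType) := RHilbert {
  rcar :> lmodType R;
  dot : rcar -> rcar -> R;
  dotC : forall x y, dot x y = dot y x;
  dotDl : forall x y z, dot (x + y) z = dot x z + dot y z;
  dotZl : forall a x y, dot (a *: x) y = a * dot x y;
  dot_ge0 : forall x, 0 <= dot x x;
  dot_eq0 : forall x, dot x x = 0 -> x = 0;
  rcomplete : forall u : nat -> rcar,
    vcauchy (fun x => Num.sqrt (dot x x)) u ->
    exists l, vcvg (fun x => Num.sqrt (dot x x)) u l }.

Section HilbertBasics.
Context {R : realType} {V : rhilbert R}.
Implicit Types (x y z w : V) (a b : R).

Definition nm x : R := Num.sqrt (dot x x).

Lemma dotDr x y z : dot z (x + y) = dot z x + dot z y.
Proof. by rewrite dotC dotDl ![dot _ z]dotC. Qed.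

Lemma dotZr a x y : dot y (a *: x) = a * dot y x.
Proof. by rewrite dotC dotZl [dot _ y]dotC. Qed.

Lemma dotNl x y : dot (- x) y = - dot x y.
Proof. by rewrite -scaleN1r dotZl mulN1r. Qed.

Lemma dotNr x y : dot y (- x) = - dot y x.
Proof. by rewrite dotC dotNl dotC. Qed.

Lemma dot0l x : dot 0 x = 0.
Proof. by rewrite -(scale0r x) dotZl mul0r. Qed.

Lemma dot0r x : dot x 0 = 0.
Proof. by rewrite dotC dot0l. Qed.

Definition dotE := (dotDl, dotDr, dotNl, dotNr, dotZl, dotZr, @dot0l, @dot0r).

Lemma vec_eq x y : (forall w, dot x w = dot y w) -> x = y.
Proof.
move=> h; apply/eqP; rewrite -subr_eq0; apply/eqP/dot_eq0.
by rewrite dotDl dotNl h subrr.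
Qed.

Lemma nm_ge0 x : 0 <= nm x. Proof. exact: sqrtr_ge0. Qed.

Lemma sqr_nm x : nm x ^+ 2 = dot x x.
Proof. by rewrite sqr_sqrtr // dot_ge0. Qed.

Lemma nm_eq0 x : nm x = 0 -> x = 0.
Proof. by move=> h; apply: dot_eq0; rewrite -sqr_nm h expr0n. Qed.

Lemma nm0 : nm 0 = 0 :> R. Proof. by rewrite /nm dot0l sqrtr0. Qed.

Lemma nmZ a x : nm (a *: x) = `|a| * nm x.
Proof. by rewrite /nm dotZl dotZr mulrA -expr2 sqrtrM ?sqr_ge0 // sqrtr_sqr. Qed.

Lemma nmN x : nm (- x) = nm x.
Proof. by rewrite -scaleN1r nmZ normrN1 mul1r. Qed.

Lemma nmBC x y : nm (x - y) = nm (y - x).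
Proof. by rewrite -nmN opprB. Qed.

Lemma le_nm a x : 0 <= a -> dot x x <= a ^+ 2 -> nm x <= a.
Proof. by move=> a0; rewrite -sqr_nm ler_sqr ?nnegrE ?nm_ge0. Qed.

(** Cauchy--Schwarz, from the nonnegativity of the square norm of
    [dot y y *: x - dot x y *: y]. *)
Lemma dot_le x y : dot x y <= nm x * nm y.
Proof.
have [y0|yN0] := eqVneq (dot y y) 0.
  by rewrite (dot_eq0 y0) dot0r nm0 mulr0.
have ypos : 0 < dot y y by rewrite lt_neqAle eq_sym yN0 dot_ge0.
rewrite -[leRHS]ger0_norm ?mulr_ge0 ?nm_ge0 // (le_trans (ler_norm _)) //.
rewrite -ler_sqr ?nnegrE ?normr_ge0 // !real_normK ?num_real //.
rewrite exprMn !sqr_nm.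
have := dot_ge0 (dot y y *: x - dot x y *: y).
rewrite !dotE [dot y x]dotC => h.
have : 0 <= dot y y * (dot x x * dot y y - dot x y ^+ 2) by nra.
by rewrite pmulr_rge0 // subr_ge0.
Qed.

Lemma dot_abs x y : `|dot x y| <= nm x * nm y.
Proof.
by rewrite ler_norml dot_le andbT lerNl -dotNl (le_trans (dot_le _ _)) ?nmN.
Qed.

Lemma nmD x y : nm (x + y) <= nm x + nm y.
Proof.
apply: le_nm; first by rewrite addr_ge0 ?nm_ge0.
rewrite !dotE [dot y x]dotC -!sqr_nm; have := dot_le x y; nra.
Qed.

Lemma nmB x y : nm (x - y) <= nm x + nm y.
Proof. by rewrite (le_trans (nmD _ _)) // nmN. Qed.

Lemma nm_trans y x z : nm (x - z) <= nm (x - y) + nm (y - z).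
Proof. by rewrite (le_trans _ (nmD _ _)) // addrA subrK. Qed.

Lemma nm_le_add x y : nm x <= nm y + nm (x - y).
Proof. by rewrite (le_trans _ (nmD _ _)) // addrC subrK. Qed.

End HilbertBasics.

#[global] Hint Extern 0 (is_true (0 <= nm _)) => exact: nm_ge0 : core.
#[global] Hint Extern 0 (is_true (0 <= dot _ _)) => exact: dot_ge0 : core.

(** Vector identities are checked against an arbitrary test vector, where they
    become ring identities. *)
Ltac vring := apply: vec_eq => ?; rewrite !dotE; ring.
Ltac vfield := apply: vec_eq => ?; rewrite !dotE; field.

Lemma le_eps {R : realType} (a b k : R) :
  (forall e : R, 0 < e -> a <= b + k * e) -> a <= b.
Proof.
move=> h; apply/ler_addgt0Pr => e e0.
have k1 : 0 < `|k| + 1 by rewrite ltr_wpDl.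
have := h (e / (`|k| + 1)); rewrite divr_gt0 // => /(_ isT) /le_trans; apply.
rewrite lerD2l mulrCA -{2}[e]mulr1 ler_wpM2l ?ltW //.
rewrite ltr_pdivrMr // mul1r; have := ler_norm k; lra.
Qed.

Lemma pos_below2 {R : realType} (a b : R) : 0 < a -> 0 < b ->
  exists d, [/\ 0 < d, d <= a & d <= b].
Proof.
by move=> a0 b0; exists (Num.min a b); rewrite lt_min a0 b0 !ge_min !lexx orbT.
Qed.

Lemma pos_below3 {R : realType} (a b c : R) : 0 < a -> 0 < b -> 0 < c ->
  exists d, [/\ 0 < d, d <= a, d <= b & d <= c].
Proof.
move=> a0 b0 c0; have [d [d0 da db]] := pos_below2 a0 b0.
have [d' [d0' d1 d2]] := pos_below2 d0 c0.
by exists d'; split=> //; exact: le_trans d1 _.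
Qed.

Section HilbertComplete.
Context {R : realType} {V : rhilbert R}.
Implicit Types (x y z l : V) (u : nat -> V).

Lemma complete_rate u (r : nat -> R) :
  (forall e : R, 0 < e -> exists n, r n < e) ->
  (forall n m, (n <= m)%N -> nm (u n - u m) <= r n) ->
  exists l, forall n, nm (u n - l) <= r n.
Proof.
move=> r0 ur.
have [|l ul] := @rcomplete _ V u.
  move=> e e0; have [N rN] := r0 (e / 2) (divr_gt0 e0 (ltr0Sn _ _)).
  exists N => m n Nm Nn; have h1 := ur _ _ Nm; have h2 := ur _ _ Nn.
  have h3 := nm_trans (u N) (u m) (u n); rewrite (nmBC (u N)) in h1. have : nm (u m - u n) < e by lra.
  exact.
exists l => n; apply: (@le_eps _ _ _ 1) => e e0.
have [N uN] := ul e e0.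
have h1 := ur _ _ (leq_maxl n N); have h2 := uN _ (leq_maxr n N).
have := nm_trans (u (maxn n N)) (u n) l; rewrite -?/(nm _) in h2 *; lra.
Qed.

Lemma inv_small (e : R) : 0 < e -> exists n : nat, n.+1%:R^-1 < e.
Proof.
move=> e0; have := archi_boundP (ltW (_ : 0 < e^-1)).
rewrite invr_gt0 e0 => /(_ isT) h; exists (Num.bound e^-1).
rewrite invf_plt ?posrE // (lt_le_trans h) // ler_nat.
exact: leqnSn.
Qed.

(** As [S] is not assumed closed, the projection of [z] lies in its closure: it
    is the limit of a minimizing sequence in [S], Cauchy by the parallelogram
    identity. *)
Lemma projection (S : V -> Prop) z :
  S 0 -> (forall x y, S x -> S y -> S (x + y)) ->
  (forall a x, S x -> S (a *: x)) ->
  exists p, (forall e : R, 0 < e -> exists2 s, S s & nm (s - p) < e) /\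
            (forall s, S s -> dot (z - p) s = 0).
Proof.
move=> S0 SD SZ.
pose E := [set dot (z - s) (z - s) | s in [set s | S s]].
have E0 : E !=set0 by exists (dot (z - 0) (z - 0)), 0.
have Elb : has_lbound E by exists 0 => _ [s _ <-]; exact: dot_ge0.
have dle s : S s -> inf E <= dot (z - s) (z - s).
  by move=> Ss; apply: ge_inf => //; exists s.
have dapp e : 0 < e -> exists2 s, S s & dot (z - s) (z - s) < inf E + e.
  move=> e0; have [_ [s Ss <-] h] := inf_adherent e0 (conj E0 Elb).
  by exists s.
have /choice[s sP] : forall n, exists s, S s /\
    dot (z - s) (z - s) < inf E + n.+1%:R^-1.
  by move=> n; have [|s Ss h] := dapp n.+1%:R^-1; [rewrite invr_gt0|exists s].
have close x y a b : S x -> S y -> dot (z - x) (z - x) < inf E + a ->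
    dot (z - y) (z - y) < inf E + b -> dot (x - y) (x - y) <= 2 * a + 2 * b.
  move=> Sx Sy hx hy.
  have := dle _ (SZ (1/2) _ (SD _ _ Sx Sy)).
  move: hx hy; rewrite !dotE ![dot y x]dotC ![dot y z]dotC ![dot x z]dotC; lra.
have [||l ul] := @complete_rate s (fun n => 2 * Num.sqrt n.+1%:R^-1).
- move=> e e0; have [|n hn] := @inv_small ((e / 2) ^+ 2).
    by rewrite exprn_gt0 // divr_gt0.
  exists n; rewrite -ltr_pdivlMl // mulrC -[ltRHS]ger0_norm ?divr_ge0 ?ltW //.
  by rewrite -sqrtr_sqr ltr_sqrt // exprn_gt0 // divr_gt0.
- move=> n m nm_; apply: le_nm; first by rewrite mulr_ge0 // sqrtr_ge0.
  have [S1 h1] := sP n; have [S2 h2] := sP m.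
  apply: le_trans (close _ _ _ _ S1 S2 h1 h2) _.
  rewrite exprMn sqr_sqrtr ?invr_ge0 //.
  have : m.+1%:R^-1 <= n.+1%:R^-1 :> R by rewrite lef_pV2 ?posrE ?ler_nat.
  move: (m.+1%:R^-1 : R) (n.+1%:R^-1 : R) => a b ab; nra.
have lapp e : 0 < e -> exists2 n, nm (s n - l) < e & n.+1%:R^-1 < e.
  move=> e0; have [|n hn] := @inv_small (Num.min e ((e / 2) ^+ 2)).
    by rewrite lt_min e0 exprn_gt0 // divr_gt0.
  move: hn; rewrite lt_min => /andP[hn hn2]; exists n => //.
  rewrite (le_lt_trans (ul n)) //.
  rewrite -ltr_pdivlMl // mulrC -[ltRHS]ger0_norm ?divr_ge0 ?ltW //.
  by rewrite -sqrtr_sqr ltr_sqrt // exprn_gt0 // divr_gt0.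
exists l; split=> [e e0|y Sy].
  by have [n hn _] := lapp e e0; exists (s n) => //; case: (sP n).
have key t : dot (z - l) (z - l) <= dot (z - l - t *: y) (z - l - t *: y).
  set q := z - l - t *: y.
  apply: (@le_eps _ _ _ (2 + 2 * nm q + 2 * nm (z - l))) => e e0.
  have [|n h1 h2] := lapp (Num.min e 1); first by rewrite lt_min e0 ltr01.
  move: h1 h2; rewrite !lt_min => /andP[h1 h1'] /andP[h2 _].
  have [Sn hs] := sP n.
  have := dle _ (SD _ _ Sn (SZ t _ Sy)).
  have -> : z - (s n + t *: y) = q - (s n - l) by rewrite /q; vring.
  have -> : z - l = z - s n + (s n - l) by vring.
  have -> : dot (z - s n + (s n - l)) (z - s n + (s n - l)) =
    dot (z - s n) (z - s n) + 2 * dot (z - l) (s n - l) - dot (s n - l) (s n - l).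
    rewrite !dotE ![dot l (s n)]dotC ![dot (s n) z]dotC ![dot l z]dotC; ring.
  set d := s n - l.
  have -> : dot (q - d) (q - d) = dot q q - 2 * dot q d + dot d d.
    by move: (q) (d) => a b; rewrite !dotE [dot b a]dotC; ring.
  have c1 := dot_abs q d; have c2 := dot_abs (z - l) d.
  move: c1 c2; rewrite !ler_norml => /andP[c1 _] /andP[_ c2].
  have -> : z - s n + d = z - l by rewrite /d; vring.
  rewrite -/d in h1 h1'; move: hs; rewrite -[dot d d]sqr_nm.
  have p1 : nm q * nm d <= nm q * e by rewrite ler_wpM2l ?nm_ge0 ?ltW.
  have p2 : nm (z - l) * nm d <= nm (z - l) * e by rewrite ler_wpM2l ?nm_ge0 ?ltW.
  have p3 : nm d ^+ 2 <= e by have := nm_ge0 d; nra.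
  move: h2; move: (n.+1%:R^-1) => i; lra.
have [y0|yN0] := eqVneq (dot y y) 0; first by rewrite (dot_eq0 y0) dot0r.
have ypos : 0 < dot y y by rewrite lt_neqAle eq_sym yN0 dot_ge0.
have := key (dot (z - l) y / dot y y).
set c := z - l; have -> t : dot (c - t *: y) (c - t *: y) =
    dot c c - 2 * t * dot c y + t ^+ 2 * dot y y.
  by move: c => b; rewrite !dotE [dot y b]dotC; ring.
have -> : dot c c - 2 * (dot c y / dot y y) * dot c y +
   (dot c y / dot y y) ^+ 2 * dot y y = dot c c - (dot c y) ^+ 2 / dot y y.
  by field.
move=> h; have : (dot c y) ^+ 2 / dot y y <= 0 by lra.
rewrite pmulr_lle0 ?invr_gt0 // => h2; apply/eqP.
by rewrite -sqrf_eq0 eq_le h2 sqr_ge0.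
Qed.

Lemma expr_small (q e : R) : 0 <= q -> q < 1 -> 0 < e -> exists n, q ^+ n < e.
Proof.
move=> q0 q1 e0.
have /cvgrPdist_lt/(_ _ e0)[N _ hN] : (q ^+ n @[n --> \oo] --> (0 : R)).
  by apply: cvg_expr; rewrite ger0_norm.
by exists N; have := hN N (leqnn N); rewrite /= sub0r normrN ger0_norm ?exprn_ge0.
Qed.

Lemma contraction_fixpoint (f : V -> V) (q : R) :
  0 <= q -> q < 1 -> (forall x y, nm (f x - f y) <= q * nm (x - y)) ->
  exists x, f x = x.
Proof.
move=> q0 q1 fq; pose u n := iter n f 0; pose c := nm (f 0) / (1 - q).
have c0 : 0 <= c by rewrite divr_ge0 ?nm_ge0 // subr_ge0 ltW.
have du n : nm (u n.+1 - u n) <= q ^+ n * nm (f 0).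
  elim: n => [|n ih]; first by rewrite /u /= subr0 expr0 mul1r.
  by rewrite (le_trans (fq _ _)) // exprS -mulrA ler_wpM2l.
have ud k n : nm (u n - u (n + k)%N) <= q ^+ n * c.
  elim: k n => [|k ih] n.
    by rewrite addn0 subrr nm0 mulr_ge0 // exprn_ge0.
  apply: le_trans (nm_trans (u n.+1) _ _) _; rewrite addnS -addSn.
  have := du n; have := ih n.+1; rewrite nmBC exprS => h1 h2.
  have -> : q ^+ n * c = q * q ^+ n * c + q ^+ n * nm (f 0).
    by rewrite /c; field; lra.
  by rewrite nmBC in h2; lra.
have rsmall e : 0 < e -> exists n, q ^+ n * c < e.
  move=> e0; have [|n hn] := @expr_small q (e / (c + 1)) q0 q1.
    by rewrite divr_gt0 // ltr_wpDl.
  exists n; rewrite (@le_lt_trans _ _ (q ^+ n * (c + 1))) //.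
    by rewrite ler_wpM2l ?exprn_ge0 // lerDl.
  by rewrite -ltr_pdivlMr // ltr_wpDl.
have [|l ul] := complete_rate (u := u) rsmall.
  by move=> n m nm_; rewrite -(subnKC nm_).
exists l; apply/eqP; rewrite -subr_eq0; apply/eqP/nm_eq0/eqP.
rewrite eq_le nm_ge0 andbT; apply: (@le_eps _ _ _ (q + 1)) => e e0.
have [n hn] := rsmall e e0.
have := nm_trans (u n.+1) (f l) l; have := fq l (u n); rewrite -/(u n.+1).
have := ul n; have := ul n.+1; rewrite (nmBC l) => h1 h2 h3 h4.
have : q ^+ n.+1 * c <= q ^+ n * c.
  by rewrite ler_wpM2r // exprS ler_piMl ?exprn_ge0 // ltW.
have := nm_ge0 (u n - l); nra.
Qed.

(** Baire's theorem, for a countable union of sets exhausting the space: one of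
    them is dense in some ball. *)
Lemma baire_union (E : nat -> V -> Prop) : (forall y, exists n, E n y) ->
  exists n y0 r, 0 < r /\ forall y, nm (y - y0) < r ->
    forall e : R, 0 < e -> exists2 y', E n y' & nm (y' - y) < e.
Proof.
move=> EU; apply: contrapT => hN.
(* otherwise every ball contains a smaller ball that misses [E n] *)
have step (n : nat) (b : V * R) : exists b' : V * R, 0 < b.2 ->
    [/\ 0 < b'.2, b'.2 <= b.2 / 2, nm (b'.1 - b.1) + b'.2 <= b.2 &
        forall y, nm (y - b'.1) <= b'.2 -> ~ E n y].
  have [b0|] := pselect (0 < b.2); last by move=> ?; exists b.
  apply: contrapT => hb; apply: hN; exists n, b.1, (b.2 / 2).
  split=> [|y yb e e0]; first exact: divr_gt0.
  apply: contrapT => hy; apply: hb; exists (y, Num.min (e / 2) (b.2 / 2)) => _ /=.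
  have m0 : 0 < Num.min (e / 2) (b.2 / 2) by rewrite lt_min !divr_gt0.
  have m1 : Num.min (e / 2) (b.2 / 2) <= b.2 / 2 by rewrite ge_min lexx orbT.
  have m2 : Num.min (e / 2) (b.2 / 2) <= e / 2 by rewrite ge_min lexx.
  split=> //; first by lra.
  by move=> z zy Ez; apply: hy; exists z => //; lra.
have /choice[next nextP] : forall nb : nat * (V * R), exists b' : V * R,
    0 < nb.2.2 -> [/\ 0 < b'.2, b'.2 <= nb.2.2 / 2,
      nm (b'.1 - nb.2.1) + b'.2 <= nb.2.2 &
      forall y, nm (y - b'.1) <= b'.2 -> ~ E nb.1 y].
  by move=> [n b]; exact: step.
pose b := fix b n := if n is m.+1 then next (m, b m) else (0 : V, 1 : R).
have b0 n : 0 < (b n).2 by elim: n => [|n /(nextP (n, _))[]] //=.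
have bS n : [/\ (b n.+1).2 <= (b n).2 / 2,
    nm ((b n.+1).1 - (b n).1) + (b n.+1).2 <= (b n).2 &
    forall y, nm (y - (b n.+1).1) <= (b n.+1).2 -> ~ E n y].
  by have [? ? ? ?] := nextP (n, b n) (b0 n).
have bd k n : nm ((b (n + k)%N).1 - (b n).1) + (b (n + k)%N).2 <= (b n).2.
  elim: k n => [|k ih] n; first by rewrite addn0 subrr nm0 add0r.
  have [_ h _] := bS (n + k)%N; have := ih n; rewrite addnS.
  have := nm_trans (b (n + k)%N).1 (b (n + k).+1).1 (b n).1; lra.
have bsmall n : (b n).2 <= (1 / 2) ^+ n.
  elim: n => [|n ih]; first by rewrite expr0.
  have [h _ _] := bS n; rewrite exprS; lra.
have [||l lP] := @complete_rate (fun n => (b n).1) (fun n => (b n).2).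
- move=> e e0; have [||n hn] := @expr_small (1 / 2) e _ _ e0; [lra..|].
  by exists n; have := bsmall n; lra.
- move=> n m nm_; have := bd (m - n)%N n; rewrite subnKC // nmBC.
  have := b0 m; lra.
have [n En] := EU l; have [_ _ h] := bS n; apply: (h l) En.
by rewrite nmBC; exact: lP.
Qed.

End HilbertComplete.

Section OpenMapping.
Context {R : realType} {D W Y : rhilbert R}.
Variables (E : {linear D -> W}) (L : {linear D -> Y}) (cE cL : R).
Hypothesis Eb : forall x, nm (E x) <= cE * nm x.
Hypothesis Lb : forall x, nm (L x) <= cL * nm x.
Hypothesis Lsurj : forall y, exists x, E x = 0 /\ L x = y.

Lemma bounded_closed (Z : rhilbert R) (f : {linear D -> Z}) (c : R) x z :
  (forall x, nm (f x) <= c * nm x) ->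
  (forall e : R, 0 < e -> exists2 y, nm (y - x) < e & nm (f y - z) <= e) -> f x = z.
Proof.
move=> fb h; apply/eqP; rewrite -subr_eq0; apply/eqP/nm_eq0/eqP.
rewrite eq_le nm_ge0 andbT; apply: (@le_eps _ _ _ (`|c| + 1)) => e e0.
have [y h1 h2] := h e e0; have := nm_trans (f y) (f x) z.
have := fb (x - y); rewrite linearB /= nmBC (nmBC x) => h3.
have : c * nm (y - x) <= `|c| * e.
  have := ler_norm c; have := nm_ge0 (y - x); have := normr_ge0 c; nra.
rewrite nmBC; lra.
Qed.

(** Open mapping theorem, for a bounded operator [L] that is onto when
    restricted to the kernel of another bounded operator [E]. *)
Lemma open_mapping : exists c : R, 0 < c /\
  forall y, exists x, [/\ E x = 0, L x = y & nm x <= c * nm y].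
Proof.
have [|n [y0 [r [r0 hr]]]] :=
    @baire_union _ Y (fun n y => exists x, [/\ E x = 0, L x = y & nm x <= n%:R]).
  move=> y; have [x [Ex Lx]] := Lsurj y; exists (Num.bound (nm x)), x.
  by split=> //; apply/ltW/archi_boundP/nm_ge0.
(* approximate solvability, first near 0 and then everywhere by homogeneity *)
have app0 y e : nm y < r -> 0 < e -> exists x, [/\ E x = 0, nm x <= 2 * n%:R &
    nm (L x - y) < e].
  move=> yr e0; have e20 : 0 < e / 2 by rewrite divr_gt0.
  have [|y1 [x1 [E1 L1 n1]] h1] := hr (y + y0) _ (e / 2) e20.
    by rewrite addrK.
  have [|y2 [x2 [E2 L2 n2]] h2] := hr y0 _ (e / 2) e20.
    by rewrite subrr nm0.
  exists (x1 - x2); split.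
  - by rewrite linearB E1 E2 subrr.
  - by have := nmB x1 x2; lra.
  rewrite linearB /= L1 L2.
  have -> : y1 - y2 - y = (y1 - (y + y0)) - (y2 - y0) by vring.
  by have := nmB (y1 - (y + y0)) (y2 - y0); lra.
pose c := 4 * n%:R / r + 1.
have c0 : 0 < c by rewrite ltr_wpDl // divr_ge0 ?(ltW r0) // mulr_ge0.
have app y : exists x, [/\ E x = 0, nm x <= c * nm y & nm (L x - y) <= nm y / 2].
  have [y0'|yN0] := eqVneq (nm y) 0.
    by exists 0; rewrite !linear0 nm0 y0' sub0r nmN y0'; split => //; lra.
  have yp : 0 < nm y by rewrite lt_neqAle eq_sym yN0 nm_ge0.
  pose a := r / (2 * nm y).
  have a0 : 0 < a by rewrite divr_gt0 // mulr_gt0.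
  have [||x [E1 n1 h1]] := app0 (a *: y) (r / 4).
  - rewrite nmZ gtr0_norm //.
    have -> : a * nm y = r / 2 by rewrite /a; field.
    lra.
  - lra.
  exists (a^-1 *: x); split.
  - by rewrite linearZ /= E1 scaler0.
  - rewrite nmZ gtr0_norm ?invr_gt0 // -ler_pdivlMl ?invr_gt0 // invrK.
    rewrite (le_trans n1) // /c /a.
    have -> : r / (2 * nm y) * ((4 * n%:R / r + 1) * nm y) = 2 * n%:R + r / 2.
      by field; rewrite yN0 gt_eqF.
    by lra.
  rewrite linearZ /=.
  have -> : a^-1 *: L x - y = a^-1 *: (L x - a *: y).
    by rewrite scalerBr scalerA mulVf ?lt0r_neq0 // scale1r.
  rewrite nmZ gtr0_norm ?invr_gt0 // -ler_pdivlMl ?invr_gt0 // invrK.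
  rewrite (le_trans (ltW h1)) // /a.
  have -> : r / (2 * nm y) * (nm y / 2) = r / 4 by field.
  by [].
exists (2 * c); split; first by rewrite mulr_gt0.
(* iterative correction *)
move=> y; have [g gP] := choice app.
pose rest := fix rest k := if k is k'.+1 then rest k' - L (g (rest k')) else y.
pose x := fix x k := if k is k'.+1 then x k' + g (rest k') else 0.
have rb k : nm (rest k) <= (1 / 2) ^+ k * nm y.
  elim: k => [|k ih] /=; first by rewrite expr0 mul1r.
  have [_ _ h] := gP (rest k); rewrite nmBC exprS -mulrA; lra.
have xL k : L (x k) = y - rest k.
  elim: k => [|k ih] /=; first by rewrite linear0 subrr.
  by rewrite linearD ih opprB addrA addrAC.
have xE k : E (x k) = 0.
  elim: k => [|k ih] /=; first by rewrite linear0.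
  by have [h _ _] := gP (rest k); rewrite linearD ih h addr0.
have xd m k : nm (x k - x (k + m)%N) <= 2 * c * nm y * ((1 / 2) ^+ k - (1 / 2) ^+ (k + m)).
  elim: m => [|m ih]; first by rewrite addn0 !subrr nm0 mulr0.
  apply: le_trans (nm_trans (x (k + m)%N) _ _) _; rewrite addnS /=.
  have -> : x (k + m)%N - (x (k + m)%N + g (rest (k + m)%N)) = - g (rest (k + m)%N).
    by vring.
  rewrite nmN; have [_ h _] := gP (rest (k + m)%N); have := rb (k + m)%N.
  move: ih h; rewrite (exprS _ (k + m)) -/(x (k + m)%N).
  set p := (1 / 2) ^+ (k + m) => ih h h2.
  have : c * nm (rest (k + m)%N) <= c * (p * nm y) by rewrite ler_wpM2l // ltW.
  lra.
have cy : 0 <= 2 * c * nm y by rewrite !mulr_ge0 ?nm_ge0 ?(ltW c0).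
have [||l lP] := @complete_rate _ _ x (fun k => 2 * c * nm y * (1 / 2) ^+ k).
- move=> e e0; have [|||k hk] := @expr_small R (1 / 2) (e / (2 * c * nm y + 1)).
  + lra.
  + lra.
  + by rewrite divr_gt0 // ltr_wpDl.
  exists k; rewrite ltr_pdivlMr ?ltr_wpDl // in hk.
  have : 0 <= (1 / 2 : R) ^+ k by rewrite exprn_ge0.
  nra.
- move=> k m km; have := xd (m - k)%N k; rewrite subnKC // => /le_trans; apply.
  by rewrite ler_wpM2l // lerBlDr lerDl exprn_ge0.
have lapp e : 0 < e -> exists2 k, nm (x k - l) < e & nm (rest k) < e.
  move=> e0; pose d := 2 * c * nm y + nm y + 1.
  have d0 : 0 < d by rewrite ltr_wpDl // addr_ge0 ?nm_ge0.
  have [|||k hk] := @expr_small R (1 / 2) (e / d); [lra|lra|exact: divr_gt0|].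
  have p0 : 0 <= (1 / 2 : R) ^+ k by rewrite exprn_ge0.
  rewrite ltr_pdivlMr // /d in hk; have := lP k; have := rb k; have := nm_ge0 y.
  by exists k; nra.
exists l; split.
- apply: (bounded_closed Eb) => e e0; have [k h1 h2] := lapp e e0.
  by exists (x k) => //; rewrite xE subrr nm0 ltW.
- apply: (bounded_closed Lb) => e e0; have [k h1 h2] := lapp e e0.
  exists (x k) => //; rewrite xL; have -> : y - rest k - y = - rest k by vring.
  by rewrite nmN ltW.
- by have := lP 0%N; rewrite expr0 mulr1 /= sub0r nmN.
Qed.

End OpenMapping.

(** * Maximal monotone operators *)

(** The graph of a single-valued operator on a real Hilbert space.  In the last
    field, [I + h M] is onto for every [h > 0]: by Minty's theorem this is
    maximality. *)
Record maximal_monotone (R : realType) (V : rhilbert R) (M : V -> V -> Prop) :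
    Prop := MaximalMonotone {
  mm_mon : forall x v y w, M x v -> M y w -> 0 <= dot (v - w) (x - y);
  mm_fun : forall x v w, M x v -> M x w -> v = w;
  mm_range : forall h : R, 0 < h -> forall z, exists x v,
    M x v /\ x + h *: v = z }.

Section MaximalMonotone.
Context {R : realType} {V : rhilbert R} (M : V -> V -> Prop).
Hypothesis hM : maximal_monotone M.
Implicit Types (x y v w b z g : V) (h e : R).

Lemma maximal_monotone_shift g : maximal_monotone (fun x w => M x (w + g)).
Proof.
split.
- move=> x v y w Mv Mw; have := mm_mon hM Mv Mw.
  by have -> : v + g - (w + g) = v - w by vring.
- by move=> x v w Mv Mw; apply: (addIr g); exact: mm_fun Mv Mw.
- move=> h h0 z; have [x [v [Mv e]]] := mm_range hM h0 (z + h *: g).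
  exists x, (v - g); rewrite subrK; split=> //; apply: (addIr (h *: g)).
  by rewrite -e; vring.
Qed.

Lemma resolvent_le h x v y w : 0 <= h -> M x v -> M y w ->
  nm (x - y) <= nm (x + h *: v - (y + h *: w)).
Proof.
move=> h0 Mv Mw; apply: le_nm => //; rewrite sqr_nm.
have -> : x + h *: v - (y + h *: w) = (x - y) + h *: (v - w) by vring.
have := mm_mon hM Mv Mw; move: (x - y) (v - w) => a b ab.
rewrite !dotE [dot a b]dotC; have := dot_ge0 b.
have : 0 <= h * dot b a by rewrite mulr_ge0.
nra.
Qed.

(** The Yosida approximation [b] of the value [v] at [x] is shorter than [v],
    and its distance to [v] is controlled by the defect of length. *)
Lemma yosida_le h x v y b : 0 < h -> M x v -> M y b -> y + h *: b = x ->
  dot (b - v) (b - v) <= dot v v - dot b b.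
Proof.
move=> h0 Mv Mb e; have := mm_mon hM Mv Mb.
have -> : x - y = h *: b by rewrite -e; vring.
rewrite dotZr pmulr_rge0 // !dotE [dot b v]dotC; lra.
Qed.

Lemma yosida_nm_le h x v y b : 0 < h -> M x v -> M y b -> y + h *: b = x ->
  nm b <= nm v.
Proof.
move=> h0 Mv Mb e; apply: le_nm => //; rewrite sqr_nm.
have := yosida_le h0 Mv Mb e; have := dot_ge0 (b - v); lra.
Qed.

(** Lengths of Yosida approximations increase as the parameter decreases, and
    their distance is controlled by the gain of length. *)
Lemma yosida_cauchy h k x y b y' b' : 0 < k -> k <= h -> M y b -> M y' b' ->
  y + h *: b = x -> y' + k *: b' = x ->
  dot (b - b') (b - b') <= dot b' b' - dot b b.
Proof.
move=> k0 kh Mb Mb' <- e; have := mm_mon hM Mb Mb'.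
have -> : y - y' = k *: b' - h *: b.
  by rewrite -[y'](addrK (k *: b')) e; vring.
rewrite !dotE [dot b' b]dotC => h1.
have h2 := dot_le b b'; rewrite -!sqr_nm in h1 *.
have nn : nm b <= nm b'.
  rewrite leNgt; apply/negP => lt.
  have p1 : 0 <= (h - k) * nm b' by rewrite mulr_ge0 ?nm_ge0 // subr_ge0.
  have p2 : 0 < nm b - nm b' by lra.
  have p3 : 0 < h * nm b - k * nm b' by nra.
  nra.
have : 0 <= (h + k) * (dot b b' - nm b ^+ 2).
  have : 0 <= k * (nm b' ^+ 2 - nm b ^+ 2).
    by rewrite mulr_ge0 ?(ltW k0) // subr_ge0 ler_sqr ?nnegrE.
  lra.
rewrite pmulr_rge0; lra.
Qed.

Lemma graph_closed x v :
  (forall e, 0 < e -> exists y b, [/\ M y b, nm (y - x) < e & nm (b - v) < e]) ->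
  M x v.
Proof.
move=> h; have [y [w [Mw yw]]] := mm_range hM ltr01 (x + v).
suff xy : x = y.
  by move: yw Mw; rewrite scale1r -xy => /addrI ->.
apply/eqP; rewrite -subr_eq0; apply/eqP/nm_eq0/eqP.
rewrite eq_le nm_ge0 andbT; apply: (@le_eps _ _ _ 3) => e e0.
have [y' [b [Mb h1 h2]]] := h e e0.
have := resolvent_le ler01 Mb Mw; rewrite yw scale1r.
have -> : y' + b - (x + v) = (y' - x) + (b - v) by vring.
have := nmD (y' - x) (b - v); have := nm_trans y' x y; rewrite (nmBC x y'); lra.
Qed.

(** A point belongs to the domain as soon as its Yosida approximations stay
    bounded, and they then converge strongly to the value of the operator. *)
Lemma yosida_bounded x (C : R) : 0 <= C ->
  (forall h y b, 0 < h -> M y b -> y + h *: b = x -> nm b <= C) ->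
  exists v, [/\ M x v, nm v <= C & forall e, 0 < e ->
    exists h y b, [/\ 0 < h, M y b, y + h *: b = x & nm (b - v) < e]].
Proof.
move=> C0 bC.
have lam0 n : 0 < n.+1%:R^-1 :> R by rewrite invr_gt0.
have /choice[y] : forall n : nat, exists y, exists b,
    M y b /\ y + n.+1%:R^-1 *: b = x by move=> n; exact: mm_range.
move=> /choice[b ybP].
have bb n m : (n <= m)%N ->
    dot (b n - b m) (b n - b m) <= dot (b m) (b m) - dot (b n) (b n).
  move=> nm_; have [Mn en] := ybP n; have [Mm em] := ybP m.
  by apply: yosida_cauchy Mn Mm en em; rewrite ?lef_pV2 ?posrE ?ler_nat.
pose E := range (fun n => dot (b n) (b n)).
have Eub : ubound E (C ^+ 2).
  move=> _ [n _ <-]; have [Mn en] := ybP n; rewrite -sqr_nm.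
  by rewrite ler_sqr ?nnegrE ?nm_ge0 //; exact: bC (lam0 n) Mn en.
have Eb n : dot (b n) (b n) <= sup E.
  by apply: ub_le_sup; [exists (C ^+ 2)|exists n].
have Es : has_sup E by split; [exists (dot (b 0%N) (b 0%N)), 0%N|exists (C ^+ 2)].
pose r n := Num.sqrt (sup E - dot (b n) (b n)).
have rsmall e : 0 < e -> exists n, r n < e.
  move=> e0; have e20 : 0 < e ^+ 2 by rewrite exprn_gt0.
  have [_ [n _ <-] hn] := sup_adherent e20 Es.
  exists n; rewrite -[ltRHS]ger0_norm ?(ltW e0) // -sqrtr_sqr ltr_sqrt //; lra.
have rmono n m : (n <= m)%N -> r m <= r n.
  move=> nm_; apply: ler_wsqrtr; rewrite lerB //.
  by have := bb n m nm_; have := dot_ge0 (b n - b m); lra.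
have [|v vP] := complete_rate (u := b) rsmall.
  move=> n m nm_; apply: le_nm; first exact: sqrtr_ge0.
  rewrite sqr_sqrtr ?subr_ge0 //; have := bb n m nm_; have := Eb m; lra.
have app e : 0 < e -> exists n, n.+1%:R^-1 < e /\ nm (b n - v) < e.
  move=> e0; have [n1 h1] := inv_small e0; have [n2 h2] := rsmall e e0.
  exists (maxn n1 n2); split.
    by apply: le_lt_trans h1; rewrite lef_pV2 ?posrE // ler_nat ltnS leq_maxl.
  apply: le_lt_trans (vP _) _; apply: le_lt_trans h2; apply: rmono.
  exact: leq_maxr.
exists v; split.
- apply: graph_closed => e e0.
  have d0 : 0 < e / (C + 1) by rewrite divr_gt0 // ltr_wpDl.
  have [|n [h1 h2]] := app (Num.min e (e / (C + 1))).
    by rewrite lt_min e0.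
  move: h1 h2; rewrite !lt_min => /andP[_ h1] /andP[h2 _].
  have [Mn en] := ybP n; exists (y n), (b n); split => //.
  rewrite -en; have -> : y n - (y n + n.+1%:R^-1 *: b n) = - (n.+1%:R^-1 *: b n).
    by vring.
  rewrite nmN nmZ gtr0_norm //.
  have := bC _ _ _ (lam0 n) Mn en; have := nm_ge0 (b n).
  move: h1; rewrite ltr_pdivlMr ?ltr_wpDl //; have := lam0 n.
  move: (n.+1%:R^-1) => i; nra.
- apply: (@le_eps _ _ _ 1) => e e0; have [n [_ h2]] := app e e0.
  have [Mn en] := ybP n; have := bC _ _ _ (lam0 n) Mn en.
  have := nm_le_add v (b n); rewrite nmBC; lra.
- move=> e e0; have [n [_ h2]] := app e e0; have [Mn en] := ybP n.
  by exists n.+1%:R^-1, (y n), (b n).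
Qed.

Lemma yosida_cvg x v e : M x v -> 0 < e ->
  exists h y b, [/\ 0 < h, M y b, y + h *: b = x & nm (b - v) < e].
Proof.
move=> Mv e0; have [||w [Mw _ h]] := @yosida_bounded x (nm v).
- exact: nm_ge0.
- by move=> h y b h0 Mb e1; exact: yosida_nm_le h0 Mv Mb e1.
- by rewrite (mm_fun hM Mv Mw); exact: h.
Qed.

Lemma yosida_lip h x x' y b y' b' : 0 < h -> M y b -> M y' b' ->
  y + h *: b = x -> y' + h *: b' = x' -> nm (b - b') <= 2 / h * nm (x - x').
Proof.
move=> h0 Mb Mb' <- <-; have := resolvent_le (ltW h0) Mb Mb'.
set d := y + _ - _ => h1.
have -> : b - b' = h^-1 *: (d - (y - y')).
  by rewrite /d; vfield; rewrite gt_eqF.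
rewrite nmZ gtr0_norm ?invr_gt0 // mulrAC [leRHS]mulrC ler_wpM2l ?invr_ge0 ?(ltW h0) //.
by have := nmB d (y - y'); lra.
Qed.

(** Along points converging to [x], values whose length does not exceed that of
    the value [v] at [x] in the limit converge strongly to [v]. *)
Lemma strong_value x v e : M x v -> 0 < e -> exists2 eta, 0 < eta &
  forall y b, M y b -> nm (y - x) < eta -> nm b <= nm v + eta -> nm (b - v) < e.
Proof.
move=> Mv e0; pose n1 := nm v + 1.
have n10 : 0 < n1 by rewrite ltr_wpDl.
have [||d [d0 d1 d2]] := @pos_below2 _ (e / 8) (e ^+ 2 / (64 * n1)).
- by rewrite divr_gt0.
- by rewrite divr_gt0 ?mulr_gt0 ?exprn_gt0.
rewrite ler_pdivlMr ?mulr_gt0 // in d2.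
have [h [y0 [b0 [h0 M0 e1 b0v]]]] := yosida_cvg Mv d0.
have dh0 : 0 < d * h / 2 by rewrite divr_gt0 // mulr_gt0.
have [eta [eta0 eta1 eta2 eta3]] := pos_below3 ltr01 d0 dh0.
exists eta => // y b Mb yx bv.
have [y1 [b1 [M1 e2]]] := mm_range hM h0 y.
have l1 := yosida_lip h0 M1 M0 e2 e1.
have l2 : 2 / h * nm (y - x) <= d.
  rewrite mulrAC ler_pdivrMr //; lra.
have l3 := yosida_le h0 Mb M1 e2; have l4 := yosida_nm_le h0 Mb M1 e2.
have l5 : nm v <= nm b1 + 2 * d.
  have := nm_le_add v b0; have := nm_le_add b0 b1.
  rewrite (nmBC b0 b1) (nmBC v); lra.
have l6 : nm (b1 - b) <= e / 2.
  apply: le_nm; first by lra.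
  rewrite -!sqr_nm in l3 *; apply: le_trans l3 _.
  have l7 : nm b ^+ 2 - nm b1 ^+ 2 <= 3 * d * (2 * n1).
    have -> : nm b ^+ 2 - nm b1 ^+ 2 = (nm b - nm b1) * (nm b + nm b1) by ring.
    by have w1 := nm_ge0 b; have w2 := nm_ge0 b1; apply: ler_pM; rewrite /n1;
      move: eta1 eta2 bv l4 l5 w2; goal_lra.
  apply: le_trans l7 _; have -> : (e / 2) ^+ 2 = e ^+ 2 / 4 by field.
  have := mulr_ge0 (ltW d0) (ltW n10); lra.
have := nm_trans b1 b v; have := nm_trans b0 b1 v; rewrite (nmBC b b1); lra.
Qed.

End MaximalMonotone.

(** * The semi-implicit Euler scheme *)

Lemma discrete_gronwall (R : realType) (a : nat -> R) (c h b : R) (n : nat) :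
  0 <= c -> 0 <= h -> 0 <= b -> 0 <= a 0%N ->
  (forall k, (k < n)%N -> a k.+1 <= (1 + h * c) * a k + h * b) ->
  a n <= expR (c * (n%:R * h)) * (a 0%N + n%:R * h * b).
Proof.
move=> c0 h0 b0 a0; elim: n => [|n ih] ha.
  by rewrite !mul0r mulr0 expR0 mul1r addr0.
have := ih (fun k kn => ha k (ltnW kn)); have := ha n (ltnSn n).
set E := expR (c * (n%:R * h)) => h1 h2.
have -> : c * (n.+1%:R * h) = c * (n%:R * h) + h * c by rewrite -natr1; ring.
rewrite expRD -/E -natr1.
have E1 : 1 <= E by rewrite -expR0 ler_expR !mulr_ge0.
have F1 : 1 + h * c <= expR (h * c) by exact: expR_ge1Dx.
have hc : 0 <= h * c by rewrite mulr_ge0.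
have hb : 0 <= h * b by rewrite mulr_ge0.
set S := a 0%N + n%:R * h * b in h2 *.
have S0 : 0 <= S by rewrite addr_ge0 // !mulr_ge0.
have -> : a 0%N + (n%:R + 1) * h * b = S + h * b by rewrite /S; ring.
have ES : 0 <= E * S by rewrite mulr_ge0 //; lra.
have p1 : (1 + h * c) * a n <= (1 + h * c) * (E * S) by apply: ler_wpM2l => //; lra.
have p2 : (1 + h * c) * (E * S) <= expR (h * c) * (E * S) by exact: ler_wpM2r.
have p3 : h * b <= E * expR (h * c) * (h * b).
  by rewrite -[leLHS]mul1r ler_wpM2r // mulr_ege1 //; lra.
apply: le_trans h1 _; rewrite mulrDr; lra.
Qed.

Section Euler.
Context {R : realType} {V : rhilbert R} (M : V -> V -> Prop).
Hypothesis hM : maximal_monotone M.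
Variables (G : R -> V -> V) (L T : R) (x0 v0 : V).
Hypotheses (L0 : 0 <= L) (T0 : 0 < T) (Mx0 : M x0 v0).
Hypothesis GL : forall s t x y,
  nm (G t x - G s y) <= L * nm (x - y) + L * (1 + nm x) * `|t - s|.

(** One step solves [x' + h M x' = x + h G(t, x)]; [W] records the values of [M]. *)
Definition euler (h : R) (X W : nat -> V) : Prop :=
  [/\ X 0%N = x0, W 0%N = v0, forall k, M (X k) (W k) &
      forall k, X k.+1 + h *: W k.+1 = X k + h *: G (k%:R * h) (X k)].

Lemma euler_exists h : 0 < h -> exists X W, euler h X W.
Proof.
move=> h0; have /choice[J JP] : forall z : V, exists p : V * V,
    M p.1 p.2 /\ p.1 + h *: p.2 = z.
  by move=> z; have [x [v [Mv e]]] := mm_range hM h0 z; exists (x, v).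
pose s := fix s k := if k is j.+1 then J ((s j).1 + h *: G (j%:R * h) (s j).1)
                     else (x0, v0).
exists (fun k => (s k).1), (fun k => (s k).2); split=> //.
  by case=> [|k] //=; have [] := JP ((s k).1 + h *: G (k%:R * h) (s k).1).
by move=> k /=; have [_] := JP ((s k).1 + h *: G (k%:R * h) (s k).1).
Qed.

Lemma euler_shift h X W k m : 0 < h -> euler h X W ->
  nm (X (k.+1 + m)%N - X k.+1) <=
  (1 + h * L) * nm (X (k + m)%N - X k) + h * (L * (1 + nm (X k)) * (m%:R * h)).
Proof.
move=> h0 [_ _ MX XS]; rewrite addSn.
apply: le_trans (resolvent_le hM (ltW h0) (MX _) (MX _)) _.
rewrite !XS; set g := G _ (X (k + m)%N); set g' := G _ (X k).
have -> : X (k + m)%N + h *: g - (X k + h *: g') =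
  (X (k + m)%N - X k) + h *: (g - g') by vring.
have := nmD (X (k + m)%N - X k) (h *: (g - g')); rewrite nmZ gtr0_norm //.
have := GL ((k + m)%:R * h) (k%:R * h) (X k) (X (k + m)%N).
have -> : k%:R * h - (k + m)%:R * h = - (m%:R * h) by rewrite natrD; ring.
rewrite normrN ger0_norm ?mulr_ge0 ?(ltW h0) // nmBC -/g -/g' (nmBC (X k)) => h1.
have := ler_wpM2l (ltW h0) h1; lra.
Qed.

Lemma euler_ball h X W k : 0 < h -> euler h X W -> k%:R * h <= T ->
  nm (X k - x0) <= expR (L * T) * (T * (nm (G 0 x0 - v0) + L * (1 + nm x0) * T)).
Proof.
move=> h0 [X0 W0 MX XS] kT; set b := nm (G 0 x0 - v0) + _.
have b0 : 0 <= b by rewrite addr_ge0 // !mulr_ge0 ?(ltW T0) // addr_ge0.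
have := @discrete_gronwall R (fun j => nm (X j - x0)) L h b k L0 (ltW h0) b0.
rewrite X0 subrr nm0 add0r => /(_ (lexx _)) H; apply: le_trans (H _) _ => [j jk|].
  apply: le_trans (resolvent_le hM (ltW h0) (MX _) Mx0) _; rewrite XS.
  set g := G _ _.
  have -> : X j + h *: g - (x0 + h *: v0) = (X j - x0) + h *: (g - v0) by vring.
  have := nmD (X j - x0) (h *: (g - v0)); rewrite nmZ gtr0_norm //.
  have := GL (j%:R * h) 0 x0 (X j); rewrite sub0r normrN ger0_norm ?mulr_ge0 ?(ltW h0) //.
  rewrite nmBC (nmBC x0) -/g => h1; have h2 := nm_trans (G 0 x0) g v0.
  have jT : j%:R * h <= T.
    by apply: le_trans kT; rewrite ler_wpM2r ?(ltW h0) // ler_nat ltnW.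
  have : L * (1 + nm x0) * (j%:R * h) <= L * (1 + nm x0) * T.
    by apply: ler_wpM2l => //; rewrite mulr_ge0 // addr_ge0.
  move=> h3; have h4 : nm (g - v0) <= L * nm (X j - x0) + b by rewrite /b; lra.
  have := ler_wpM2l (ltW h0) h4; lra.
have kh0 : 0 <= k%:R * h by rewrite mulr_ge0 ?(ltW h0).
apply: ler_pM; rewrite ?mulr_ge0 ?expR_ge0 ?(ltW h0) //.
  by rewrite ler_expR ler_wpM2l.
by rewrite ler_wpM2r.
Qed.

(** A priori bounds, uniform in the step. *)
Lemma euler_bounds : exists2 C : R, 0 < C & forall (h : R) X W, 0 < h -> h <= T ->
  euler h X W -> forall k, k%:R * h <= T ->
  [/\ nm (X k) <= C, nm (X k.+1 - X k) <= C * h, nm (W k) <= C,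
      nm (W k.+1) <= C & nm (G (k%:R * h) (X k)) <= C].
Proof.
pose r := expR (L * T) * (T * (nm (G 0 x0 - v0) + L * (1 + nm x0) * T)).
have r0 : 0 <= r.
  rewrite !mulr_ge0 ?expR_ge0 ?(ltW T0) // addr_ge0 // !mulr_ge0 ?(ltW T0) //.
  by rewrite addr_ge0.
pose b := L * (1 + (nm x0 + r)).
have b0 : 0 <= b by rewrite mulr_ge0 // !addr_ge0.
pose c1 := expR (L * T) * (nm (G 0 x0 - v0) + T * b).
have c10 : 0 <= c1.
  by rewrite mulr_ge0 ?expR_ge0 // addr_ge0 // mulr_ge0 ?(ltW T0).
pose g := nm (G 0 x0) + L * r + L * (1 + nm x0) * T.
have g0 : 0 <= g.
  have Lr := mulr_ge0 L0 r0; have : 0 <= L * (1 + nm x0) * T.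
    by rewrite !mulr_ge0 ?(ltW T0) // addr_ge0.
  by have := nm_ge0 (G 0 x0); rewrite /g; lra.
exists (nm x0 + r + c1 + g + nm v0 + 1).
  by have := nm_ge0 x0; have := nm_ge0 v0; lra.
move=> h X W h0 hT hX.
have Xb k : k%:R * h <= T -> nm (X k) <= nm x0 + r.
  move=> kT; have := euler_ball h0 hX kT; rewrite -/r.
  have := nm_le_add (X k) x0; lra.
have Gb k : k%:R * h <= T -> nm (G (k%:R * h) (X k)) <= g.
  move=> kT; have := GL (k%:R * h) 0 x0 (X k).
  rewrite sub0r normrN ger0_norm ?mulr_ge0 ?(ltW h0) // nmBC (nmBC x0) => h1.
  have := nm_le_add (G (k%:R * h) (X k)) (G 0 x0).
  have : L * (1 + nm x0) * (k%:R * h) <= L * (1 + nm x0) * T.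
    by apply: ler_wpM2l => //; rewrite mulr_ge0 // addr_ge0.
  have := ler_wpM2l L0 (euler_ball h0 hX kT); rewrite /g -/r; lra.
have [X0 W0 MX XS] := hX.
have Xd k : k%:R * h <= T -> nm (X k.+1 - X k) <= c1 * h.
  move=> kT.
  have := @discrete_gronwall R (fun j => nm (X (j + 1)%N - X j)) L h (b * h) k L0 (ltW h0).
  have hb : 0 <= b * h by rewrite mulr_ge0 // ltW.
  move=> /(_ hb (nm_ge0 _)) H; rewrite -addn1.
  apply: le_trans (H _) _ => [j jk|].
    apply: le_trans (euler_shift j 1 h0 hX) _; rewrite mul1r lerD2l.
    rewrite ler_wpM2l ?(ltW h0) // ler_wpM2r ?(ltW h0) // /b ler_wpM2l // lerD2l.
    apply: Xb; apply: le_trans kT.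
    by rewrite ler_wpM2r ?(ltW h0) // ler_nat ltnW.
  have X1 : nm (X (0 + 1)%N - X 0%N) <= h * nm (G 0 x0 - v0).
    rewrite X0; apply: le_trans (resolvent_le hM (ltW h0) (MX _) Mx0) _.
    rewrite add0n XS mul0r X0.
    have -> : x0 + h *: G 0 x0 - (x0 + h *: v0) = h *: (G 0 x0 - v0) by vring.
    by rewrite nmZ gtr0_norm.
  have kh0 : 0 <= k%:R * h by rewrite mulr_ge0 ?(ltW h0).
  have -> : c1 * h = expR (L * T) * ((nm (G 0 x0 - v0) + T * b) * h).
    by rewrite /c1; ring.
  apply: ler_pM; rewrite ?expR_ge0 //.
  - by rewrite addr_ge0 // mulr_ge0.
  - by rewrite ler_expR ler_wpM2l.
  - have := ler_wpM2r hb kT; lra.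
have Wb k : k%:R * h <= T -> nm (W k.+1) <= c1 + g.
  move=> kT; have -> : W k.+1 = G (k%:R * h) (X k) - h^-1 *: (X k.+1 - X k).
    have -> : X k.+1 = X k + h *: G (k%:R * h) (X k) - h *: W k.+1.
      by rewrite -XS; vring.
    by vfield; rewrite gt_eqF.
  apply: le_trans (nmB _ _) _; rewrite nmZ gtr0_norm ?invr_gt0 //.
  have := Gb k kT; have := Xd k kT; rewrite -ler_pdivrMr // mulrC; lra.
move=> k kT; have := Xb k kT; have := Xd k kT; have := Gb k kT; have := Wb k kT.
have := nm_ge0 x0; have := nm_ge0 v0 => w0 w1 w2 w3 w4 w5.
split; [move: r0 c10 g0 w0 w1 w2 w3 w5; goal_lra| |case: k kT {w2 w3 w4 w5} => [|k] kT|move: r0 c10 g0 w0 w1 w2 w3 w5; goal_lra|move: r0 c10 g0 w0 w1 w2 w3 w5;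
  goal_lra].
- apply: le_trans w4 _; rewrite ler_wpM2r ?(ltW h0) //; lra.
- by rewrite W0; lra.
- have := Wb k (le_trans _ kT); rewrite ler_wpM2r ?(ltW h0) ?ler_nat //.
  by move=> /(_ isT); lra.
Qed.

End Euler.

Lemma truncn_div (R : realType) (x : R) (p : nat) : 0 <= x -> (0 < p)%N ->
  (Num.truncn x %/ p)%N = Num.truncn (x / p%:R).
Proof.
move=> x0 p0; apply/esym/truncn_def; have /andP[h1 h2] := truncn_itv x0.
have p0' : 0 < p%:R :> R by rewrite ltr0n.
apply/andP; split.
  rewrite ler_pdivlMr // (le_trans _ h1) // -natrM ler_nat; exact: leq_divM.
rewrite ltr_pdivrMr // (lt_le_trans h2) // -natrM ler_nat.
exact: ltn_ceil.
Qed.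

Section EulerLimit.
Context {R : realType} {V : rhilbert R} (M : V -> V -> Prop).
Hypothesis hM : maximal_monotone M.
Variables (G : R -> V -> V) (L T : R) (x0 v0 : V).
Hypotheses (L0 : 0 <= L) (T0 : 0 < T) (Mx0 : M x0 v0).
Hypothesis GL : forall s t x y,
  nm (G t x - G s y) <= L * nm (x - y) + L * (1 + nm x) * `|t - s|.

Local Notation euler := (euler M G x0 v0).

(** Comparison of a scheme with a refinement of it, by the energy method: the
    piecewise linear interpolant of the coarse scheme is compared with the fine
    one, and monotonicity leaves only the distance of the interpolant to the
    coarse scheme, which is of the order of the step. *)
Lemma euler_compare : exists2 K : R, 0 < K & forall (h : R) p X W Y Z,
  0 < h -> h <= T -> (0 < p)%N -> euler h X W -> euler (h / p%:R) Y Z ->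
  forall j, j%:R * (h / p%:R) <= T ->
  nm (X (j %/ p)%N - Y j) <= K * Num.sqrt h.
Proof.
have [C C0 CP] := euler_bounds hM L0 T0 Mx0 GL.
pose D := L * C + L * (1 + C); pose E := 4 * L * C + 2 * D.
pose c := 2 * L + T * E; pose b := E + 4 * T * D * C + 4 * C ^+ 2.
have L0' := L0; have T0' := T0; have LC : 0 <= L * C by rewrite mulr_ge0 // ltW.
have D0 : 0 <= D by rewrite /D; lra.
have DC : 0 <= D * C by rewrite mulr_ge0 // ltW.
have E0 : 0 <= E by rewrite /E; lra.
have TE : 0 <= T * E by rewrite mulr_ge0 // ltW.
have TDC : 0 <= T * D * C by rewrite !mulr_ge0 // ltW.
have c0 : 0 <= c by rewrite /c; lra.
have b0 : 0 <= b by have := sqr_ge0 C; rewrite /b; lra.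
pose K2 := expR (c * T) * (T * b).
have K20 : 0 <= K2 by rewrite !mulr_ge0 ?expR_ge0 // ltW.
exists (Num.sqrt K2 + C * Num.sqrt T).
  by rewrite ltr_wpDl ?sqrtr_ge0 // mulr_gt0 // sqrtr_gt0.
move=> h p X W Y Z h0 hT p0 hX hY; set d := h / p%:R => j jT.
have pr0 : 0 < p%:R :> R by rewrite ltr0n.
have pr1 : 1 <= p%:R :> R by rewrite ler1n.
have d0 : 0 < d by rewrite divr_gt0.
have dh : d <= h by rewrite ler_pdivrMr // ler_peMr // ltW.
have hpd : h = p%:R * d by rewrite /d; field; rewrite gt_eqF.
have [_ _ MX XS] := hX; have [_ _ MY YS] := hY; rewrite -/d in YS.
pose lin k i := X k + (i%:R / p%:R) *: (X k.+1 - X k).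
have frac i : (i <= p)%N -> 0 <= (i%:R / p%:R : R) <= 1.
  by move=> ip; rewrite divr_ge0 // ler_pdivrMr // mul1r ler_nat.
have linE k i : (i <= p)%N -> k%:R * h <= T ->
    nm (lin k i - X k) <= h * C /\ nm (X k.+1 - lin k i) <= h * C.
  move=> ip kT; have [_ Xd _ _ _] := CP _ _ _ h0 hT hX k kT.
  have /andP[f0 f1] := frac i ip; have := nm_ge0 (X k.+1 - X k) => n0.
  have -> : lin k i - X k = (i%:R / p%:R) *: (X k.+1 - X k).
    by rewrite /lin; move: (i%:R / p%:R) => f; vring.
  have -> : X k.+1 - lin k i = (1 - i%:R / p%:R) *: (X k.+1 - X k).
    by rewrite /lin; move: (i%:R / p%:R) => f; vring.
  rewrite !nmZ !ger0_norm ?subr_ge0 //.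
  by move: (i%:R / p%:R) f0 f1 => f f0 f1; split; nra.
have step k i : (i < p)%N -> let j := (k * p + i)%N in j%:R * d <= T ->
    dot (lin k i.+1 - Y j.+1) (lin k i.+1 - Y j.+1) <=
    (1 + d * c) * dot (lin k i - Y j) (lin k i - Y j) + d * (h * b).
  move=> ip /=; set l := (k * p + i)%N => lT.
  have lE : l%:R * d = k%:R * h + i%:R * d.
    by rewrite /l natrD natrM hpd; ring.
  have id0 : 0 <= i%:R * d by rewrite mulr_ge0 // ltW.
  have idh : i%:R * d <= h by rewrite hpd ler_wpM2r ?(ltW d0) // ler_nat ltnW.
  have kT : k%:R * h <= T by move: lT id0; goal_lra.
  have [X1 X2 _ X3 _] := CP _ _ _ h0 hT hX k kT.
  have [_ Y2 _ Y3 _] := CP _ _ _ d0 (le_trans dh hT) hY l lT.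
  have [e1 _] := linE k i (ltnW ip) kT; have [_ e2] := linE k i.+1 ip kT.
  set w := lin k i - Y l; set w' := lin k i.+1 - Y l.+1.
  set g := G (k%:R * h) (X k); set g' := G (l%:R * d) (Y l).
  have gg : nm (g - g') <= L * nm w + h * D.
    have := GL (l%:R * d) (k%:R * h) (X k) (Y l); rewrite -/g -/g'.
    have -> : k%:R * h - l%:R * d = - (i%:R * d) by rewrite lE; ring.
    rewrite normrN ger0_norm // => h1; apply: le_trans h1 _.
    have h2 : nm (X k - Y l) <= nm w + h * C.
      by have := nm_trans (lin k i) (X k) (Y l); rewrite (nmBC (X k) (lin k i)) -/w;
        move: e1; goal_lra.
    have h3 := ler_wpM2l L0 h2.
    have h4 : L * (1 + nm (X k)) * (i%:R * d) <= L * (1 + C) * h.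
      apply: ler_pM => //; first by rewrite mulr_ge0 // addr_ge0.
      by rewrite ler_wpM2l // lerD2l.
    by rewrite /D; move: h3 h4; goal_lra.
  have ww : w' - w = d *: ((g - g') - (W k.+1 - Z l.+1)).
    have -> : w' - w = p%:R^-1 *: (X k.+1 - X k) - (Y l.+1 - Y l).
      rewrite /w' /w /lin -natr1; move: (i%:R) => f; vfield; rewrite gt_eqF //.
    have -> : X k.+1 = X k + h *: g - h *: W k.+1 by rewrite -XS; vring.
    have -> : Y l.+1 = Y l + d *: g' - d *: Z l.+1 by rewrite -YS; vring.
    by rewrite hpd; vfield; rewrite gt_eqF.
  have w'b : nm w' <= nm w + 2 * h * C.
    have -> : w' = w + (p%:R^-1 *: (X k.+1 - X k) - (Y l.+1 - Y l)).
      rewrite /w' /w /lin -natr1; move: (i%:R) => f; vfield; rewrite gt_eqF //.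
    apply: le_trans (nmD _ _) _; rewrite lerD2l.
    apply: le_trans (nmB _ _) _; rewrite nmZ gtr0_norm ?invr_gt0 //.
    have : p%:R^-1 * nm (X k.+1 - X k) <= nm (X k.+1 - X k).
      by rewrite ler_piMl // invf_le1.
    have : C * d <= C * h by rewrite ler_wpM2l // ltW.
    move: X2 Y2; goal_lra.
  have mono := mm_mon hM (MX k.+1) (MY l.+1).
  have w'E : X k.+1 - Y l.+1 = w' + (X k.+1 - lin k i.+1) by rewrite /w'; vring.
  rewrite w'E dotDr in mono.
  have ab : nm (W k.+1 - Z l.+1) <= 2 * C.
    by apply: le_trans (nmB _ _) _; move: X3 Y3; goal_lra.
  have h5 : dot (W k.+1 - Z l.+1) (X k.+1 - lin k i.+1) <= 2 * C * (h * C).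
    by apply: le_trans (dot_le _ _) _; apply: ler_pM.
  have h6 : dot (g - g') w' <= (L * nm w + h * D) * (nm w + 2 * h * C).
    by apply: le_trans (dot_le _ _) _; apply: ler_pM.
  have h7 : dot (w' - w) w' <=
      d * ((L * nm w + h * D) * (nm w + 2 * h * C) + 2 * C * (h * C)).
    rewrite ww dotZl ler_wpM2l ?(ltW d0) // dotDl dotNl;
      move: mono h5 h6; goal_lra.
  have h8 : dot w' w' <= dot w w + 2 * dot (w' - w) w'.
    have := dot_ge0 (w' - w); move: (w) (w') => w1 w2.
    by rewrite !dotE [dot w1 w2]dotC; goal_lra.
  have h9 : 2 * ((L * nm w + h * D) * (nm w + 2 * h * C) + 2 * C * (h * C))
      <= c * dot w w + h * b.
    rewrite -sqr_nm /c /b; have := nm_ge0 w; move: (nm w) => n n0.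
    have n1 : h * n * E <= h * E + T * E * n ^+ 2.
      have : h * n * E <= h * (1 + n ^+ 2) * E.
        rewrite ler_wpM2r // ler_wpM2l ?(ltW h0) //; nra.
      have : h * (E * n ^+ 2) <= T * (E * n ^+ 2).
        by rewrite ler_wpM2r // mulr_ge0 // sqr_ge0.
      goal_lra.
    have n2 : 4 * h * (h * (D * C)) <= 4 * h * (T * (D * C)).
      by rewrite ler_wpM2l ?ler_wpM2r //; move: id0 idh; goal_lra.
    rewrite /E in n1 *; move: n1 n2; goal_lra.
  have h10 := ler_wpM2l (ltW d0) h9; move: h7 h8 h10; goal_lra.
pose a j := dot (lin (j %/ p)%N (j %% p)%N - Y j) (lin (j %/ p)%N (j %% p)%N - Y j).
have aS l : l%:R * d <= T -> a l.+1 <= (1 + d * c) * a l + d * (h * b).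
  move=> lT; have := step (l %/ p)%N (l %% p)%N; rewrite ltn_mod p0 -divn_eq.
  move=> /(_ isT lT); rewrite /a.
  suff -> : lin (l.+1 %/ p)%N (l.+1 %% p)%N = lin (l %/ p)%N (l %% p).+1 by [].
  have lp : (l %% p < p)%N by rewrite ltn_mod.
  rewrite {1 2}(divn_eq l p) -addnS divnMDl // modnMDl.
  move: lp; rewrite leq_eqVlt => /orP[/eqP ->|lp].
    rewrite divnn p0 modnn addn1 /lin mul0r scale0r addr0.
    by rewrite divff ?gt_eqF // scale1r addrC subrK.
  by rewrite (divn_small lp) (modn_small lp) addn0.
have aj : a j <= K2 * h.
  have hb : 0 <= h * b by rewrite mulr_ge0 // ltW.
  have := @discrete_gronwall R a c d (h * b) j c0 (ltW d0) hb (dot_ge0 _).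
  have a00 : a 0%N = 0.
    rewrite /a div0n mod0n /lin mul0r scale0r addr0.
    by have [-> _ _ _] := hX; have [-> _ _ _] := hY; rewrite subrr dot0l.
  rewrite a00 add0r => H; apply: le_trans (H _) _ => [l lj|].
    apply: aS; apply: le_trans jT.
    by rewrite ler_wpM2r ?(ltW d0) // ler_nat ltnW.
  have jd0 : 0 <= j%:R * d by rewrite mulr_ge0 // ltW.
  have -> : K2 * h = expR (c * T) * (T * (h * b)) by rewrite /K2; ring.
  apply: ler_pM; rewrite ?expR_ge0 ?ler_expR ?(ler_wpM2r hb) ?ler_wpM2l //.
  exact: mulr_ge0.
have jk : (j %/ p)%N%:R * h <= T.
  apply: le_trans jT; rewrite {1}hpd mulrA ler_wpM2r ?(ltW d0) // -natrM ler_nat.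
  exact: leq_divM.
have [] := linE (j %/ p)%N (j %% p)%N _ jk; first by rewrite ltnW // ltn_mod.
move=> e1 _; have e2 : nm (lin (j %/ p)%N (j %% p)%N - Y j) <= Num.sqrt K2 * Num.sqrt h.
  by apply: le_nm; rewrite ?mulr_ge0 ?sqrtr_ge0 // -sqrtrM // sqr_sqrtr ?mulr_ge0 // ltW.
have e3 : h * C <= C * Num.sqrt T * Num.sqrt h.
  rewrite mulrC -mulrA ler_wpM2l ?(ltW C0) // -{1}(sqr_sqrtr (ltW h0)) expr2.
  by rewrite ler_wpM2r ?sqrtr_ge0 // ler_wsqrtr.
have := nm_trans (lin (j %/ p)%N (j %% p)%N) (X (j %/ p)%N) (Y j).
rewrite (nmBC (X _) (lin _ _)); move: e1 e2 e3; goal_lra.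
Qed.

(** Along the steps [T / 2 ^ n] each scheme refines the preceding ones, so that the
    comparison makes them a uniform Cauchy sequence. *)
Lemma euler_limit : exists u : R -> V, forall e, 0 < e -> exists h X W,
  [/\ 0 < h, h <= T, h < e, euler h X W &
      forall t, 0 <= t -> t <= T -> nm (X (Num.truncn (t / h)) - u t) <= e].
Proof.
have [K K0 KP] := euler_compare.
pose h n : R := T / (2 ^ n)%N%:R.
have p0 n : 0 < (2 ^ n)%N%:R :> R by rewrite ltr0n expn_gt0.
have h0 n : 0 < h n by rewrite divr_gt0.
have hT n : h n <= T.
  by rewrite ler_pdivrMr // ler_peMr ?(ltW T0) // ler1n expn_gt0.
have /choice[X] : forall n, exists X, exists W, euler (h n) X W.
  by move=> n; exact: euler_exists.
move=> /choice[W XW].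
have hsmall e : 0 < e -> exists n, h n < e.
  move=> e0; have [|||n hn] := @expr_small R (1 / 2) (e / T).
  - lra.
  - lra.
  - exact: divr_gt0.
  exists n; move: hn; rewrite ltr_pdivlMr // expr_div_n expr1n /h natrX.
  by rewrite mulrC mulrA mulr1.
pose r n := K * Num.sqrt (h n).
have rsmall e : 0 < e -> exists n, r n < e /\ h n < e.
  move=> e0; have eK : 0 < e / K by rewrite divr_gt0.
  have eK2 : 0 < (e / K) ^+ 2 by rewrite exprn_gt0.
  have [d [d0 d1 d2]] := pos_below2 e0 eK2.
  have [n hn] := hsmall d d0; exists n; split; last by lra.
  rewrite /r mulrC -ltr_pdivlMr // -[ltRHS]ger0_norm ?(ltW eK) //.
  by rewrite -sqrtr_sqr ltr_sqrt //; lra.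
have cauchy t n m : 0 <= t -> t <= T -> (n <= m)%N ->
    nm (X n (Num.truncn (t / h n)) - X m (Num.truncn (t / h m))) <= r n.
  move=> t0 tT nm_; pose p := (2 ^ (m - n))%N.
  have hm : h m = h n / p%:R.
    by rewrite /h /p -mulrA -invfM -natrM -expnD subnKC.
  have p_gt0 : (0 < p)%N by rewrite expn_gt0.
  have th : t / h n = (t / h m) / p%:R.
    by rewrite hm; field; rewrite !gt_eqF ?ltr0n.
  have thm0 : 0 <= t / h m by rewrite divr_ge0 // ltW.
  rewrite th -truncn_div //; apply: (KP (h n) p (X n) (W n) (X m) (W m)) => //.
    by rewrite -hm; exact: XW.
  have /andP[h1 _] := truncn_itv thm0.
  by rewrite -hm -ler_pdivlMr // (le_trans h1) // ler_wpM2r ?invr_ge0 // ltW.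
have /choice[u uP] : forall t, exists l, 0 <= t -> t <= T ->
    forall n, nm (X n (Num.truncn (t / h n)) - l) <= r n.
  move=> t; have [/andP[t0 tT]|/negP tN] := boolP (0 <= t <= T); last first.
    by exists 0 => t0 tT; case: tN; rewrite t0 tT.
  have [||l lP] := @complete_rate _ _ (fun n => X n (Num.truncn (t / h n))) r.
  - by move=> e e0; have [n [h1 _]] := rsmall e e0; exists n.
  - by move=> n m nm_; exact: cauchy.
  by exists l.
exists u => e e0; have [n [h1 h2]] := rsmall e e0.
exists (h n), (X n), (W n); split=> // t t0 tT.
exact: le_trans (uP _ t0 tT n) (ltW h1).
Qed.

End EulerLimit.

(** * The evolution generated by a perturbed maximal monotone operator *)

Section Evolution.
Context {R : realType} {V : rhilbert R} (M : V -> V -> Prop).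
Hypothesis hM : maximal_monotone M.
Variables (G : R -> V -> V) (L T : R) (x0 v0 : V).
Hypotheses (L0 : 0 <= L) (T0 : 0 < T) (Mx0 : M x0 v0).
Hypothesis GL : forall s t x y,
  nm (G t x - G s y) <= L * nm (x - y) + L * (1 + nm x) * `|t - s|.

Variable u : R -> V.
Hypothesis hu : forall e, 0 < e -> exists h X W,
  [/\ 0 < h, h <= T, h < e, euler M G x0 v0 h X W &
      forall t, 0 <= t -> t <= T -> nm (X (Num.truncn (t / h)) - u t) <= e].

Lemma grid_itv (h t : R) : 0 < h -> 0 <= t ->
  (Num.truncn (t / h))%:R * h <= t < (Num.truncn (t / h))%:R * h + h.
Proof.
move=> h0 t0; have th : 0 <= t / h by rewrite divr_ge0 // ltW.
have /andP[h1 h2] := truncn_itv th; rewrite -ler_pdivlMr // h1 /=.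
by rewrite -natr1 ltr_pdivrMr // mulrDl mul1r in h2.
Qed.

Lemma euler_dist (C h : R) (X : nat -> V) (a b : nat) :
  (forall k, k%:R * h <= T -> nm (X k.+1 - X k) <= C * h) -> 0 < h ->
  (a <= b)%N -> b%:R * h <= T -> nm (X b - X a) <= C * (b%:R * h - a%:R * h).
Proof.
move=> XC h0; elim: b => [|b ih]; first by rewrite leqn0 => /eqP ->; rewrite !subrr nm0 mulr0.
rewrite leq_eqVlt => /orP[/eqP ->|ab bT]; first by rewrite !subrr nm0 mulr0.
have bT' : b%:R * h <= T by move: bT; rewrite -natr1 mulrDl mul1r; lra.
have := ih ab bT'; have := XC b bT'; have := nm_trans (X b) (X b.+1) (X a).
rewrite -natr1; lra.
Qed.

Lemma limit_init : u 0 = x0.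
Proof.
apply/eqP; rewrite eq_sym -subr_eq0; apply/eqP/nm_eq0/eqP.
rewrite eq_le nm_ge0 andbT; apply: (@le_eps _ _ _ 1) => e e0.
have [h [X [W [h0 hT he [X0 _ _ _] Xu]]]] := hu e0.
have := Xu 0 (lexx _) (ltW T0); rewrite mul0r truncn0 X0; lra.
Qed.

Lemma limit_bounded : exists2 C : R, 0 < C & forall s t : R, 0 <= s -> s <= t -> t <= T ->
  nm (u t) <= C /\ nm (u t - u s) <= C * (t - s).
Proof.
have [C C0 CP] := euler_bounds hM L0 T0 Mx0 GL; exists C => // s t s0 st tT.
have t0 : 0 <= t by lra. have sT : s <= T by lra.
split.
  apply: (@le_eps _ _ _ 1) => e e0.
  have [h [X [W [h0 hT he hX Xu]]]] := hu e0; have /andP[g1 g2] := grid_itv h0 t0.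
  have [X1 _ _ _ _] := CP _ _ _ h0 hT hX _ (le_trans g1 tT).
  have := nm_le_add (u t) (X (Num.truncn (t / h))); have := Xu t t0 tT.
  rewrite (nmBC (u t)); lra.
apply: (@le_eps _ _ _ (2 + C)) => e e0.
have [h [X [W [h0 hT he hX Xu]]]] := hu e0.
have /andP[g1 g2] := grid_itv h0 t0; have /andP[f1 f2] := grid_itv h0 s0.
have ab : (Num.truncn (s / h) <= Num.truncn (t / h))%N.
  by apply: le_truncn; rewrite ler_wpM2r // invr_ge0 ltW.
have Xd k : k%:R * h <= T -> nm (X k.+1 - X k) <= C * h.
  by move=> kT; have [] := CP _ _ _ h0 hT hX k kT.
have h1 := euler_dist Xd h0 ab (le_trans g1 tT).
have h2 := Xu t t0 tT; have h3 := Xu s s0 sT.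
set a := Num.truncn (s / h) in f1 f2 ab h1 h3; set b := Num.truncn (t / h) in g1 g2 ab h1 h2.
have h4 := nm_trans (X b) (u t) (u s); have h5 := nm_trans (X a) (X b) (u s).
have h6 : C * (b%:R * h - a%:R * h) <= C * (t - s + e).
  by apply: ler_wpM2l; [exact: ltW|move: he f2 g1; goal_lra].
rewrite (nmBC (u t) (X b)) in h4; move: h3 h1 h2 h4 h5 h6; goal_lra.
Qed.

(** The values of [M] along the scheme are bounded, so that the limit stays in
    the domain of [M]. *)
Lemma limit_value : exists2 C : R, 0 < C & forall t : R, 0 <= t -> t <= T ->
  exists2 v, M (u t) v & nm v <= C.
Proof.
have [C C0 CP] := euler_bounds hM L0 T0 Mx0 GL; exists C => // t t0 tT.
have [||v [Mv vC _]] := @yosida_bounded _ _ _ hM (u t) C; last by exists v.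
  exact: ltW.
move=> l y b l0 Mb yb; apply: (@le_eps _ _ _ (2 / l)) => e e0.
have [h [X [W [h0 hT he hX Xu]]]] := hu e0; have /andP[g1 g2] := grid_itv h0 t0.
set k := Num.truncn (t / h) in g1 g2; have [_ _ W1 _ _] := CP _ _ _ h0 hT hX k (le_trans g1 tT).
have [_ _ MX _] := hX.
have [y' [b' [Mb' yb']]] := mm_range hM l0 (X k).
have h1 := yosida_nm_le hM l0 (MX k) Mb' yb'.
have h2 := yosida_lip hM l0 Mb Mb' yb yb'.
have h3 : 2 / l * nm (u t - X k) <= 2 / l * e.
  by rewrite ler_wpM2l ?divr_ge0 ?(ltW l0) // nmBC; exact: Xu.
have := nm_le_add b b'; lra.
Qed.

Let G_bounded : exists2 C : R, 0 < C & forall t : R, 0 <= t -> t <= T -> nm (G t (u t)) <= C.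
Proof.
have [C C0 CP] := limit_bounded.
have LC : 0 <= L * C by rewrite mulr_ge0 // ltW.
have LT : 0 <= L * T by rewrite mulr_ge0 // ltW.
exists (nm (G 0 0) + L * C + L * T + 1) => [|t t0 tT].
  by rewrite ltr_wpDl // !addr_ge0.
have := GL t 0 0 (u t); rewrite sub0r nmN sub0r normrN ger0_norm // nm0 addr0 mulr1.
have [h1 _] := CP _ _ t0 (lexx t) tT; have h2 := ler_wpM2l L0 h1.
have h3 := ler_wpM2l L0 tT.
have := nm_le_add (G t (u t)) (G 0 0); rewrite (nmBC (G t _)); lra.
Qed.

(** The variation of the distance of the solution to a point [y] of the domain
    (Benilan's inequality), in the form that the scheme gives directly. *)
Lemma limit_step : exists2 c : R, 0 < c & forall s t : R, 0 <= s -> s <= t -> t <= T ->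
  forall y q, M y q ->
  nm (u t - y) <= nm (u s - y) + (t - s) * (nm (G s (u s) - q) + c * (t - s)) /\
  dot (u t - y) (u t - y) <= dot (u s - y) (u s - y) +
    2 * (t - s) * (dot (G s (u s) - q) (u s - y) +
                   c * (1 + nm y + nm q) * (t - s)).
Proof.
have [C C0 CP] := euler_bounds hM L0 T0 Mx0 GL.
have [B B0 BP] := limit_bounded; have [Cg Cg0 CgP] := G_bounded.
pose c1 := 2 * L * (1 + C).
have c10 : 0 <= c1 by rewrite !mulr_ge0 // addr_ge0 // ltW.
pose c := c1 * (C + 1) + (Cg + 1) * (C + 1).
have c1C : 0 <= c1 * C by rewrite mulr_ge0 // ltW.
have CgC : 0 <= Cg * C by rewrite mulr_ge0 // ltW.
have c0 : 0 < c by rewrite /c; lra.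
have c1c : c1 <= c by rewrite /c; lra.
exists c => // s t s0 st tT y q Mq.
have t0 : 0 <= t by lra. have sT : s <= T by lra.
set g := G s (u s); set tau := t - s.
have tau0 : 0 <= tau by rewrite subr_ge0.
have gC : nm g <= Cg by exact: CgP.
(* the common estimates on one step of the scheme *)
have key e : 0 < e -> e <= 1 -> exists h X a b,
    [/\ [/\ nm (X a - u s) <= e, nm (X b - u t) <= e, (a <= b)%N &
            tau - e <= b%:R * h - a%:R * h <= tau + e],
        forall k, (a <= k < b)%N -> nm (X k.+1 - y) <=
          nm (X k - y) + h * (nm (g - q) + c * (tau + e)),
        forall k, (a <= k < b)%N -> dot (X k.+1 - y) (X k.+1 - y) <=
          dot (X k - y) (X k - y) + 2 * h * (dot (g - q) (u s - y) +
             c * (1 + nm y + nm q) * (tau + e)),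
        0 < h & nm (X b) <= C].
  move=> e0 e1; have [h [X [W [h0 hT he hX Xu]]]] := hu e0.
  have /andP[g1 g2] := grid_itv h0 t0; have /andP[f1 f2] := grid_itv h0 s0.
  have ab : (Num.truncn (s / h) <= Num.truncn (t / h))%N.
    by apply: le_truncn; rewrite ler_wpM2r // invr_ge0 ltW.
  have Xa := Xu s s0 sT; have Xb := Xu t t0 tT.
  exists h, X, (Num.truncn (s / h)), (Num.truncn (t / h)).
  set a := Num.truncn (s / h) in f1 f2 ab Xa *; set b := Num.truncn (t / h) in g1 g2 ab Xb *.
  have [_ _ MX XS] := hX.
  have Xd k : k%:R * h <= T -> nm (X k.+1 - X k) <= C * h.
    by move=> kT; have [] := CP _ _ _ h0 hT hX k kT.
  have te : 0 <= tau + e by move: tau0 e0; goal_lra.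
  have kb k : (k <= b)%N -> k%:R * h <= t.
    by move=> kb; apply: le_trans g1; rewrite ler_wpM2r ?(ltW h0) // ler_nat.
  have ka k : (a <= k)%N -> s - h <= k%:R * h.
    move=> ak; have : a%:R * h <= k%:R * h by rewrite ler_wpM2r ?(ltW h0) // ler_nat.
    move: f2; goal_lra.
  have Xus k : (a <= k)%N -> (k <= b)%N -> nm (X k - u s) <= (C + 1) * (tau + e).
    move=> ak kb'; have := euler_dist Xd h0 ak (le_trans (kb k kb') tT).
    have : C * (k%:R * h - a%:R * h) <= C * (tau + e).
      by apply: ler_wpM2l; [exact: ltW|have := kb k kb'; rewrite /tau;
        move: he f2; goal_lra].
    have := nm_trans (X a) (X k) (u s); move: tau0 Xa; goal_lra.
  have Gk k : (a <= k)%N -> (k <= b)%N ->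
      nm (G (k%:R * h) (X k) - g) <= c1 * (tau + e).
    move=> ak kb'; have := GL s (k%:R * h) (X k) (u s); rewrite -/g => h1.
    apply: le_trans h1 _; have h2 := ler_wpM2l L0 (Xus k ak kb').
    have h3 : `|k%:R * h - s| <= tau + e.
      by rewrite ler_norml; have := ka k ak; have := kb k kb'; rewrite /tau;
        move: st he f1 f2; goal_lra.
    have [X1 _ _ _ _] := CP _ _ _ h0 hT hX k (le_trans (kb k kb') tT).
    have h4 : L * (1 + nm (X k)) * `|k%:R * h - s| <= L * (1 + C) * (tau + e).
      apply: ler_pM => //; first by rewrite mulr_ge0 // addr_ge0.
      by rewrite ler_wpM2l // lerD2l.
    by rewrite /c1; move: h2 h4; goal_lra.
  split=> //; first by split=> //; rewrite /tau; apply/andP; split;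
    move: he f1 f2 g1 g2; goal_lra.
  - move=> k /andP[ak kb']; have h1 := Gk k ak (ltnW kb').
    apply: le_trans (resolvent_le hM (ltW h0) (MX _) Mq) _; rewrite XS.
    set gk := G _ (X k) in h1 *.
    have -> : X k + h *: gk - (y + h *: q) = (X k - y) + h *: (gk - q) by vring.
    apply: le_trans (nmD _ _) _; rewrite lerD2l nmZ gtr0_norm // ler_wpM2l ?(ltW h0) //.
    have := nm_trans g gk q; have : c1 * (tau + e) <= c * (tau + e) by rewrite ler_wpM2r.
    move: h1; goal_lra.
  - move=> k /andP[ak kb']; have h1 := Gk k ak (ltnW kb').
    have := mm_mon hM (MX k.+1) Mq; have := XS k.
    set gk := G _ (X k) in h1 *; move=> eX mono.
    have h2 : dot (gk - q) (X k.+1 - y) <= dot (g - q) (u s - y) +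
             c * (1 + nm y + nm q) * (tau + e).
      have -> : dot (gk - q) (X k.+1 - y) = dot (g - q) (u s - y) +
          dot (gk - g) (X k.+1 - y) + dot (g - q) (X k.+1 - u s).
        by rewrite !dotE; ring.
      rewrite -addrA lerD2l.
      have [X1 _ _ _ _] := CP _ _ _ h0 hT hX k.+1 (le_trans (kb _ kb') tT).
      have h3 : nm (X k.+1 - y) <= C + nm y by apply: le_trans (nmB _ _) _;
        move: X1; goal_lra.
      have h4 : nm (g - q) <= Cg + nm q by apply: le_trans (nmB _ _) _;
        move: gC; goal_lra.
      have h5 : dot (gk - g) (X k.+1 - y) <= c1 * (tau + e) * (C + nm y).
        by apply: le_trans (dot_le _ _) _; apply: ler_pM.
      have h6 : dot (g - q) (X k.+1 - u s) <= (Cg + nm q) * ((C + 1) * (tau + e)).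
        apply: le_trans (dot_le _ _) _; apply: ler_pM => //.
        by apply: Xus => //; exact: leqW.
      have h7 : c1 * (C + nm y) + (Cg + nm q) * (C + 1) <= c * (1 + nm y + nm q).
        rewrite /c; have y0 := nm_ge0 y; have q0 := nm_ge0 q.
        have p1 : 0 <= c1 * C * nm y by rewrite mulr_ge0.
        have p2 : 0 <= c1 * C * nm q by rewrite mulr_ge0.
        have p3 : 0 <= Cg * C * nm y by rewrite mulr_ge0.
        have p4 : 0 <= Cg * C * nm q by rewrite mulr_ge0.
        have p5 : 0 <= c1 * nm q by rewrite mulr_ge0.
        have p6 : 0 <= Cg * nm y by rewrite mulr_ge0 // ltW.
        have p7 : 0 <= Cg * nm q by rewrite mulr_ge0 // ltW.
        have p8 : 0 <= C * nm y by rewrite mulr_ge0 // ltW.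
        move: C0 c10 y0 p1 p2 p3 p4 p5 p6 p7 p8; goal_lra.
      have h8 := ler_wpM2r te h7; lra.
    have -> : dot (X k - y) (X k - y) = dot (X k.+1 - y) (X k.+1 - y) -
        2 * dot (X k.+1 - X k) (X k.+1 - y) + dot (X k.+1 - X k) (X k.+1 - X k).
      move: (X k) (X k.+1) => x1 x2.
      by rewrite !dotE [dot y x1]dotC [dot y x2]dotC [dot x1 x2]dotC; ring.
    have -> : X k.+1 - X k = h *: ((gk - q) - (W k.+1 - q)).
      apply: (addIr (h *: W k.+1)); rewrite addrAC eX; vring.
    have -> : dot (h *: ((gk - q) - (W k.+1 - q))) (X k.+1 - y) =
       h * (dot (gk - q) (X k.+1 - y) - dot (W k.+1 - q) (X k.+1 - y)).
      by rewrite dotZl dotDl dotNl.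
    have := dot_ge0 (h *: ((gk - q) - (W k.+1 - q))).
    have : h * (dot (gk - q) (X k.+1 - y) - dot (W k.+1 - q) (X k.+1 - y)) <=
       h * (dot (g - q) (u s - y) + c * (1 + nm y + nm q) * (tau + e)).
      by apply: ler_wpM2l; [exact: ltW|move: mono h2; goal_lra].
    goal_lra.
  - by have [] := CP _ _ _ h0 hT hX b (le_trans g1 tT).
have tele (f : nat -> R) (a b : nat) (h z : R) : (a <= b)%N ->
    (forall k, (a <= k < b)%N -> f k.+1 <= f k + h * z) ->
    f b <= f a + (b%:R * h - a%:R * h) * z.
  elim: b => [|b ih]; first by rewrite leqn0 => /eqP -> _; rewrite subrr mul0r addr0.
  rewrite leq_eqVlt => /orP[/eqP -> _|ab hf]; first by rewrite subrr mul0r addr0.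
  have := hf b; rewrite leqnn andbT => /(_ ab).
  have := ih ab _; rewrite -natr1 => /(_ _)-H h1.
  have : f b <= f a + (b%:R * h - a%:R * h) * z.
    by apply: ih => // k /andP[ak kb]; apply: hf; rewrite ak ltnW.
  move: h1; goal_lra.
split.
  set A := nm (g - q); have A0 : 0 <= A := nm_ge0 _.
  apply: (@le_eps _ _ _ (2 + A + 2 * c * tau + c)) => e' e'0.
  have [e [e0 e1 ee']] := pos_below2 ltr01 e'0.
  have [h [X [a [b [[Xa Xb ab /andP[w1 w2]] S1 _ h0 _]]]]] := key e e0 e1.
  have h1 := tele (fun k => nm (X k - y)) _ _ _ _ ab S1; rewrite /= -/A in h1.
  have ctau : 0 <= c * tau by rewrite mulr_ge0 // ltW.
  have h2 : (b%:R * h - a%:R * h) * (A + c * (tau + e)) <=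
      (tau + e) * (A + c * (tau + e)).
    by rewrite ler_wpM2r // addr_ge0 // mulr_ge0 ?(ltW c0) //;
      move: tau0 e0; goal_lra.
  have h3 := nm_trans (X b) (u t) y; have h4 := nm_trans (u s) (X a) y.
  rewrite (nmBC (u t) (X b)) in h3.
  have h5 : e * (A + 2 * c * tau + c * e) <= e * (A + 2 * c * tau + c).
    by rewrite ler_wpM2l ?(ltW e0) // lerD2l ler_piMr // ltW.
  have h6 : (2 + A + 2 * c * tau + c) * e <= (2 + A + 2 * c * tau + c) * e'.
    by rewrite ler_wpM2l //; move: c0 A0 ctau; goal_lra.
  move: Xa Xb h1 h2 h4 h3 h5 h6; goal_lra.
set beta := dot (g - q) (u s - y); set d := c * (1 + nm y + nm q).
have d0 : 0 <= d by rewrite mulr_ge0 ?(ltW c0) // !addr_ge0.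
have C0' := C0; have B0' := B0; pose N := B + C + 1 + nm y.
have N0 : 0 <= N by rewrite !addr_ge0 // ltW.
apply: (@le_eps _ _ _ (4 * N + 2 * (`|beta| + 2 * d * tau + d))) => e' e'0.
have [e [e0 e1 ee']] := pos_below2 ltr01 e'0.
have [h [X [a [b [[Xa Xb ab /andP[w1 w2]] _ S2 h0 XbC]]]]] := key e e0 e1.
have S2' k : (a <= k < b)%N -> dot (X k.+1 - y) (X k.+1 - y) <=
    dot (X k - y) (X k - y) + h * (2 * (beta + d * (tau + e))).
  by move=> kab; have := S2 k kab; rewrite /beta /d; goal_lra.
have h1 := tele (fun k => dot (X k - y) (X k - y)) _ _ _ _ ab S2'; rewrite /= in h1.
have h2 : (b%:R * h - a%:R * h) * (d * (tau + e)) <= (tau + e) * (d * (tau + e)).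
  by rewrite ler_wpM2r // mulr_ge0 //; move: tau0 w1 w2; goal_lra.
have h3 : (b%:R * h - a%:R * h) * beta <= tau * beta + e * `|beta|.
  rewrite -lerBlDl -mulrBl; apply: le_trans (ler_norm _) _; rewrite normrM.
  by rewrite ler_wpM2r // ler_norml; move: w1 w2; goal_lra.
have sqd (x z : V) r : nm (x - z) <= e -> nm z <= r -> nm x <= r ->
    dot (x - y) (x - y) <= dot (z - y) (z - y) + 2 * (r + nm y) * e.
  move=> xz zr xr.
  have -> : dot (x - y) (x - y) = dot (z - y) (z - y) +
      dot (x - z) ((x - y) + (z - y)).
    by rewrite !dotE [dot y x]dotC [dot y z]dotC [dot z x]dotC; ring.
  rewrite lerD2l; apply: le_trans (dot_le _ _) _.
  rewrite [leRHS]mulrC; apply: ler_pM => //.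
  have := nmD (x - y) (z - y); have := nmB x y; have := nmB z y;
    move: zr xr; goal_lra.
have [uC _] := BP _ _ t0 (lexx t) tT; have [usC _] := BP _ _ s0 (lexx s) sT.
have XaC : nm (X a) <= B + 1.
  by have := nm_le_add (X a) (u s); move: e1 Xa usC; goal_lra.
have h4 : dot (u t - y) (u t - y) <= dot (X b - y) (X b - y) + 2 * N * e.
  by apply: sqd; [rewrite nmBC|move: C0' B0' XbC uC; goal_lra|move: C0' B0' XbC uC;
    goal_lra].
have h5 : dot (X a - y) (X a - y) <= dot (u s - y) (u s - y) + 2 * N * e.
  by apply: sqd => //; move: C0' usC XaC; goal_lra.
have h6 : e * (`|beta| + 2 * d * tau + d * e) <= e * (`|beta| + 2 * d * tau + d).
  by rewrite ler_wpM2l ?(ltW e0) // lerD2l ler_piMr.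
have h7 : (4 * N + 2 * (`|beta| + 2 * d * tau + d)) * e <=
   (4 * N + 2 * (`|beta| + 2 * d * tau + d)) * e'.
  have := normr_ge0 beta; have : 0 <= d * tau by rewrite mulr_ge0.
  by move=> *; rewrite ler_wpM2l //; lra.
move: h1 h2 h3 h4 h5 h6 h7; goal_lra.
Qed.

End Evolution.

Section EvolutionRegularity.
Context {R : realType} {V : rhilbert R} (M : V -> V -> Prop).
Hypothesis hM : maximal_monotone M.
Variables (G : R -> V -> V) (L T : R) (x0 v0 : V).
Hypotheses (L0 : 0 <= L) (T0 : 0 < T) (Mx0 : M x0 v0).
Hypothesis GL : forall s t x y,
  nm (G t x - G s y) <= L * nm (x - y) + L * (1 + nm x) * `|t - s|.

Variable u : R -> V.
Hypothesis hu : forall e, 0 < e -> exists h X W,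
  [/\ 0 < h, h <= T, h < e, euler M G x0 v0 h X W &
      forall t, 0 <= t -> t <= T -> nm (X (Num.truncn (t / h)) - u t) <= e].

(** The scheme is compared with its own shift by [d], by monotonicity: only the
    variation of [G] in time and in space, of order [d], makes their distance
    grow. *)
Lemma limit_shift : exists2 c : R, 0 < c & forall s t d : R,
  0 <= s -> s <= t -> 0 <= d -> t + d <= T ->
  nm (u (t + d) - u t) <= nm (u (s + d) - u s) + c * (t - s) * d.
Proof.
have [C C0 CP] := euler_bounds hM L0 T0 Mx0 GL.
have L0' := L0; have LC : 0 <= L * C by rewrite mulr_ge0 // ltW.
pose c := L * C + L * (1 + C) + 1.
have c0 : 0 < c by rewrite /c; lra.
exists c => // s t d s0 st d0 tdT.
have t0 : 0 <= t by lra. have tT : t <= T by lra.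
apply: (@le_eps _ _ _ (c * d + 4 * C + 4)) => e e0.
have [h [X [W [h0 hT he hX Xu]]]] := hu e0.
have Xd k : k%:R * h <= T -> nm (X k.+1 - X k) <= C * h.
  by move=> kT; have [] := CP _ _ _ h0 hT hX k kT.
have /andP[g1 g2] := grid_itv h0 t0; have /andP[f1 f2] := grid_itv h0 s0.
have /andP[d1 d2] := grid_itv h0 d0.
have ab : (Num.truncn (s / h) <= Num.truncn (t / h))%N.
  by apply: le_truncn; rewrite ler_wpM2r // invr_ge0 ltW.
set m := Num.truncn (d / h) in d1 d2.
have m0 : 0 <= m%:R * h by rewrite mulr_ge0 // ltW.
(* the index of [r + d] exceeds that of [r] by [m] or [m + 1] *)
have close r : 0 <= r -> r <= t ->
    nm (X (Num.truncn (r / h) + m)%N - u (r + d)) <= 2 * C * e + e.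
  move=> r0 rt; have rd0 : 0 <= r + d by lra.
  have rdT : r + d <= T by move: tdT rt; goal_lra.
  have /andP[r1 r2] := grid_itv h0 r0; have /andP[k1 k2] := grid_itv h0 rd0.
  have := Xu _ rd0 rdT; set k := Num.truncn (r / h) in r1 r2 *.
  set k' := Num.truncn ((r + d) / h) in k1 k2 *.
  have kk' : (k + m <= k')%N.
    rewrite truncn_ge_nat ?divr_ge0 ?(ltW h0) // ler_pdivlMr // natrD mulrDl;
      move: d1 r1; goal_lra.
  have := euler_dist Xd h0 kk' (le_trans k1 rdT).
  have : C * (k'%:R * h - (k + m)%N%:R * h) <= C * (2 * e).
    apply: ler_wpM2l; first exact: ltW.
    rewrite natrD mulrDl; move: he d2 r2 k1; goal_lra.
  have := nm_trans (X k') (X (k + m)%N) (u (r + d)).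
  rewrite (nmBC (X (k + m)%N) (X k')); goal_lra.
have ct := close t t0 (lexx t); have cs := close s s0 st.
have xt := Xu t t0 tT; have xs := Xu s s0 (le_trans st tT).
set a := Num.truncn (s / h) in f1 f2 ab cs xs; set b := Num.truncn (t / h) in g1 g2 ab ct xt.
have step k : (a <= k < b)%N -> nm (X (k.+1 + m)%N - X k.+1) <=
    nm (X (k + m)%N - X k) + h * (c * d).
  move=> /andP[ak kb]; apply: le_trans (euler_shift hM GL k m h0 hX) _.
  have kh : (k + m)%N%:R * h <= T.
    have : k%:R * h <= b%:R * h by rewrite ler_wpM2r ?(ltW h0) // ler_nat ltnW.
    rewrite natrD mulrDl; move: tdT d1 g1; goal_lra.
  have kT : k%:R * h <= T.
    apply: le_trans kh; rewrite ler_wpM2r ?(ltW h0) // ler_nat; exact: leq_addr.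
  have [X1 _ _ _ _] := CP _ _ _ h0 hT hX k kT.
  have := euler_dist Xd h0 (leq_addr m k) kh; rewrite natrD mulrDl addrAC subrr add0r.
  move=> h1; have h2 : L * nm (X (k + m)%N - X k) <= L * C * d.
    rewrite -mulrA ler_wpM2l //; apply: le_trans h1 _; rewrite ler_wpM2l //; exact: ltW.
  have h3 : L * (1 + nm (X k)) * (m%:R * h) <= L * (1 + C) * d.
    apply: ler_pM => //; first by rewrite mulr_ge0 // addr_ge0.
    by rewrite ler_wpM2l // lerD2l.
  have h4 : L * nm (X (k + m)%N - X k) + L * (1 + nm (X k)) * (m%:R * h) <= c * d.
    by rewrite /c; move: d1 m0 h2 h3; goal_lra.
  have := ler_wpM2l (ltW h0) h4; goal_lra.
have tele : nm (X (b + m)%N - X b) <= nm (X (a + m)%N - X a) +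
    (b%:R * h - a%:R * h) * (c * d).
  move: b ab step {g1 g2 ct xt}; elim=> [|b ih] ab step.
    by move: ab; rewrite leqn0 => /eqP ->; rewrite subrr mul0r addr0.
  move: ab; rewrite leq_eqVlt => /orP[/eqP ->|ab].
    by rewrite subrr mul0r addr0.
  have := step b; rewrite leqnn andbT => /(_ ab); rewrite -natr1.
  have : nm (X (b + m)%N - X b) <= nm (X (a + m)%N - X a) + (b%:R * h - a%:R * h) * (c * d).
    by apply: ih => // k /andP[ak kb]; apply: step; rewrite ak ltnW.
  goal_lra.
have cd0 : 0 <= c * d by rewrite mulr_ge0 // ltW.
have h5 : (b%:R * h - a%:R * h) * (c * d) <= (t - s + e) * (c * d).
  by rewrite ler_wpM2r //; move: he f2 g1; goal_lra.
have h6 := nm_trans (X (b + m)%N) (u (t + d)) (u t).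
have h7 := nm_trans (X b) (X (b + m)%N) (u t).
have h8 := nm_trans (u (s + d)) (X (a + m)%N) (X a).
have h9 := nm_trans (u s) (u (s + d)) (X a).
rewrite (nmBC (u (t + d)) (X (b + m)%N)) in h6; rewrite (nmBC (u s) (X a)) in h9.
move: cs xs ct xt tele h5 h7 h8 h6 h9; goal_lra.
Qed.

(** The right derivative exists everywhere.  The difference quotient [D] has
    length at most that of [q], the opposite of the expected derivative, and
    Benilan's inequality at a Yosida approximation shows that the scalar product
    of [D] with [q] is at most minus the square of the length of [q]. *)
Lemma limit_right_derivative s v : 0 <= s -> s < T -> M (u s) v ->
  forall e, 0 < e -> exists2 eta : R, 0 < eta &
  forall t : R, s <= t -> t < s + eta -> t <= T ->
  nm (u t - u s - (t - s) *: (G s (u s) - v)) <= e * (t - s).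
Proof.
move=> s0 sT Mv e e0; have [c c0 cP] := limit_step hM L0 T0 Mx0 GL hu.
set g := G s (u s); pose q := v - g.
have hMg := maximal_monotone_shift hM g.
have Mq : M (u s) (q + g) by rewrite /q subrK.
pose n := nm q; have n0 : 0 <= n by exact: nm_ge0.
pose eps := e ^+ 2 / (2 * (6 * n + 1)).
have e20 : 0 < e ^+ 2 by rewrite exprn_gt0.
have eps0 : 0 < eps by rewrite divr_gt0 // mulr_gt0 // ltr_wpDl // mulr_ge0.
have [l [y [b [l0 Mb yb bq]]]] := yosida_cvg hMg Mq eps0.
have bn := yosida_nm_le hMg l0 Mq Mb yb.
pose K := 2 * n * c + c ^+ 2 + 2 * (c * (1 + nm y + nm (b + g))) / l + 2 * c * eps + 1.
have K0 : 0 < K.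
  have k1 : 0 <= 2 * n * c by rewrite !mulr_ge0 // ltW.
  have k2 : 0 <= 2 * (c * (1 + nm y + nm (b + g))) / l.
    by rewrite divr_ge0 ?(ltW l0) // !mulr_ge0 ?(ltW c0) // !addr_ge0.
  have k3 : 0 <= 2 * c * eps.
    by rewrite mulr_ge0 ?(ltW eps0) // mulr_ge0 // ltW.
  by have := sqr_ge0 c; rewrite /K; lra.
have [|eta [eta0 eta1 eta2]] := @pos_below2 _ 1 (e ^+ 2 / (2 * K)) ltr01.
  exact: divr_gt0 e20 (mulr_gt0 (ltr0Sn _ 1) K0).
exists eta => // t st teta tT.
set tau := t - s; have tau0 : 0 <= tau by rewrite subr_ge0.
have taue : tau <= eta by rewrite /tau; lra.
set Dl := u t - u s.
have [h1 _] := cP s t s0 st tT _ _ Mv; have [_ h2] := cP s t s0 st tT _ _ Mb.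
rewrite subrr nm0 add0r -/g -/tau -/Dl nmBC -/q -/n in h1.
rewrite -/g -/tau in h2; set dd := c * (1 + nm y + nm (b + g)) in h2 K K0 eta2 *.
have us : u s - y = l *: b by rewrite -yb; vring.
have ut : u t - y = Dl + l *: b by rewrite -us /Dl; vring.
have gb : g - (b + g) = - b by vring.
have qE : Dl - tau *: (g - v) = Dl + tau *: q by rewrite /q; vring.
rewrite qE; clearbody Dl; clear qE.
rewrite us ut gb !dotE [dot b Dl]dotC in h2.
have sD : dot Dl Dl <= (tau * (n + c * tau)) ^+ 2.
  by rewrite -sqr_nm ler_sqr ?nnegrE // ?mulr_ge0 // ?addr_ge0 // mulr_ge0 // ltW.
have h3 : dot Dl b <= - tau * dot b b + tau * (dd / l) * tau.
  have : l * (dot Dl b) <= l * (- tau * dot b b + tau * (dd / l) * tau).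
    have -> : l * (- tau * dot b b + tau * (dd / l) * tau) =
       - tau * (l * dot b b) + tau * dd * tau by field; rewrite gt_eqF.
    have := dot_ge0 Dl; move: h2; goal_lra.
  by rewrite ler_pM2l.
have h4 : dot Dl (q - b) <= tau * (n + c * tau) * eps.
  apply: le_trans (dot_le _ _) _; apply: ler_pM => //.
  by rewrite nmBC ltW.
have h5 : dot q q - dot b b <= 2 * n * eps.
  rewrite -!sqr_nm; have -> : nm q ^+ 2 - nm b ^+ 2 = (nm q + nm b) * (nm q - nm b) by ring.
  have h6 := nm_le_add q b; rewrite (nmBC q b) in h6.
  have h7 : nm q - nm b <= eps by move: bq h6; goal_lra.
  have h8 : nm q + nm b <= 2 * n by rewrite /n; move: bn; goal_lra.
  by apply: ler_pM; rewrite ?subr_ge0 // addr_ge0.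
apply: le_nm; first by rewrite mulr_ge0 // ltW.
have -> : dot (Dl + tau *: q) (Dl + tau *: q) =
    dot Dl Dl + 2 * tau * (dot Dl b + dot Dl (q - b)) + tau ^+ 2 * dot q q.
  by clearbody q; rewrite !dotE [dot q Dl]dotC; ring.
have -> : (e * tau) ^+ 2 = tau ^+ 2 * e ^+ 2 by ring.
have h6 : 2 * tau * (dot Dl b + dot Dl (q - b)) <= 2 * tau *
   (- tau * dot b b + tau * (dd / l) * tau + tau * (n + c * tau) * eps).
  by rewrite ler_wpM2l ?mulr_ge0 //; move: h3 h4; goal_lra.
suff h7 : (n + c * tau) ^+ 2 + 2 * (- dot b b + (dd / l) * tau + (n + c * tau) * eps)
    + dot q q <= e ^+ 2.
  have := ler_wpM2l (sqr_ge0 tau) h7; move: sD h6; goal_lra.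
have h8 : 6 * n * eps <= e ^+ 2 / 2.
  rewrite /eps mulrA ler_pdivrMr ?mulr_gt0 ?ltr_wpDl ?mulr_ge0 //;
    move: e20; goal_lra.
have h9 : K * tau <= e ^+ 2 / 2.
  have : K * tau <= K * (e ^+ 2 / (2 * K)) by rewrite ler_wpM2l ?(ltW K0) //;
    move: taue eta2; goal_lra.
  by have -> : K * (e ^+ 2 / (2 * K)) = e ^+ 2 / 2 by field; rewrite gt_eqF.
have h10 : c ^+ 2 * tau ^+ 2 <= c ^+ 2 * tau.
  by rewrite ler_wpM2l ?sqr_ge0 // expr2 ler_piMr //; move: eta1 taue; goal_lra.
have nq : n ^+ 2 = dot q q by rewrite sqr_nm.
rewrite /K -/dd in h9; move: tau0 h5 h8 h9 h10; goal_lra.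
Qed.

(** The shift of a solution is a solution for a shifted perturbation, so that
    the length of an increment over a fixed time is almost decreasing; so is
    then the length of the right derivative. *)
Lemma speed_quasi_decreasing : exists2 c : R, 0 < c & forall (s t : R) v w,
  0 <= s -> s <= t -> t < T -> M (u s) v -> M (u t) w ->
  nm (G t (u t) - w) <= nm (G s (u s) - v) + c * (t - s).
Proof.
have [c c0 cP] := limit_shift; exists c => // s t v w s0 st tT Mv Mw.
apply: (@le_eps _ _ _ 2) => e e0.
have t0 : 0 <= t by lra. have sT : s < T by lra.
have [d1 d10 d1P] := limit_right_derivative s0 sT Mv e0.
have [d2 d20 d2P] := limit_right_derivative t0 tT Mw e0.
have [|||d [d0 da db dc]] := @pos_below3 _ (d1 / 2) (d2 / 2) (T - t).
- by rewrite divr_gt0.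
- by rewrite divr_gt0.
- by rewrite subr_gt0.
have a1 := d1P (s + d) _ _ _; have a2 := d2P (t + d) _ _ _.
have {}a1 : nm (u (s + d) - u s - d *: (G s (u s) - v)) <= e * d.
  by have := a1; rewrite [s + d - s]addrAC subrr add0r; apply;
    move: st d0 da dc; goal_lra.
have {}a2 : nm (u (t + d) - u t - d *: (G t (u t) - w)) <= e * d.
  by have := a2; rewrite [t + d - t]addrAC subrr add0r; apply;
    move: d0 db dc; goal_lra.
have a3 := cP s t d s0 st (ltW d0) _.
have {}a3 : nm (u (t + d) - u t) <= nm (u (s + d) - u s) + c * (t - s) * d.
  by apply: a3; lra.
have a4 := nm_le_add (u (s + d) - u s) (d *: (G s (u s) - v)).
have a5 := nm_le_add (d *: (G t (u t) - w)) (u (t + d) - u t).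
rewrite [nm (d *: _ - _)]nmBC in a5.
rewrite nmZ gtr0_norm // in a4; rewrite nmZ gtr0_norm // in a5.
suff : d * nm (G t (u t) - w) <= d * (nm (G s (u s) - v) + c * (t - s) + 2 * e).
  by rewrite ler_pM2l.
move: a1 a2 a3 a4 a5; goal_lra.
Qed.

(** For [M] shifted by the constant [G s (u s)], the hypothesis on the speeds
    becomes the hypothesis on lengths under which values converge strongly. *)
Lemma value_continuous s v : 0 <= s -> s <= T -> M (u s) v ->
  forall e : R, 0 < e -> exists2 eta : R, 0 < eta & forall t w,
  0 <= t -> t <= T -> `|t - s| < eta -> M (u t) w ->
  nm (G t (u t) - w) <= nm (G s (u s) - v) + eta -> nm (w - v) < e.
Proof.
move=> s0 sT Mv e e0; set g := G s (u s); pose q := v - g.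
have hMg := maximal_monotone_shift hM g.
have Mq : M (u s) (q + g) by rewrite /q subrK.
have [eta eta0 etaP] := strong_value hMg Mq e0.
have [C C0 CP] := limit_bounded hM L0 T0 Mx0 GL hu.
have L0' := L0; have LC : 0 <= L * C by rewrite mulr_ge0 // ltW.
pose K := L * C + L * (1 + C) + C + 1.
have K0 : 0 < K by rewrite /K; lra.
have [||d [d0 d1 d2]] := @pos_below2 _ (eta / 2) (eta / (2 * K)).
- by rewrite divr_gt0.
- by rewrite divr_gt0 // mulr_gt0.
exists d => // t w t0 tT ts Mw gw.
have us : nm (u t - u s) <= C * `|t - s|.
  have [st|ts'] := leP s t; first by have [_] := CP s t s0 st tT; rewrite ger0_norm ?subr_ge0.
  have [_] := CP t s t0 (ltW ts') sT; rewrite nmBC ler0_norm ?subr_le0 ?(ltW ts') //.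
  by rewrite opprB.
have [usC _] := CP s s s0 (lexx s) sT.
have dK : K * `|t - s| <= eta / 2.
  have : K * `|t - s| <= K * (eta / (2 * K)).
    by rewrite ler_wpM2l ?(ltW K0) //; apply: le_trans (ltW ts) d2.
  by have -> : K * (eta / (2 * K)) = eta / 2 by field; rewrite gt_eqF.
have tsn := normr_ge0 (t - s).
have Lts : 0 <= L * `|t - s| by rewrite mulr_ge0.
have LCts : 0 <= L * C * `|t - s| by rewrite mulr_ge0.
have Cts : 0 <= C * `|t - s| by rewrite mulr_ge0 // ltW.
have gg : nm (G t (u t) - g) <= eta / 2.
  have := GL t s (u s) (u t); rewrite -/g nmBC (nmBC (u s)) distrC => h1.
  have h2 := ler_wpM2l L0 us.
  have h3 : L * (1 + nm (u s)) * `|t - s| <= L * (1 + C) * `|t - s|.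
    by rewrite ler_wpM2r // ler_wpM2l // lerD2l.
  by rewrite /K in dK; move: dK tsn Cts h1 h2 h3; goal_lra.
have -> : w - v = (w - g) - q by rewrite /q; vring.
apply: (etaP (u t)); first by rewrite subrK.
  by rewrite /K in dK; move: d1 ts us dK tsn Lts LCts; goal_lra.
have h4 := nm_trans (G t (u t)) w g; rewrite (nmBC w (G t (u t))) in h4.
have -> : nm q = nm (g - v) by rewrite nmBC.
move: d1 gw gg h4; goal_lra.
Qed.

End EvolutionRegularity.

Lemma ae_mono (R : realType) (P Q : R -> Prop) : (forall t, P t -> Q t) ->
  {ae @lebesgue_measure R, forall t, P t} ->
  {ae @lebesgue_measure R, forall t, Q t}.
Proof.
by move=> PQ; apply: negligibleS => t /= nQ Pt; exact: nQ (PQ t Pt).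
Qed.

(** The discontinuities of a monotone function are countable. *)
Lemma nondecreasing_continuous_ae (R : realType) (a b : R) (f : R -> R) :
  {in `[a, b] &, nondecreasing_fun f} ->
  {ae @lebesgue_measure R, forall t, a < t < b -> {for t, continuous f}}.
Proof.
move=> ndf; have cD := discontinuity_countable ndf.
exists [set x | (x \in `]a, b[) /\ discontinuity f x]; split.
- exact: countable_measurable.
- exact: countable_lebesgue_measure0.
move=> t /= /not_implyP[atb nc]; split; first by rewrite in_itv.
move/andP: (atb) => [a_t tb].
have tab : t \in `]a, b[ by rewrite in_itv.
have sub x y : a <= x -> y <= b -> {in `]x, y[ &, nondecreasing_fun f}.
  move=> ax yb r s rxy sxy; apply: ndf.
    by move: rxy; rewrite !in_itv /= => /andP[? ?]; apply/andP; split; lra.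
  by move: sxy; rewrite !in_itv /= => /andP[? ?]; apply/andP; split; lra.
have cl : cvg (f x @[x --> t^'-]).
  apply: nondecreasing_at_left_is_cvgr.
    by near=> x; apply: sub; [near: x; exact: nbhs_left_ge|exact: ltW].
  near=> x; exists (f t) => _ [y + <-]; rewrite /= in_itv /= => /andP[xy yt].
  apply: ndf; rewrite ?in_itv /=; [|by rewrite !ltW|exact: ltW].
  by apply/andP; split; [apply: le_trans (ltW xy); near: x; exact: nbhs_left_ge|lra].
have cr : cvg (f x @[x --> t^'+]).
  apply: nondecreasing_at_right_is_cvgr.
    by near=> x; apply: sub; [exact: ltW|near: x; exact: nbhs_right_le].
  near=> x; exists (f t) => _ [y + <-]; rewrite /= in_itv /= => /andP[ty yx].
  apply: ndf; rewrite ?in_itv /=; [by rewrite !ltW| |exact: ltW].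
  by apply/andP; split; [lra|apply: le_trans (ltW yx) _; near: x; exact: nbhs_right_le].
split=> //; apply/eqP => lr; apply: nc; apply/left_right_continuousP.
have lf : lim (f x @[x --> t^'-]) <= f t.
  apply: limr_le => //; near=> x.
  have xt : x <= t by near: x; exact: nbhs_left_le.
  have ax : a <= x by near: x; exact: nbhs_left_ge.
  by apply: ndf => //; rewrite in_itv /=; apply/andP; split=> //; lra.
have rf : f t <= lim (f x @[x --> t^'+]).
  apply: limr_ge => //; near=> x.
  have tx : t <= x by near: x; exact: nbhs_right_ge.
  have xb : x <= b by near: x; exact: nbhs_right_le.
  by apply: ndf => //; rewrite in_itv /=; apply/andP; split=> //; lra.
have e1 : lim (f x @[x --> t^'-]) = f t by apply/eqP; rewrite eq_le lf lr.
by split; rewrite -e1; [exact: cl|rewrite lr; exact: cr].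
Unshelve. all: by end_near. Qed.

(** A strong solution of [u' + M u = G(t, u)] on [[0, T]], together with the
    value [v t] of [M] at [u t]. *)
Record strong_solution (R : realType) (V : rhilbert R) (M : V -> V -> Prop)
    (G : R -> V -> V) (T : R) (x0 : V) (u v : R -> V) : Prop := StrongSolution {
  sol_init : u 0 = x0;
  sol_lip : exists C : R, forall s t : R, 0 <= s -> s <= t -> t <= T ->
    nm (u t - u s) <= C * (t - s);
  sol_val : forall t, 0 <= t -> t <= T -> M (u t) (v t);
  sol_bound : exists C : R, forall t : R, 0 <= t -> t <= T -> nm (v t) <= C;
  sol_rder : forall s : R, 0 <= s -> s < T -> forall e : R, 0 < e ->
    exists2 eta : R, 0 < eta & forall t : R, s <= t -> t < s + eta -> t <= T ->
    nm (u t - u s - (t - s) *: (G s (u s) - v s)) <= e * (t - s);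
  sol_rcont : forall s : R, 0 <= s -> s < T -> forall e : R, 0 < e ->
    exists2 eta : R, 0 < eta & forall t : R, s <= t -> t < s + eta -> t < T ->
    nm (v t - v s) < e;
  sol_cont : {ae @lebesgue_measure R, forall t, 0 < t < T ->
    forall e : R, 0 < e -> exists2 eta : R, 0 < eta &
    forall s : R, `|s - t| < eta -> nm (v s - v t) < e } }.

(** Kato's theorem.  The speed is decreasing up to a Lipschitz function, hence
    continuous almost everywhere, and at points of continuity of the speed the velocity itself is continuous. *)
Theorem strong_solution_exists (R : realType) (V : rhilbert R)
    (M : V -> V -> Prop) (hM : maximal_monotone M) (G : R -> V -> V)
    (L T : R) (x0 v0 : V) : 0 <= L -> 0 < T -> M x0 v0 ->
  (forall s t x y,
     nm (G t x - G s y) <= L * nm (x - y) + L * (1 + nm x) * `|t - s|) ->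
  exists u v, strong_solution M G T x0 u v.
Proof.
move=> L0 T0 Mx0 GL; have [u hu] := euler_limit hM L0 T0 Mx0 GL.
have [B B0 BP] := limit_bounded hM L0 T0 Mx0 GL hu.
have [C C0 CP] := limit_value hM L0 T0 Mx0 GL hu.
have /choice[v vP] : forall t, exists w, 0 <= t -> t <= T -> M (u t) w.
  move=> t; have [/andP[t0 tT]|/negP tN] := boolP (0 <= t <= T).
    by have [w Mw _] := CP t t0 tT; exists w.
  by exists 0 => t0 tT; case: tN; rewrite t0.
have [c c0 cP] := speed_quasi_decreasing hM L0 T0 Mx0 GL hu.
exists u, v; split=> //.
- exact: (limit_init T0 hu).
- by exists B => s t s0 st tT; have [] := BP s t s0 st tT.
- exists C => t t0 tT; have [w Mw wC] := CP t t0 tT.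
  by rewrite (mm_fun hM (vP t t0 tT) Mw).
- move=> s s0 sT; apply: (limit_right_derivative hM L0 T0 Mx0 GL hu s0 sT).
  by apply: vP => //; exact: ltW.
- move=> s s0 sT e e0.
  have [eta eta0 etaP] := value_continuous hM L0 T0 Mx0 GL hu s0 (ltW sT)
    (vP s s0 (ltW sT)) e0.
  have c10 : 0 < c + 1 by rewrite addr_gt0.
  exists (eta / (c + 1)); first by rewrite divr_gt0.
  move=> t st ts tT; have t0 : 0 <= t by lra.
  have tse : (t - s) * (c + 1) < eta by rewrite -ltr_pdivlMr //; lra.
  have cts : 0 <= c * (t - s) by rewrite mulr_ge0 ?subr_ge0 // ltW.
  apply: (etaP t) => //; [exact: ltW| |by apply: vP; [|exact: ltW]|].
    by rewrite ger0_norm ?subr_ge0 //; lra.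
  have := cP s t _ _ s0 st tT (vP s s0 (ltW sT)) (vP t t0 (ltW tT)); lra.
pose N t := if t < T then nm (G t (u t) - v t) else 0.
have ndF : {in `[0, T] &, nondecreasing_fun (fun t => c * t - N t)}.
  move=> s t; rewrite !in_itv /= => /andP[s0 sT] /andP[t0 tT] st.
  have cst : c * s <= c * t by rewrite ler_wpM2l // ltW.
  have N0 r : 0 <= N r by rewrite /N; case: ifP.
  have [tT'|tT'] := boolP (t < T); last first.
    have := N0 s; have -> : N t = 0 by rewrite /N (negbTE tT').
    by lra.
  rewrite /N tT' (le_lt_trans st tT').
  by have := cP s t _ _ s0 st tT' (vP s s0 sT) (vP t t0 tT); lra.
apply: (ae_mono _ (nondecreasing_continuous_ae ndF)) => t tc /andP[t0 tT] e e0.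
have t0T : 0 < t < T by rewrite t0.
have [eta eta0 etaP] := value_continuous hM L0 T0 Mx0 GL hu (ltW t0) (ltW tT)
    (vP t (ltW t0) (ltW tT)) e0.
have /cvgrPdist_lt/(_ (eta / 2)) := tc t0T.
rewrite divr_gt0 // => /(_ isT)/nbhs_ballP[r /= r0 rP].
have c10 : 0 < 2 * c + 2 by rewrite addr_gt0 // mulr_gt0.
have [|||d [d0 d1 d2 d3]] := @pos_below3 _ (Num.min t (T - t)) r (eta / (2 * c + 2)).
- by rewrite lt_min t0 subr_gt0.
- exact: r0.
- by rewrite divr_gt0.
move: d1; rewrite le_min => /andP[d1 d1'].
exists d => // s sd; have := sd; rewrite ltr_norml => /andP[sd1 sd2].
have s0 : 0 <= s by move: d1 sd1; goal_lra. have sT : s < T by move: d1' sd2;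
  goal_lra.
have dd : d * (2 * c + 2) <= eta by rewrite -ler_pdivlMr.
have cd : `|s - t| * c <= d * c by rewrite ler_wpM2r // ltW.
have dc : 0 <= d * c by rewrite mulr_ge0 // ltW.
apply: (etaP s) => //; [exact: ltW|move: sd sd1 sd2 dd dc;
  goal_lra|by apply: vP; [|exact: ltW]|].
have := rP s; rewrite /ball /= distrC => /(_ (lt_le_trans sd d2)).
rewrite /N tT sT ltr_norml => /andP[h1 h2].
have : c * (s - t) <= d * c.
  by apply: le_trans cd; rewrite mulrC ler_wpM2r ?(ltW c0) // ler_norm.
move: sd1 sd2 dd h2; goal_lra.
Qed.

(** * Real Hilbert spaces underlying Hilbert spaces over the scalar field *)

Section ScalarLemmas.
Context {R : realType}.

Lemma ReKD (K : numFieldType) (F : scalar_field R K) (x y : K) :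
  ReK F (x + y) = ReK F x + ReK F y.
Proof. by case: K / F x y => //= -[a b] [c d]. Qed.

Lemma ReK0 (K : numFieldType) (F : scalar_field R K) : ReK F 0 = 0.
Proof. by case: K / F. Qed.

Lemma ReK_ofRM (K : numFieldType) (F : scalar_field R K) (a : R) (x : K) :
  ReK F (ofR F a * x) = a * ReK F x.
Proof. by case: K / F x => //= -[b c] /=; rewrite mul0r subr0. Qed.

Lemma ReK_conj (K : numFieldType) (F : scalar_field R K) (x : K) :
  ReK F (conjK F x) = ReK F x.
Proof. by case: K / F x => //= -[b c]. Qed.

Lemma ofRK (K : numFieldType) (F : scalar_field R K) (a : R) :
  ReK F (ofR F a) = a.
Proof. by case: K / F. Qed.

Lemma ofRD (K : numFieldType) (F : scalar_field R K) (a b : R) :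
  ofR F (a + b) = ofR F a + ofR F b.
Proof. by case: K / F => //=; rewrite rmorphD. Qed.

Lemma ofRM (K : numFieldType) (F : scalar_field R K) (a b : R) :
  ofR F (a * b) = ofR F a * ofR F b.
Proof. by case: K / F => //=; rewrite rmorphM. Qed.

Lemma ofR1 (K : numFieldType) (F : scalar_field R K) : ofR F 1 = 1.
Proof. by case: K / F. Qed.

Lemma ofR0 (K : numFieldType) (F : scalar_field R K) : ofR F 0 = 0.
Proof. by case: K / F. Qed.

Lemma ler_ofR (K : numFieldType) (F : scalar_field R K) (a b : R) :
  (ofR F a <= ofR F b) = (a <= b).
Proof. by case: K / F => //=; rewrite lecR. Qed.

Lemma ltr_ofR (K : numFieldType) (F : scalar_field R K) (a b : R) :
  (ofR F a < ofR F b) = (a < b).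
Proof. by case: K / F => //=; rewrite ltcR. Qed.

Lemma ge0_ofR (K : numFieldType) (F : scalar_field R K) (x : K) :
  0 <= x -> x = ofR F (ReK F x).
Proof. by case: K / F x => //= x x0; rewrite RRe_real // ger0_real. Qed.

Lemma norm_ofR (K : numFieldType) (F : scalar_field R K) (a : R) :
  `|ofR F a| = ofR F `|a|.
Proof. by case: K / F => //=; rewrite normc_def /= expr0n addr0 sqrtr_sqr. Qed.

End ScalarLemmas.

Lemma ofR_sign {R : realType} {K : numFieldType} (F : scalar_field R K) (n : nat) :
  ofR F ((-1) ^+ n) = (-1) ^+ n.
Proof. by case: K / F => //=; rewrite rmorphXn rmorphN1. Qed.

Lemma ofRB {R : realType} {K : numFieldType} (F : scalar_field R K) (a b : R) :
  ofR F (a - b) = ofR F a - ofR F b.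
Proof. by case: K / F => //=; rewrite rmorphB. Qed.

Section Rnorm.
Context {R : realType} {K : numFieldType} (F : scalar_field R K).
Variable V : normedModType K.
Implicit Types x y : V.

Lemma rnormE x : `|x| = ofR F (rnorm F x).
Proof. exact: ge0_ofR. Qed.

Lemma rnorm_ge0 x : 0 <= rnorm F x.
Proof. by rewrite -(ler_ofR F) -rnormE ofR0. Qed.

Lemma rnorm_lt x (e : R) : (rnorm F x < e) = (`|x| < ofR F e).
Proof. by rewrite rnormE ltr_ofR. Qed.

Lemma rnormD x y : rnorm F (x + y) <= rnorm F x + rnorm F y.
Proof. by rewrite -(ler_ofR F) ofRD -!rnormE ler_normD. Qed.

Lemma rnormN x : rnorm F (- x) = rnorm F x.
Proof. by rewrite /rnorm normrN. Qed.

Lemma rnormBC x y : rnorm F (x - y) = rnorm F (y - x).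
Proof. by rewrite /rnorm distrC. Qed.

Lemma rnorm0 : rnorm F (0 : V) = 0.
Proof. by rewrite /rnorm normr0 ReK0. Qed.

Lemma rnorm_eq0 x : rnorm F x = 0 -> x = 0.
Proof. by move=> x0; apply/normr0_eq0; rewrite rnormE x0 ofR0. Qed.

Lemma rnormZ (a : K) x : rnorm F (a *: x) = ReK F `|a| * rnorm F x.
Proof. by rewrite /rnorm normrZ {1}(ge0_ofR F (normr_ge0 a)) ReK_ofRM. Qed.

Lemma rnormZr (a : R) x : rnorm F (ofR F a *: x) = `|a| * rnorm F x.
Proof. by rewrite rnormZ norm_ofR ofRK. Qed.

Lemma ballK_real (e : K) : 0 < e -> 0 < ReK F e /\ e = ofR F (ReK F e).
Proof.
move=> e0; have eE := ge0_ofR F (ltW e0); split=> //.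
by rewrite -(ltr_ofR F) -eE ofR0.
Qed.

Lemma cvg_rnormP {T : Type} {G : set_system T} {FG : Filter G} (f : T -> V) (l : V) :
  f @ G --> l <-> forall e : R, 0 < e -> \forall t \near G, rnorm F (f t - l) < e.
Proof.
split=> [/cvgrPdist_lt h e e0|h].
  have := h (ofR F e); rewrite -(ofR0 F) ltr_ofR => /(_ e0).
  by apply: filterS => t; rewrite rnorm_lt distrC.
apply/cvgrPdist_lt => e /ballK_real[e0 eE]; apply: filterS (h _ e0) => t.
by rewrite rnorm_lt distrC -eE.
Qed.

Lemma cvg_seq_rnormP (u : nat -> V) (l : V) :
  u n @[n --> \oo] --> l <-> vcvg (@rnorm R K F V) u l.
Proof.
rewrite cvg_rnormP; split=> h e e0.
  by have [N _ hN] := h e e0; exists N => n Nn; exact: hN.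
by have [N hN] := h e e0; exists N.
Qed.

End Rnorm.

Lemma rnorm_complete {R : realType} {K : numFieldType} (F : scalar_field R K)
    (V : completeNormedModType K) (u : nat -> V) :
  vcauchy (@rnorm R K F V) u -> exists l, vcvg (@rnorm R K F V) u l.
Proof.
move=> uc; have /cvg_ex[l ul] : cvg (u n @[n --> \oo]).
  apply: cauchy_cvg; apply/cauchyP => e /(ballK_real F)[e0 eE].
  have [N hN] := uc _ e0; exists (u N); exists N => // n Nn.
  by rewrite /= -ball_normE /ball_ /= (rnormE F) eE ltr_ofR; exact: hN.
by exists l; apply/cvg_seq_rnormP.
Qed.

Definition restrict_scalars {R : realType} {K : numFieldType}
  (F : scalar_field R K) (V : normedModType K) : Type := V.

Section RestrictScalars.
Context {R : realType} {K : numFieldType} (F : scalar_field R K).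
Variable V : normedModType K.
Local Notation VR := (restrict_scalars F V).

HB.instance Definition _ := GRing.Zmodule.copy VR V.

Definition real_scale (a : R) (x : VR) : VR := ofR F a *: (x : V).

Lemma real_scaleA a b x : real_scale a (real_scale b x) = real_scale (a * b) x.
Proof. by rewrite /real_scale scalerA ofRM. Qed.

Lemma real_scale1 : left_id 1 real_scale.
Proof. by move=> x; rewrite /real_scale ofR1 scale1r. Qed.

Lemma real_scaleDr : right_distributive real_scale +%R.
Proof. by move=> a x y; rewrite /real_scale scalerDr. Qed.

Lemma real_scaleDl x : {morph real_scale^~ x : a b / a + b}.
Proof. by move=> a b; rewrite /real_scale ofRD scalerDl. Qed.

HB.instance Definition _ := GRing.Zmodule_isLmodule.Build R VR
  real_scaleA real_scale1 real_scaleDr real_scaleDl.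

End RestrictScalars.

Section Realify.
Context {R : realType} {K : numFieldType} {F : scalar_field R K}.
Variable X : hilbert F.
Implicit Types x y z : X.

Definition rdot x y : R := ReK F (inner X x y).

Lemma rdotC x y : rdot x y = rdot y x.
Proof.
by rewrite /rdot [inner X x y]hermitian_subproof /= mul1r ReK_conj.
Qed.

Lemma rdotDl x y z : rdot (x + y) z = rdot x z + rdot y z.
Proof. by rewrite /rdot linearDl ReKD. Qed.

Lemma rdotZl (a : R) x y : rdot (ofR F a *: x) y = a * rdot x y.
Proof. by rewrite /rdot linearZl_LR /= ReK_ofRM. Qed.

Lemma rdotxx x : rdot x x = rnorm F x ^+ 2.
Proof.
by rewrite /rdot inner_norm (rnormE F) -[_ ^+ 2]/(_ * _) ReK_ofRM ofRK.
Qed.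

Lemma rdot_ge0 x : 0 <= rdot x x.
Proof. by rewrite rdotxx sqr_ge0. Qed.

Lemma rdot_eq0 x : rdot x x = 0 -> x = 0.
Proof. by rewrite rdotxx => /eqP; rewrite sqrf_eq0 => /eqP; exact: rnorm_eq0. Qed.

Lemma sqrt_rdot x : Num.sqrt (rdot x x) = rnorm F x.
Proof. by rewrite rdotxx sqrtr_sqr ger0_norm // rnorm_ge0. Qed.

Lemma rdot_complete (u : nat -> X) :
  vcauchy (fun x => Num.sqrt (rdot x x)) u ->
  exists l, vcvg (fun x => Num.sqrt (rdot x x)) u l.
Proof.
have -> : (fun x => Num.sqrt (rdot x x)) = @rnorm R K F X.
  by apply/funext => x; exact: sqrt_rdot.
exact: rnorm_complete.
Qed.

Definition realify : rhilbert R :=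
  @RHilbert R (restrict_scalars F X) rdot rdotC rdotDl rdotZl rdot_ge0
    rdot_eq0 rdot_complete.

Lemma nm_realify (x : realify) : nm x = rnorm F (x : X).
Proof. exact: sqrt_rdot. Qed.

End Realify.

Section RealifyLinear.
Context {R : realType} {K : numFieldType} {F : scalar_field R K}.
Context {X Y : hilbert F}.

Definition realify_lin (f : {linear X -> Y}) : realify X -> realify Y := f.

Variable f : {linear X -> Y}.

Lemma realify_lin_linear : linear (realify_lin f : realify X -> realify Y).
Proof. by move=> a x y; rewrite /realify_lin; exact: linearP. Qed.

HB.instance Definition _ := GRing.isLinear.Build R (realify X) (realify Y) _
  (realify_lin f) realify_lin_linear.

End RealifyLinear.

(** * The nonlinear boundary operator is maximal monotone *)

(** The solution of least norm depends linearly on the right-hand side, and is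
    bounded by the open mapping theorem. *)
Lemma right_inverse (R : realType) (D W Y : rhilbert R) (E : {linear D -> W})
    (L : {linear D -> Y}) (cE cL : R) :
  (forall x, nm (E x) <= cE * nm x) -> (forall x, nm (L x) <= cL * nm x) ->
  (forall y, exists x, E x = 0 /\ L x = y) ->
  exists (P : {linear Y -> D}) (c : R), 0 < c /\
    forall y, [/\ E (P y) = 0, L (P y) = y & nm (P y) <= c * nm y].
Proof.
move=> Eb Lb Ls; have [c [c0 cP]] := open_mapping Eb Lb Ls.
pose N x := E x = 0 /\ L x = 0.
have /choice[P PP] : forall y, exists x, [/\ E x = 0, L x = y, nm x <= c * nm y &
    forall n, N n -> dot x n = 0].
  move=> y; have [x [Ex Lx xc]] := cP y.
  have [|||p [pN po]] := @projection _ _ N x.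
  - by split; rewrite linear0.
  - by move=> a b [Ea La] [Eb' Lb']; split; rewrite linearD ?Ea ?La ?Eb' ?Lb' addr0.
  - by move=> a b [Ea La]; split; rewrite linearZ /= ?Ea ?La scaler0.
  have Ep : E p = 0.
    apply: (bounded_closed Eb) => e e0; have [s [Es _] sp] := pN e e0.
    by exists s => //; rewrite Es subrr nm0 ltW.
  have Lp : L p = 0.
    apply: (bounded_closed Lb) => e e0; have [s [_ Lse] sp] := pN e e0.
    by exists s => //; rewrite Lse subrr nm0 ltW.
  exists (x - p); split=> //; try by rewrite linearB ?Ex ?Lx ?Ep ?Lp subr0.
  apply: le_trans xc; apply: le_nm => //.
  have := po p (conj Ep Lp); rewrite sqr_nm !dotE [dot p x]dotC.
  by have := dot_ge0 p; lra.
have Plin : linear P.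
  move=> a x y; have [E1 L1 _ o1] := PP (a *: x + y).
  have [E2 L2 _ o2] := PP x; have [E3 L3 _ o3] := PP y.
  pose n := P (a *: x + y) - (a *: P x + P y).
  have Nn : N n.
    by split; rewrite /n linearB linearP /= ?E1 ?E2 ?E3 ?L1 ?L2 ?L3 ?scaler0 ?addr0 subrr.
  have dn m : dot (P (a *: x + y) - (a *: P x + P y)) m =
      dot (P (a *: x + y)) m - (a * dot (P x) m + dot (P y) m).
    by rewrite !dotE; ring.
  apply/eqP; rewrite -subr_eq0; apply/eqP/dot_eq0; rewrite -/n {1}/n dn.
  by rewrite (o1 _ Nn) (o2 _ Nn) (o3 _ Nn); ring.
pose Pl : {linear Y -> D} := HB.pack P (GRing.isLinear.Build _ _ _ _ P Plin).
by exists Pl, c; split=> // y; have [] := PP y.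
Qed.

Section Psi.
Context {R : realType} {U : rhilbert R}.
Implicit Types e v : U.

(** The funnel feedback [psi(1, e)]. *)
Definition funnel e : U := (1 - nm e ^+ 2)^-1 *: e.

(** On the unit ball, the gain is at least 1 and increases with the norm. *)
Lemma funnel_mono e1 e2 : nm e1 < 1 -> nm e2 < 1 ->
  nm (e1 - e2) ^+ 2 <= dot (funnel e1 - funnel e2) (e1 - e2).
Proof.
move=> h1 h2; rewrite /funnel sqr_nm.
have p0 := nm_ge0 e1; have q0 := nm_ge0 e2.
have d1 : 0 < 1 - nm e1 ^+ 2 by nra.
have d2 : 0 < 1 - nm e2 ^+ 2 by nra.
set a := (1 - nm e1 ^+ 2)^-1; set b := (1 - nm e2 ^+ 2)^-1.
have a1 : 1 <= a by rewrite /a invf_ge1 //; have := sqr_ge0 (nm e1); lra.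
have b1 : 1 <= b by rewrite /b invf_ge1 //; have := sqr_ge0 (nm e2); lra.
have key : 0 <= (nm e1 - nm e2) * ((a - 1) * nm e1 - (b - 1) * nm e2).
  have [le|/ltW le] := leP (nm e1) (nm e2).
    have ab : a <= b by rewrite /a /b lef_pV2 ?posrE //; nra.
    by rewrite mulr_le0 ?subr_le0 //; apply: ler_pM; rewrite ?subr_ge0 ?lerB.
  have ab : b <= a by rewrite /a /b lef_pV2 ?posrE //; nra.
  by rewrite mulr_ge0 ?subr_ge0 //; apply: ler_pM; rewrite ?subr_ge0 ?lerB.
have cs : (a + b - 2) * dot e1 e2 <= (a + b - 2) * (nm e1 * nm e2).
  by rewrite ler_wpM2l ?dot_le //; lra.
rewrite !dotE [dot e2 e1]dotC -!sqr_nm; lra.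
Qed.

(** The scalar equation for the norm of [e] is a cubic one. *)
Lemma funnel_resolvent (k : R) : 0 < k ->
  forall v, exists2 e, nm e < 1 & e + k *: funnel e = v.
Proof.
move=> k0 v; have [v0|vN0] := eqVneq (nm v) 0.
  by exists 0; rewrite ?nm0 ?ltr01 // (nm_eq0 v0) /funnel !scaler0 addr0.
have vp : 0 < nm v by rewrite lt_neqAle eq_sym vN0 nm_ge0.
pose p : {poly R} := 'X * (1 - 'X^2) + k *: 'X - (nm v) *: (1 - 'X^2).
have pE r : p.[r] = r * (1 - r ^+ 2) + k * r - nm v * (1 - r ^+ 2).
  by rewrite /p !hornerE.
have [|r /andP[r0 r1] /rootP pr] := @poly_ivt R p 0 1 ler01.
  by rewrite !pE; apply/andP; split; lra.
rewrite pE in pr.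
have r1' : r < 1.
  rewrite lt_neqAle r1 andbT; apply/eqP => r1e; move: pr; rewrite r1e; lra.
have d0 : 0 < 1 - r ^+ 2 by nra.
have e_nm : nm ((r / nm v) *: v) = r.
  by rewrite nmZ ger0_norm ?divr_ge0 // divfK.
exists ((r / nm v) *: v); first by rewrite e_nm.
rewrite /funnel e_nm !scalerA -scalerDl -[RHS]scale1r; congr (_ *: _).
have vE : nm v = (r * (1 - r ^+ 2) + k * r) / (1 - r ^+ 2).
  by apply/(canRL (mulfK (lt0r_neq0 d0))); lra.
have rp : r != 0.
  by apply: contra vN0 => /eqP r00; rewrite vE r00 !mul0r mulr0 addr0 mul0r.
have kp : 1 - r ^+ 2 + k != 0 by rewrite gt_eqF //; lra.
have -> : r / nm v = (1 - r ^+ 2) / (1 - r ^+ 2 + k).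
  apply/eqP; rewrite eqr_div //; apply/eqP; lra.
by field; rewrite kp gt_eqF.
Qed.

(** Forward-backward splitting: the resolvent of the strongly monotone [funnel]
    absorbs the expansion of the explicit step with [K], so that the composite
    is a contraction for a small step [k]. *)
Lemma funnel_perturbed (K : {linear U -> U}) (c : R) :
  (forall e, nm (K e) <= c * nm e) -> (forall e, 0 <= dot (K e) e) ->
  forall b, exists2 e, nm e < 1 & K e + funnel e = b.
Proof.
move=> Kb Km b; pose k := (c ^+ 2 + 1)^-1.
have c1 : 0 < c ^+ 2 + 1 by rewrite ltr_wpDl // sqr_ge0.
have k0 : 0 < k by rewrite invr_gt0.
have kc : k * c ^+ 2 <= 1.
  by rewrite /k mulrC ler_pdivrMr // mul1r lerDl.
have /choice[J JP] : forall v, exists e, nm e < 1 /\ e + k *: funnel e = v.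
  by move=> v; have [e e1 ev] := funnel_resolvent k0 v; exists e.
have Jlip x y : (1 + k) * nm (J x - J y) <= nm (x - y).
  have [x1 xE] := JP x; have [y1 yE] := JP y.
  have [j0|jN] := eqVneq (nm (J x - J y)) 0; first by rewrite j0 mulr0.
  have jp : 0 < nm (J x - J y) by rewrite lt_neqAle eq_sym jN nm_ge0.
  rewrite -(ler_pM2r jp); apply: le_trans (dot_le _ _).
  have -> : x - y = (J x - J y) + k *: (funnel (J x) - funnel (J y)).
    by rewrite -{1}xE -{1}yE; vring.
  rewrite dotDl dotZl -sqr_nm.
  have := ler_wpM2l (ltW k0) (funnel_mono x1 y1); lra.
have k1 : 0 < 1 + k by rewrite addr_gt0.
pose q := (Num.sqrt (1 + k))^-1.
have q0 : 0 <= q by rewrite invr_ge0 sqrtr_ge0.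
have q1 : q < 1.
  by rewrite invf_lt1 ?sqrtr_gt0 // -[ltLHS]sqrtr1 ltr_sqrt // ltrDl.
have [x y|e eE] := @contraction_fixpoint _ U (fun e => J (e - k *: (K e - b))) q
  q0 q1.
  set X := x - k *: (K x - b); set Y := y - k *: (K y - b).
  have h := Jlip X Y; set d := x - y.
  have KE : K d = K x - K y by rewrite /d linearB.
  have XY : X - Y = d - k *: K d by rewrite KE /X /Y /d; vring.
  clearbody d.
  have h2 : nm (X - Y) <= Num.sqrt (1 + k) * nm d.
    apply: le_nm; first by rewrite mulr_ge0 // sqrtr_ge0.
    rewrite XY exprMn sqr_sqrtr ?(ltW k1) // !dotE [dot d (K d)]dotC -!sqr_nm.
    have h3 : nm (K d) ^+ 2 <= c ^+ 2 * nm d ^+ 2.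
      rewrite -exprMn ler_sqr ?nnegrE //; exact: le_trans (Kb d).
    have h4 : k * (k * nm (K d) ^+ 2) <= k * nm d ^+ 2.
      rewrite ler_wpM2l ?(ltW k0) //.
      have := ler_wpM2l (ltW k0) h3; have := ler_wpM2r (sqr_ge0 (nm d)) kc; lra.
    have := mulr_ge0 (ltW k0) (Km d); lra.
  have qE : q * (1 + k) = Num.sqrt (1 + k).
    rewrite -[X in _ * X](sqr_sqrtr (ltW k1)) expr2 /q mulKf //.
    by rewrite gt_eqF // sqrtr_gt0.
  rewrite -(ler_pM2l k1) mulrA [_ * q]mulrC qE; exact: le_trans h h2.
have [e1 e2] := JP (e - k *: (K e - b)); rewrite eE in e1 e2.
exists e => //; apply/eqP; rewrite -subr_eq0; apply/eqP.
have : k *: (K e + funnel e - b) = 0.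
  have -> : k *: (K e + funnel e - b) =
    (e + k *: funnel e) - (e - k *: (K e - b)) by clearbody k; vring.
  by rewrite e2 subrr.
by move/eqP; rewrite scaler_eq0 gt_eqF //= => /eqP.
Qed.

End Psi.

Section BoundaryOperator.
Context {R : realType} {X D U : rhilbert R}.
Variables (i A : {linear D -> X}) (B C : {linear D -> U}).
Variables (ci cA cB cC alpha beta : R).
Hypothesis i_inj : injective i.
Hypothesis ib : forall x, nm (i x) <= ci * nm x.
Hypothesis Ab : forall x, nm (A x) <= cA * nm x.
Hypothesis Bb : forall x, nm (B x) <= cB * nm x.
Hypothesis Cb : forall x, nm (C x) <= cC * nm x.
Hypothesis S1 : forall x,
  dot (A x) (i x) <= dot (B x) (C x) + alpha * nm (i x) ^+ 2.
Hypothesis ab : alpha <= beta.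
Hypothesis S2 : forall z, exists x, C x = 0 /\ A x - beta *: i x = z.
Hypothesis S3 : forall v w, exists x, B x = v /\ C x = w.

Lemma output_lift : exists (P : {linear U -> D}) (c : R), 0 < c /\
  forall w, [/\ B (P w) = 0, C (P w) = w & nm (P w) <= c * nm w].
Proof. by apply: right_inverse Bb Cb _ => w; exact: S3. Qed.

Let shifted_linear (l : R) : linear (fun x => A x - l *: i x).
Proof. by move=> a x y; rewrite !linearP; vring. Qed.

Definition shifted (l : R) : {linear D -> X} :=
  HB.pack (fun x => A x - l *: i x)
    (GRing.isLinear.Build _ _ _ _ _ (shifted_linear l)).

Lemma shifted_bounded l x : nm (shifted l x) <= (cA + `|l| * ci) * nm x.
Proof.
rewrite /shifted /=; apply: le_trans (nmB _ _) _; rewrite nmZ mulrDl.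
by rewrite lerD // -mulrA ler_wpM2l.
Qed.

(** As [beta] may equal [alpha], dissipativity alone does not bound the inverse
    at [beta]; the open mapping theorem does, and gives room to move to the
    right of [alpha]. *)
Lemma resolvent_right : exists2 l : R, alpha < l &
  exists (P : {linear X -> D}) (c : R), 0 < c /\
  forall z, [/\ C (P z) = 0, A (P z) - l *: i (P z) = z & nm (P z) <= c * nm z].
Proof.
have [G [c [c0 GP]]] := right_inverse Cb (shifted_bounded beta) S2.
pose e := (2 * c * (`|ci| + 1))^-1.
have ci0 : 0 < `|ci| + 1 by rewrite ltr_wpDl.
have e0 : 0 < e by rewrite invr_gt0 !mulr_gt0.
exists (beta + e); first by have := ab; lra.
apply: right_inverse Cb (shifted_bounded (beta + e)) _ => z.
have [||x y|x xE] := @contraction_fixpoint _ D (fun x => G (z + e *: i x)) (1 / 2).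
- lra.
- lra.
- rewrite -linearB /=; have -> : z + e *: i x - (z + e *: i y) = e *: i (x - y).
    by rewrite linearB; vring.
  have [_ _ h] := GP (e *: i (x - y)); apply: le_trans h _.
  rewrite nmZ gtr0_norm // mulrA.
  have h1 : nm (i (x - y)) <= (`|ci| + 1) * nm (x - y).
    apply: le_trans (ib _) _; rewrite ler_wpM2r //.
    by have := ler_norm ci; lra.
  have -> : 1 / 2 * nm (x - y) = c * e * ((`|ci| + 1) * nm (x - y)).
    by rewrite /e; field; rewrite !gt_eqF.
  by rewrite ler_wpM2l // mulr_ge0 // ltW.
have [h1 h2 _] := GP (z + e *: i x); rewrite xE /= in h1 h2.
exists x; split=> //=; rewrite scalerDl opprD addrA.
by move: h2; rewrite /shifted /= => ->; rewrite addrK.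
Qed.

(** The feedback law for the constant gain 1, the reference signal 0 and no
    feedforward, to which the general law reduces by a change of variables. *)
Definition closed_loop_dom (w : D) : Prop := nm (C w) < 1 /\ B w = - funnel (C w).

Lemma closed_loop_dissipative w1 w2 : closed_loop_dom w1 -> closed_loop_dom w2 ->
  dot (A (w1 - w2)) (i (w1 - w2)) <= alpha * nm (i (w1 - w2)) ^+ 2.
Proof.
move=> [c1 b1] [c2 b2]; apply: le_trans (S1 _) _; rewrite gerDr !linearB /= b1 b2.
have -> : - funnel (C w1) - - funnel (C w2) = - (funnel (C w1) - funnel (C w2)).
  by vring.
by rewrite dotNl oppr_le0; apply: le_trans (funnel_mono c1 c2); rewrite sqr_ge0.
Qed.

(** Subtracting the solution with output 0 leaves a homogeneous problem, whose
    only unknown is the output [e] and whose boundary condition is an equation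
    [K e + funnel e = b] with [K] monotone. *)
Lemma range_at_one_point : exists2 l : R, alpha < l &
  forall z, exists2 w, closed_loop_dom w & l *: i w - A w = z.
Proof.
have [l al [G [c [c0 GP]]]] := resolvent_right.
have [P [cP [cP0 PP]]] := output_lift.
(* [P1] solves the homogeneous equation with prescribed output *)
pose P1 w := P w - G (shifted l (P w)).
have P1lin : linear (fun w => B (P1 w)).
  by move=> a x y; rewrite /P1 !(linearP, linearB) /= ?linearP /=; vring.
pose BP w := B (P1 w).
pose K : {linear U -> U} := HB.pack BP (GRing.isLinear.Build _ _ _ _ BP P1lin).
have P1C w : C (P1 w) = w.
  have [_ h _] := PP w; have [h2 _ _] := GP (shifted l (P w)).
  by rewrite /P1 linearB h h2 subr0.
have P1A w : A (P1 w) = l *: i (P1 w).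
  have [_ h _] := GP (shifted l (P w)).
  have {}h : shifted l (G (shifted l (P w))) = shifted l (P w) := h.
  apply/eqP; rewrite -subr_eq0 -[_ - _]/(shifted l (P1 w)) /P1 linearB h.
  by rewrite subrr.
have Kb w : nm (K w) <= (`|cB| * (cP + c * ((`|cA| + `|l| * `|ci|) * cP))) * nm w.
  rewrite /K /= /BP; apply: le_trans (Bb _) _.
  apply: (@le_trans _ _ (`|cB| * nm (P1 w))).
    by rewrite ler_wpM2r // ler_norm.
  rewrite -mulrA ler_wpM2l //; apply: le_trans (nmB _ _) _.
  have [_ _ h] := PP w; have [_ _ h2] := GP (shifted l (P w)).
  have h3 := shifted_bounded l (P w).
  have h4 : (cA + `|l| * ci) * nm (P w) <= (`|cA| + `|l| * `|ci|) * (cP * nm w).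
    apply: (@le_trans _ _ ((`|cA| + `|l| * `|ci|) * nm (P w))).
      by rewrite ler_wpM2r // lerD ?ler_norm // ler_wpM2l ?ler_norm.
    by rewrite ler_wpM2l // addr_ge0 // mulr_ge0.
  have := ler_wpM2l (ltW c0) (le_trans h3 h4); lra.
have Km w : 0 <= dot (K w) w.
  have := S1 (P1 w); rewrite P1A P1C dotZl -sqr_nm /K /= /BP => h.
  have : alpha * nm (i (P1 w)) ^+ 2 <= l * nm (i (P1 w)) ^+ 2.
    by rewrite ler_wpM2r ?sqr_ge0 // ltW.
  lra.
exists l => // z; have [e e1 eE] := funnel_perturbed Kb Km (- B (G (- z))).
have [g1 g2 _] := GP (- z).
exists (G (- z) + P1 e).
  have Ce : C (G (- z) + P1 e) = e by rewrite linearD g1 P1C add0r.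
  split; rewrite Ce //; apply: (addrI (- B (G (- z)))).
  by rewrite -{2}eE linearD /= /K /= /BP; vring.
have zE : z = - (A (G (- z)) - l *: i (G (- z))) by rewrite g2 opprK.
by rewrite (linearD i) (linearD A) P1A [RHS]zE; vring.
Qed.

Definition closed_loop_graph (x v : X) : Prop :=
  exists w, [/\ closed_loop_dom w, i w = x & v = alpha *: i w - A w].

(** The range condition propagates from one parameter to a neighbouring one by
    the contraction principle, hence to all parameters. *)
Lemma closed_loop_maximal_monotone : maximal_monotone closed_loop_graph.
Proof.
have dd w1 w2 : closed_loop_dom w1 -> closed_loop_dom w2 ->
    0 <= dot ((alpha *: i w1 - A w1) - (alpha *: i w2 - A w2)) (i w1 - i w2).
  move=> d1 d2; have := closed_loop_dissipative d1 d2.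
  have -> : alpha *: i w1 - A w1 - (alpha *: i w2 - A w2) =
    alpha *: i (w1 - w2) - A (w1 - w2) by rewrite !linearB /=; vring.
  have -> : i w1 - i w2 = i (w1 - w2) by rewrite linearB.
  by rewrite dotDl dotNl dotZl -sqr_nm subr_ge0.
pose solv m := forall z, exists2 w, closed_loop_dom w & (alpha + m) *: i w - A w = z.
(* from one parameter to nearby ones by a contraction *)
have step m m' : 0 < m -> 0 < m' -> m' <= 3 / 2 * m -> solv m -> solv m'.
  move=> m0 m'0 mm sm z.
  have /choice[J JP] : forall y, exists w, closed_loop_dom w /\
      (alpha + m) *: i w - A w = y.
    by move=> y; have [w ? ?] := sm y; exists w.
  have Jl x y : m * nm (i (J x) - i (J y)) <= nm (x - y).
    have [x1 xE] := JP x; have [y1 yE] := JP y.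
    have [j0|jN] := eqVneq (nm (i (J x) - i (J y))) 0; first by rewrite j0 mulr0.
    have jp : 0 < nm (i (J x) - i (J y)) by rewrite lt_neqAle eq_sym jN nm_ge0.
    rewrite -(ler_pM2r jp); apply: le_trans (dot_le _ _).
    have -> : x - y = m *: (i (J x) - i (J y)) +
        ((alpha *: i (J x) - A (J x)) - (alpha *: i (J y) - A (J y))).
      by rewrite -{1}xE -{1}yE; vring.
    by rewrite dotDl dotZl -sqr_nm; have := dd _ _ x1 y1; lra.
  have q1 : `|m - m'| / m < 1 by rewrite ltr_pdivrMr // mul1r ltr_norml; lra.
  have q0 : 0 <= `|m - m'| / m by rewrite divr_ge0 // ltW.
  have [x y|x xE] := @contraction_fixpoint _ X
      (fun x => i (J (z + (m - m') *: x))) _ q0 q1.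
    rewrite -(ler_pM2l m0); apply: le_trans (Jl _ _) _.
    have -> : z + (m - m') *: x - (z + (m - m') *: y) = (m - m') *: (x - y).
      by vring.
    by rewrite nmZ mulrA mulrCA divff ?gt_eqF // mulr1.
  have [w1 wE] := JP (z + (m - m') *: x).
  move: (J (z + (m - m') *: x)) w1 wE xE => w w1 wE xE; exists w => //.
  by apply: (addIr ((m - m') *: x)); rewrite -wE -xE; vring.
have [l al sl] := range_at_one_point.
have m0 : 0 < l - alpha by rewrite subr_gt0.
have s0 : solv (l - alpha).
  by move=> z; have [w dw wE] := sl z; exists w => //; rewrite [alpha + _]addrC subrK.
have sn n : solv ((3 / 2) ^+ n * (l - alpha)).
  elim: n => [|n ih]; first by rewrite expr0 mul1r.
  have p0 : 0 < (3 / 2 : R) ^+ n * (l - alpha) by rewrite mulr_gt0 // exprn_gt0.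
  apply: (step _ _ p0 _ _ ih); rewrite exprS; lra.
have sall m : 0 < m -> solv m.
  move=> m1; have [|||n hn] := @expr_small R (2 / 3) ((l - alpha) / m).
  - lra.
  - lra.
  - exact: divr_gt0.
  have p0 : 0 < (3 / 2 : R) ^+ n by rewrite exprn_gt0.
  have pp : (3 / 2 : R) ^+ n * (2 / 3) ^+ n = 1.
    by rewrite -exprMn -[RHS](expr1n _ n); congr (_ ^+ _); field.
  apply: step (sn n) => //; first exact: mulr_gt0.
  rewrite ltr_pdivlMr // in hn; have := ler_wpM2l (ltW p0) (ltW hn).
  rewrite mulrA pp mul1r => h; have := mulr_gt0 p0 m0; lra.
split.
- move=> x v y w [w1 [d1 <- ->]] [w2 [d2 <- ->]]; exact: dd.
- by move=> x v w [w1 [d1 <- ->]] [w2 [d2 /i_inj -> ->]].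
- move=> h h0 z; have hi : 0 < h^-1 by rewrite invr_gt0.
  have [w dw wE] := sall _ hi (h^-1 *: z).
  exists (i w), (alpha *: i w - A w); split; first by exists w.
  have -> : i w + h *: (alpha *: i w - A w) = h *: ((alpha + h^-1) *: i w - A w).
    by vfield; rewrite gt_eqF.
  by rewrite wE scalerA divff ?gt_eqF // scale1r.
Qed.

(** A vector orthogonal to the image of the kernel of [C] is killed by
    dissipativity. *)
Lemma kernel_dense z (e : R) : 0 < e -> exists2 w, C w = 0 & nm (i w - z) < e.
Proof.
move=> e0; have [l al [G [c [c0 GP]]]] := resolvent_right.
have [|||p [pS po]] := @projection _ _ (fun x => exists2 w, C w = 0 & i w = x) z.
- by exists 0; rewrite linear0.
- by move=> _ _ [w Cw <-] [w' Cw' <-]; exists (w + w'); rewrite linearD ?Cw ?Cw' ?addr0.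
- by move=> a _ [w Cw <-]; exists (a *: w); rewrite linearZ /= ?Cw ?scaler0.
have [g1 g2 _] := GP (z - p); set w := G (z - p) in g1 g2.
have := po _ (ex_intro2 _ _ w g1 erefl); rewrite -g2 dotDl dotNl dotZl -sqr_nm.
have := S1 w; rewrite g1 dot0r add0r => h1 h2.
have iw0 : nm (i w) ^+ 2 = 0.
  apply/eqP; rewrite eq_le sqr_ge0 andbT.
  have la : 0 < l - alpha by rewrite subr_gt0.
  by rewrite -(ler_pM2l la) mulr0; lra.
have w0 : w = 0.
  apply: i_inj; rewrite linear0; apply: nm_eq0; apply/eqP.
  by rewrite -sqrf_eq0 iw0.
have zp : z = p.
  move: g2; rewrite w0 (linear0 A) (linear0 i) scaler0 subrr => /esym/eqP.
  by rewrite subr_eq0 => /eqP.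
by rewrite zp; have [_ [w' Cw <-] h] := pS e e0; exists w'.
Qed.

End BoundaryOperator.

(** * Lipschitz functions with nonpositive derivative almost everywhere *)

Lemma negligible_point {R : realType} (x : R) :
  (@lebesgue_measure R).-negligible [set x].
Proof. by exists [set x]; split=> //; exact: lebesgue_measure_set1. Qed.

Section DiniAE.
Context {R : realType}.
Local Notation mu := (@lebesgue_measure R).

Lemma negligible_open_cover (N : set R) (e : R) : mu.-negligible N -> 0 < e ->
  exists Q : set R, [/\ open Q, N `<=` Q & (mu Q < e%:E)%E].
Proof.
move=> [A [mA muA0 NA]] e0; have muA : mu A = 0%E := muA0.
have [|Q [oO AO OA]] := @lebesgue_regularity_outer R A e mA _ e0.
  by have : (mu A < +oo)%E; [rewrite muA ltry|exact].
exists Q; split=> //; first exact: subset_trans AO.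
have -> : Q = A `|` (Q `\` A) by rewrite setDUK.
have mOA : measurable (Q `\` A) by apply: measurableD => //; exact: open_measurable.
apply: le_lt_trans (measureU2 mu mA mOA) _.
by have : (mu A + mu (Q `\` A) < e%:E)%E; [rewrite muA add0e|exact].
Qed.

(** The exceptional set is covered by an open set [Q] of small measure, and the
    increase of [f] on [Q] is compensated by that of the measure of
    [Q `&` `[a, t]]. *)
Lemma dini_nonincreasing (f : R -> R) (a b L : R) (N : set R) :
  a <= b -> 0 <= L ->
  (forall s t, a <= s -> s <= t -> t <= b -> f t - f s <= L * (t - s)) ->
  mu.-negligible N ->
  (forall t, a <= t -> t < b -> ~ N t -> forall e : R, 0 < e ->
     exists2 eta : R, 0 < eta & forall t', t <= t' -> t' < t + eta -> t' <= b ->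
     f t' - f t <= e * (t' - t)) ->
  f b <= f a.
Proof.
move=> ab L0 fL N0 fD; apply: (@le_eps _ _ _ ((b - a) + L)) => e e0.
have [Q [oO NO muO]] := negligible_open_cover N0 e0.
have mO : measurable Q by exact: open_measurable.
pose m t := fine (mu (Q `&` `[a, t]%classic)).
have mI t : measurable (Q `&` `[a, t]%classic) by exact: measurableI.
have mfin t : (mu (Q `&` `[a, t]%classic) < e%:E)%E.
  by apply: le_lt_trans muO; apply: le_measure;
    rewrite ?inE; [exact: mI|exact: mO|exact: subIsetl].
have mE t : mu (Q `&` `[a, t]%classic) = (m t)%:E.
  by rewrite /m fineK // ge0_fin_numE //; apply: lt_le_trans (mfin t) (leey _).
have me t : m t <= e by rewrite -lee_fin -mE ltW.
have mmono s t : s <= t -> m s <= m t.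
  move=> st; rewrite -lee_fin -!mE; apply: le_measure; rewrite ?inE; [exact: mI|exact: mI|].
  by apply: setIS => r /=; rewrite !in_itv /= => /andP[-> /le_trans]; apply.
have m0 t : 0 <= m t by rewrite -lee_fin -mE.
(* inside [Q], the measure grows at unit speed *)
have mO1 s t : a <= s -> s <= t -> `]s, t]%classic `<=` Q -> m s + (t - s) <= m t.
  move=> as_ st stO; rewrite -lee_fin EFinD -!mE.
  have -> : (t - s)%:E = mu `]s, t]%classic.
    by rewrite lebesgue_measure_itv /= lte_fin; case: ltP => // ts;
      rewrite (_ : t = s) ?subrr //; apply/le_anti; rewrite ts st.
  have mst : measurable (`]s, t]%classic : set R) by exact: measurable_itv.
  have <- : mu ((Q `&` `[a, s]) `|` `]s, t])%classic =
      (mu (Q `&` `[a, s]) + mu `]s, t])%E.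
    apply: measureU => //; first exact: mI.
    apply/seteqP; split=> // r [[_] /=]; rewrite !in_itv /= => /andP[_ rs] /andP[sr _].
    by move: sr; rewrite ltNge rs.
  apply: le_measure; rewrite ?inE; [apply: measurableU => //; exact: mI|exact: mI|].
  move=> r [[Or] /=|/[dup] rO /=]; rewrite !in_itv /=.
    by move=> /andP[ar rs]; split=> //; rewrite ar (le_trans rs).
  move=> /andP[sr rt]; split; last by apply/andP; split; lra.
  by apply: stO; rewrite /= in_itv /= sr.
pose S := [set t | a <= t <= b /\ f t <= f a + e * (t - a) + L * m t].
have Sa : S a by split; [rewrite lexx ab|have := mulr_ge0 L0 (m0 a); lra].
have Sub : has_ubound S by exists b => t [/andP[]].
have Ss : has_sup S by split; [exists a|].
set c := sup S.
have ac : a <= c by apply: ub_le_sup.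
have cb : c <= b by apply: ge_sup => [|t [/andP[]]] //; exists a.
have Sc : f c <= f a + e * (c - a) + L * m c.
  apply: (@le_eps _ _ _ L) => d d0.
  have [s [/andP[as_ sb] fs] sd] := sup_adherent d0 Ss.
  have sc : s <= c by apply: ub_le_sup => //; split=> //; rewrite as_.
  have h1 := fL s c as_ sc cb.
  have h2 : L * m s <= L * m c by rewrite ler_wpM2l // mmono.
  have h3 : L * (c - s) <= L * d by rewrite ler_wpM2l //; rewrite -/c in sd; lra.
  have h4 : e * (s - a) <= e * (c - a) by rewrite ler_wpM2l ?(ltW e0) //; lra.
  lra.
have [cb'|bc] := ltP c b; last first.
  have bc' : b = c by lra.
  have : L * m c <= L * e by rewrite ler_wpM2l.
  rewrite {1}bc'; move: Sc; rewrite bc'; lra.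
have nS t : c < t -> t <= b -> ~ (f t <= f a + e * (t - a) + L * m t).
  move=> ct tb ft; have : t <= c; last by lra.
  by apply: ub_le_sup => //; split=> //; apply/andP; split;
    move: ac ct tb; goal_lra.
have [Oc|nOc] := pselect (Q c).
  have /nbhs_ballP[r /= r0 rO] := open_nbhs_nbhs (conj oO Oc).
  have bc0 : 0 < b - c by lra.
  have r20 : 0 < r / 2 by rewrite divr_gt0.
  have [d [d0 d1 d2]] := pos_below2 r20 bc0.
  exfalso; apply: (nS (c + d)); [move: d0 d2; goal_lra|move: d0 d2; goal_lra|].
  have h1 := fL c (c + d) ac _ _; have {}h1 : f (c + d) - f c <= L * d.
    by have := h1; rewrite addrAC subrr add0r; apply; move: d0 d2; goal_lra.
  have h2 : m c + d <= m (c + d).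
    have := mO1 c (c + d) ac _ _; rewrite [c + d - c]addrAC subrr add0r; apply.
      lra.
    move=> t /=; rewrite in_itv /= => /andP[ct td]; apply: rO.
    rewrite /ball /= ltr_norml; lra.
  have := ler_wpM2l L0 h2; have := mulr_ge0 (ltW e0) (ltW d0); lra.
have [eta eta0 etaP] := fD c ac cb' (fun Nc => nOc (NO _ Nc)) e e0.
have bc0 : 0 < b - c by lra.
have e20 : 0 < eta / 2 by rewrite divr_gt0.
have [d [d0 d1 d2]] := pos_below2 e20 bc0.
exfalso; apply: (nS (c + d)); [move: d0 d2; goal_lra|move: d0 d2; goal_lra|].
have h1 := etaP (c + d) _ _ _; have {}h1 : f (c + d) - f c <= e * (c + d - c).
  by apply: h1; move: d0 d1 d2; goal_lra.
have := ler_wpM2l L0 (mmono c (c + d) _); rewrite lerDl (ltW d0) => /(_ isT).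
lra.
Qed.

(** The weight [exp (- c t)] turns the differential inequality into a
    decrease. *)
Lemma gronwall_ae (r : R -> R) (T L c : R) (N : set R) :
  0 <= T -> 0 <= c -> (forall t, 0 <= t -> t <= T -> 0 <= r t) -> r 0 = 0 ->
  (forall s t, 0 <= s -> s <= t -> t <= T -> `|r t - r s| <= L * (t - s)) ->
  mu.-negligible N ->
  (forall t, 0 <= t -> t < T -> ~ N t -> forall e : R, 0 < e ->
     exists2 eta : R, 0 < eta & forall t', t <= t' -> t' < t + eta -> t' <= T ->
     r t' - r t <= (c * r t + e) * (t' - t)) ->
  r T = 0.
Proof.
move=> T0 c0 r0 r00 rL N0 rD.
pose g t := expR (- (c * t)).
have gpos t : 0 < g t by exact: expR_gt0.
have g1 t : 0 <= t -> g t <= 1.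
  by move=> t0; rewrite -expR0 ler_expR oppr_le0 mulr_ge0.
(* the exponential weight is decreasing at the right speed *)
have gD t t' : t <= t' -> g t' * (1 + c * (t' - t)) <= g t.
  move=> tt'; have -> : g t = g t' * expR (c * (t' - t)).
    by rewrite /g -expRD; congr expR; ring.
  by rewrite ler_wpM2l ?(ltW (gpos _)) // expR_ge1Dx.
have key t t' K : 0 <= t -> t <= t' -> t' <= T -> 0 <= K ->
    r t' - r t <= (c * r t + K) * (t' - t) ->
    g t' * r t' - g t * r t <= K * (t' - t).
  move=> t0 tt' t'T K0 h.
  have h1 := ler_wpM2l (ltW (gpos t')) h.
  have h2 := ler_wpM2r (r0 t t0 (le_trans tt' t'T)) (gD t t' tt').
  have h3 : g t' * (K * (t' - t)) <= K * (t' - t).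
    by rewrite ler_piMl ?mulr_ge0 ?subr_ge0 // g1 // (le_trans t0).
  lra.
have rT := r0 T T0 (lexx T).
have L0 : 0 <= L * T.
  by have := rL 0 T (lexx _) T0 (lexx _); rewrite subr0; apply: le_trans.
have h : g T * r T <= g 0 * r 0.
  have [T00|Tp] := eqVneq T 0; first by rewrite T00.
  have Tpos : 0 < T by rewrite lt_neqAle eq_sym Tp.
  have Lp : 0 <= L by rewrite -(pmulr_lge0 _ Tpos).
  apply: (@dini_nonincreasing (fun t => g t * r t) 0 T L N) => //.
    move=> s t s0 st tT; apply: key => //.
    have := rL s t s0 st tT; rewrite ler_norml => /andP[_ h].
    have : 0 <= c * r s * (t - s).
      by rewrite !mulr_ge0 ?subr_ge0 // r0 //; lra.
    lra.
  move=> t t0 tT nN e e0; have [eta eta0 etaP] := rD t t0 tT nN e e0.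
  exists eta => // t' tt' t'e t'T; apply: key => //; [exact: ltW|exact: etaP].
rewrite r00 mulr0 pmulr_rle0 // in h.
by apply/eqP; rewrite eq_le h rT.
Qed.

End DiniAE.

(** * Real functionals of Bochner integrals *)

Record real_functional {R : realType} {K : numFieldType} (F : scalar_field R K)
    (V : normedModType K) (l : V -> R) : Prop := RealFunctional {
  functionalD : forall x y, l (x + y) = l x + l y;
  functionalZ : forall a x, l (ofR F a *: x) = a * l x;
  functional_bound : exists2 c : R, 0 <= c & forall x, `|l x| <= c * rnorm F x
}.

Section FunctionalTheory.
Context {R : realType} {K : numFieldType} (F : scalar_field R K).
Variables (V : normedModType K) (l : V -> R).
Hypothesis hl : real_functional F l.

Lemma functional0 : l 0 = 0.
Proof. by have := functionalZ hl 0 0; rewrite ofR0 scale0r mul0r. Qed.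

Lemma functionalN x : l (- x) = - l x.
Proof.
by apply/eqP; rewrite -addr_eq0 -(functionalD hl) addNr functional0.
Qed.

Lemma functionalB x y : l (x - y) = l x - l y.
Proof. by rewrite (functionalD hl) functionalN. Qed.

Lemma functional_sum (I : Type) (r : seq I) (P : pred I) (f : I -> V) :
  l (\sum_(i <- r | P i) f i) = \sum_(i <- r | P i) l (f i).
Proof. by apply: (big_morph l (functionalD hl) functional0). Qed.

Lemma functional_opp : real_functional F (fun x => - l x).
Proof.
split=> [x y|a x|]; first by rewrite (functionalD hl) opprD.
  by rewrite (functionalZ hl) mulrN.
by have [c c0 hc] := functional_bound hl; exists c => // x; rewrite normrN.
Qed.

End FunctionalTheory.

Section SimpleFunctions.
Context {R : realType} {K : numFieldType} (F : scalar_field R K).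
Variable V : normedModType K.
Local Notation mu := (@lebesgue_measure R).

Lemma preimage_bigcup (s : R -> V) (A : set V) :
  s @^-1` A = \bigcup_(v in range s `&` A) s @^-1` [set v].
Proof.
apply/seteqP; split=> [t At|t [v [_ Av] /= ->] //].
by exists (s t) => //; split=> //; exists t.
Qed.

Lemma simple_preimage (s : R -> V) (A : set V) :
  simple s -> measurable (s @^-1` A).
Proof.
move=> [sfin sm].
have h0 B : ~ B 0 -> measurable (s @^-1` B).
  move=> B0; rewrite preimage_bigcup; apply: fin_bigcup_measurable.
    exact: finite_setIl.
  move=> v [_ Bv]; have [] // := sm v.
  by apply/eqP => v0; rewrite v0 in Bv.
have [A0|nA0] := pselect (A 0); last exact: h0.
rewrite -(setCK A) preimage_setC; apply: measurableC.
by apply: (h0 (~` A)) => /(_ A0).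
Qed.

Lemma simple_comp2 (s s' : R -> V) (g : V -> V -> R) :
  simple s -> simple s' -> measurable_fun setT (fun t => g (s t) (s' t)).
Proof.
move=> ss ss' _ Y mY; rewrite setTI.
have -> : (fun t => g (s t) (s' t)) @^-1` Y =
    \bigcup_(v in range s)
      (s @^-1` [set v] `&` s' @^-1` [set w | Y (g v w)]).
  apply/seteqP; split=> [t Yt|t [v _ [/= -> ]] //].
  by exists (s t); [exists t|].
apply: fin_bigcup_measurable; first by case: ss.
by move=> v _; apply: measurableI; exact: simple_preimage.
Qed.

Lemma simple_functional_integral (J : set R) (s : R -> V) (l : V -> R) :
  measurable J -> simple s -> real_functional F l ->
  mu.-integrable J (EFin \o (l \o s)) /\
  (\int[mu]_(t in J) (l (s t))%:E = (l (simple_integral F J s))%:E)%E.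
Proof.
move=> mJ ss hl; have [/finite_seqP[e0 e0E] sm] := ss.
pose e := undup e0.
have eE t : s t \in e by rewrite mem_undup; have := imageT s t; rewrite e0E.
pose A v := s @^-1` [set v].
have mA v : measurable (A v) by exact: simple_preimage.
have muA v : v != 0 -> (mu (J `&` A v) < +oo)%E.
  move=> v0; have [_ /(le_lt_trans _)] := sm v v0; apply.
  apply: le_measure; rewrite ?inE; [|exact: mA|exact: subIsetr].
  by apply: measurableI => //; exact: mA.
have lsE t : l (s t) = \sum_(v <- e) l v * \1_(A v) t.
  rewrite (bigD1_seq (s t)) ?undup_uniq //= indicE mem_set // mulr1.
  rewrite big1 ?addr0 // => v vs; rewrite indicE memNset ?mulr0 //.
  by move=> /= sv; move: vs; rewrite /A sv eqxx.
have int1 v : v != 0 -> mu.-integrable J (fun t => (\1_(A v) t)%:E).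
  move=> v0; apply/integrableP; split.
    by apply/measurable_EFinP; apply: measurable_indic; exact: mA.
  under eq_integral do rewrite gee0_abs ?lee_fin //.
  have := muA v v0; rewrite setIC; apply: le_lt_trans.
  rewrite le_eqVlt; apply/orP; left; apply/eqP.
  exact: (@integral_indic _ _ _ mu J mJ (A v) (mA v)).
have intA v : mu.-integrable J (fun t => (l v * \1_(A v) t)%:E).
  have [->|v0] := eqVneq v 0.
    by rewrite (functional0 hl); under eq_fun do rewrite mul0r; exact: integrable0.
  by under eq_fun do rewrite EFinM; apply: integrableZl; [|exact: int1].
have lsE' : EFin \o (l \o s) = (fun t => \sum_(v <- e) (l v * \1_(A v) t)%:E)%E.
  by apply/funext => t /=; rewrite lsE sumEFin.
split; first by rewrite lsE'; exact: integrable_sum.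
have -> : (fun t => (l (s t))%:E) = EFin \o (l \o s) by [].
rewrite lsE' integral_sum //.
rewrite /simple_integral (@fsbigE _ _ _ _ _ e) ?undup_uniq //; last first.
  move=> v _ ve; rewrite (_ : s @^-1` [set v] = set0) ?setI0 ?measure0 ?ofR0 ?scale0r //.
  by apply/seteqP; split=> // t /= sv; move: ve; rewrite -sv eE.
rewrite (functional_sum hl) -sumEFin; apply: eq_big => // [v|v _]; first by rewrite in_setT.
rewrite (functionalZ hl).
have [->|v0] := eqVneq v 0.
  by rewrite (functional0 hl) mulr0; under eq_integral do rewrite mul0r; rewrite integral0.
under eq_integral do rewrite EFinM.
have iE : (\int[mu]_(t in J) (\1_(A v) t)%:E = mu (A v `&` J))%E.
  exact: (@integral_indic _ _ _ mu J mJ (A v) (mA v)).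
rewrite integralZl; [|exact: mJ|exact: int1].
by rewrite iE setIC mulrC EFinM fineK // ge0_fin_numE // muA.
Qed.

End SimpleFunctions.

Section BochnerFunctional.
Context {R : realType} {K : numFieldType} (F : scalar_field R K).
Variable V : normedModType K.
Local Notation mu := (@lebesgue_measure R).

Lemma ae_everywhere (P : R -> Prop) :
  (forall t, P t) -> {ae mu, forall t, P t}.
Proof.
by move=> hP; exists set0; split=> // t /(_ (hP t)).
Qed.

Lemma cvge0_lt (u : nat -> \bar R) (e : R) : 0 < e -> u n @[n --> \oo] --> 0%E ->
  \forall n \near \oo, (u n < e%:E)%E.
Proof.
move=> e0 /(_ [set y | (y < e%:E)%E]); apply.
by apply: open_nbhs_nbhs; split; [exact: open_ereal_lt_ereal|rewrite /= lte_fin].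
Qed.

(** The integral of a nonnegative function is a supremum over simple functions
    below it, hence increasing even where measurability fails. *)
Lemma lower_integral_mono (J : set R) (f g : R -> \bar R) :
  (forall t, J t -> (0 <= f t)%E) -> (forall t, J t -> (f t <= g t)%E) ->
  (\int[mu]_(t in J) f t <= \int[mu]_(t in J) g t)%E.
Proof.
move=> f0 fg; rewrite ge0_integralE // ge0_integralE //; last first.
  by move=> t Jt; exact: le_trans (f0 t Jt) (fg t Jt).
apply: le_ereal_sup => _ [h hf <-]; exists h => //= t.
apply: le_trans (hf t) _; rewrite !patchE; case: ifPn => // /set_mem; exact: fg.
Qed.
(** [f] is merely an almost everywhere limit of Borel functions, so that
    [l \o f] need not be Borel: it can only be compared with Borel functions. *)
Lemma bochner_functional_le (J : set R) (f : R -> V) (I : V) (l : V -> R)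
    (h : R -> R) :
  measurable J -> real_functional F l -> bochner_integral F J f I ->
  mu.-integrable J (EFin \o h) ->
  {ae mu, forall t, J t -> l (f t) <= h t} ->
  ((l I)%:E <= \int[mu]_(t in J) (h t)%:E)%E.
Proof.
move=> mJ hl [_ [s [ss s_f s_I]]] hint lfh.
have [c c0 hc] : exists2 c : R, 0 < c & forall x, `|l x| <= c * rnorm F x.
  have [c c0 hc] := functional_bound hl; exists (c + 1); first by lra.
  by move=> x; have := hc x; have := rnorm_ge0 F x; lra.
have hfin := @integrable_fin_num _ _ _ mu J mJ _ hint.
rewrite -(fineK hfin) lee_fin.
apply: (@le_eps _ _ _ (2 * c)) => e e0.
have h1 : \forall n \near \oo, rnorm F (simple_integral F J (s n) - I) < e.
  exact: (cvg_rnormP F _ _).1 s_I _ e0.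
have h2 : \forall n \near \oo,
    (\int[mu]_(t in J) (rnorm F (f t - s n t))%:E < e%:E)%E.
  exact: cvge0_lt.
have [N _ hN] := filterI h1 h2.
have [{}h1 {}h2] := hN N (leqnn N).
move: (s N) (ss N) h1 h2 => {s ss s_f s_I hN} s ss h1 h2.
have [lsint lsE] := simple_functional_integral mJ ss hl.
pose k t := Num.max (l (s t) - h t) 0.
have kE : EFin \o k = (((EFin \o (l \o s)) \- (EFin \o h)) ^\+)%E.
  by apply/funext => t; rewrite funeposE /= EFin_max.
have kint : mu.-integrable J (EFin \o k).
  by rewrite kE; apply: integrable_funepos => //; exact: integrableB.
have kle : (\int[mu]_(t in J) (k t)%:E <= (c * e)%:E)%E.
  have [A [mA muA NA]] := lfh.
  have -> : (\int[mu]_(t in J) (k t)%:E = \int[mu]_(t in J) (c%:E * (c^-1 * k t)%:E))%E.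
    by apply: eq_integral => t _; rewrite -EFinM mulrA divff ?mul1r // gt_eqF.
  have kcint : mu.-integrable J (fun t => (c^-1 * k t)%:E).
    by under eq_fun do rewrite EFinM; exact: integrableZl.
  rewrite integralZl // EFinM lee_pmul2l // ?fin_numE //.
  apply: le_trans _ (ltW h2).
  rewrite (@negligible_integral _ _ _ mu J A) // setDE integral_mkcondr.
  have k0 t : 0 <= c^-1 * k t by rewrite mulr_ge0 ?invr_ge0 ?(ltW c0) // le_max lexx orbT.
  apply: lower_integral_mono => t Jt; rewrite patchE; case: ifPn => // hA;
    rewrite ?lee_fin ?rnorm_ge0 ?k0 //.
  have nAt : ~ A t by exact: set_mem hA.
  rewrite mulrC ler_pdivrMr // /k ge_max mulrC mulr_ge0 ?rnorm_ge0 ?(ltW c0) // andbT.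
  have lft : l (f t) <= h t by apply: contrapT => nl; apply: nAt; apply: NA => /(_ Jt).
  have := hc (f t - s t); rewrite (functionalB hl) ler_norml; lra.
have h3 : ((l (simple_integral F J s))%:E <= \int[mu]_(t in J) (h t)%:E + (c * e)%:E)%E.
  rewrite -lsE; apply: (@le_trans _ _ (\int[mu]_(t in J) ((h t)%:E + (k t)%:E)))%E.
    apply: le_integral => //; first exact: integrableD.
    move=> t _; rewrite -EFinD lee_fin /k.
    have := le_max (l (s t) - h t) (l (s t) - h t) 0; rewrite lexx /=; lra.
  by rewrite integralD // leeD2l.
rewrite -(fineK hfin) -EFinD lee_fin in h3.
have := hc (simple_integral F J s - I); rewrite (functionalB hl) ler_norml.
have : c * rnorm F (simple_integral F J s - I) <= c * e by rewrite ler_pM2l // ltW.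
lra.
Qed.

Lemma bochner_functional_eq (J : set R) (f : R -> V) (I : V) (l : V -> R)
    (h : R -> R) :
  measurable J -> real_functional F l -> bochner_integral F J f I ->
  mu.-integrable J (EFin \o h) -> (forall t, J t -> l (f t) = h t) ->
  (\int[mu]_(t in J) (h t)%:E = (l I)%:E)%E.
Proof.
move=> mJ hl fI hint lfh; apply/le_anti/andP; split.
  have hN := integrableN hint.
  have := bochner_functional_le mJ (functional_opp hl) fI hN.
  rewrite EFinN; have -> : (\int[mu]_(t in J) (- h t)%:E = - \int[mu]_(t in J) (h t)%:E)%E.
    under eq_integral do rewrite EFinN; rewrite integralN //.
    exact: integrable_add_def.
  rewrite leeN2; apply; apply: ae_everywhere => t Jt; rewrite lfh //.
by apply: (bochner_functional_le mJ hl fI hint); apply: ae_everywhere => t Jt; rewrite lfh.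
Qed.

End BochnerFunctional.

(** * Smooth steps *)

Section Smooth.
Context {R : realType}.
Implicit Types (f g : R -> R) (p q : {poly R}).

Lemma is_deriveP f (x d : R) : is_derive x 1 f d <->
  forall e : R, 0 < e -> exists2 eta : R, 0 < eta &
    forall y, `|y - x| < eta -> `|f y - f x - d * (y - x)| <= e * `|y - x|.
Proof.
split=> [[df dfE] e e0|h].
  move: df; rewrite /derivable => /cvg_ex[l hl].
  have lE : l = d by rewrite -dfE /derive; apply/esym; exact: cvg_lim.
  rewrite {}lE in hl => {l dfE}.
  have /cvgrPdist_lt/(_ _ e0) := hl.
  rewrite near_withinE => /nbhs_ballP[eta /= eta0 etaP]; exists eta => // y yx.
  have [->|nyx] := eqVneq y x; first by rewrite !subrr mulr0 subr0 normr0 mulr0.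
  have yx0 : y - x != 0 by rewrite subr_eq0.
  have := etaP (y - x); rewrite /ball /= sub0r normrN => /(_ yx yx0).
  rewrite /GRing.scale /= mulr1 subrK => /ltW h.
  have -> : f y - f x - d * (y - x) =
      - ((d - (y - x)^-1 * (f y - f x)) * (y - x)) by field.
  by rewrite normrN normrM ler_wpM2r.
have hd : h0^-1 *: ((f \o shift x) (h0 *: (1 : R)) - f x) @[h0 --> 0^'] --> d.
  apply/cvgrPdist_le => e e0; have [eta eta0 etaP] := h e e0.
  rewrite near_withinE; apply/nbhs_ballP; exists eta => //= t.
  rewrite /ball /= sub0r normrN => te t0.
  have := etaP (t + x); rewrite addrK => /(_ te) ht.
  rewrite /GRing.scale /= mulr1.
  have -> : d - t^-1 * (f (t + x) - f x) = - ((f (t + x) - f x - d * t) / t) by field.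
  by rewrite normrN normrM normfV ler_pdivrMr // normr_gt0.
by split; [apply/cvg_ex; exists d|exact: cvg_lim].
Qed.

Lemma is_derive_local f g (x d r : R) : 0 < r ->
  (forall y, `|y - x| < r -> f y = g y) -> is_derive x 1 f d -> is_derive x 1 g d.
Proof.
move=> r0 fg /is_deriveP h; apply/is_deriveP => e e0.
have [eta eta0 etaP] := h e e0; have [d0 [d00 d1 d2]] := pos_below2 eta0 r0.
exists d0 => // y yd; rewrite -!fg; [apply: etaP; lra|rewrite subrr normr0; lra|lra].
Qed.

Lemma is_derive_continuous f (x d : R) : is_derive x 1 f d -> {for x, continuous f}.
Proof.
by move=> [df _]; apply: differentiable_continuous; apply/derivable1_diffP.
Qed.

Fixpoint iter_derivable (n : nat) f : Prop :=
  if n is n'.+1 then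
    exists2 f' : R -> R, (forall t : R, is_derive t 1 f (f' t)) & iter_derivable n' f'
  else True.

Definition smooth f := forall n, iter_derivable n f.

Lemma iter_derivable_derive1n n f :
  iter_derivable n.+1 f -> forall t, derivable (derive1n n f) t 1.
Proof.
elim: n f => [|n IH] f [f' f'P fn] t; first by have [] := f'P t.
rewrite derive1Sn; have -> : derive1 f = f'; last exact: IH.
by apply/funext => s; rewrite derive1E; have [] := f'P s.
Qed.

Lemma iter_derivableW n f : iter_derivable n.+1 f -> iter_derivable n f.
Proof.
elim: n f => [//|n IH] f [f' f'P fn]; exists f' => //; exact: IH.
Qed.

Lemma iter_derivableD n f g : iter_derivable n f -> iter_derivable n g ->
  iter_derivable n (fun t => f t + g t).
Proof.
elim: n f g => [//|n IH] f g [f' f'P fn] [g' g'P gn].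
by exists (fun t => f' t + g' t) => [t|]; [exact: is_deriveD|exact: IH].
Qed.

Lemma iter_derivable_cst n (c : R) : iter_derivable n (fun=> c).
Proof.
elim: n c => [//|n IH] c; exists (fun=> 0) => [t|]; [exact: is_derive_cst|exact: IH].
Qed.

Lemma iter_derivableM n f g : iter_derivable n f -> iter_derivable n g ->
  iter_derivable n (fun t => f t * g t).
Proof.
elim: n f g => [//|n IH] f g fn1 gn1.
have fn := iter_derivableW fn1; have gn := iter_derivableW gn1.
have [f' f'P fn'] := fn1; have [g' g'P gn'] := gn1.
exists (fun t => f t * g' t + g t * f' t) => [t|].
  exact: (is_deriveM (f'P t) (g'P t)).
by apply: iter_derivableD; exact: IH.
Qed.

Lemma is_derive_affine f (f' : R -> R) (a b : R) :
  (forall t : R, is_derive t 1 f (f' t)) ->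
  forall t : R, is_derive t 1 (fun t : R => f (a * t + b)) (a * f' (a * t + b)).
Proof.
move=> f'P t; rewrite mulrC.
have ha : is_derive t (1 : R) (fun t : R => a * t + b) a.
  apply/is_deriveP => e e0; exists 1 => // y _.
  have -> : a * y + b - (a * t + b) - a * (y - t) = 0 by ring.
  by rewrite normr0 mulr_ge0 // ltW.
exact: (@is_derive1_comp R f (fun t => a * t + b) t _ _ (f'P _) ha).
Qed.

Lemma iter_derivable_affine n f (a b : R) : iter_derivable n f ->
  iter_derivable n (fun t => f (a * t + b)).
Proof.
elim: n f => [//|n IH] f [f' f'P fn].
exists (fun t => a * f' (a * t + b)); first exact: is_derive_affine.
by apply: iter_derivableM; [exact: iter_derivable_cst|exact: IH].
Qed.

Lemma poly_le_expR p : exists2 c : R, 0 <= c &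
  forall z : R, 0 <= z -> `|p.[z]| <= c * expR z.
Proof.
exists (\sum_(i < size p) `|p`_i| * (i`!)%:R).
  by apply: sumr_ge0 => i _; rewrite mulr_ge0.
move=> z z0; rewrite horner_coef mulr_suml.
apply: le_trans (ler_norm_sum _ _ _) _; apply: ler_sum => i _.
rewrite normrM -mulrA ler_wpM2l // ger0_norm ?exprn_ge0 //.
case: (nat_of_ord i) => [|k].
  by rewrite expr0 mul1r -expR0 ler_expR.
rewrite mulrC -ler_pdivrMr ?ltr0n ?fact_gt0 //.
by have := expR_ge1Dxn k z0; lra.
Qed.

(** The functions [p(1/x) exp(-1/x)], extended by 0 to the left: this class is
    stable under differentiation, so that its members are smooth. *)
Definition flat p (x : R) : R := if 0 < x then p.[x^-1] * expR (- x^-1) else 0.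

Lemma is_derive_flat p (x : R) : is_derive x 1 (flat p) (flat ('X^2 * (p - p^`())) x).
Proof.
rewrite {2}/flat; have [x0|x0] := ltP 0 x.
  apply: (@is_derive_local (fun y => p.[y^-1] * expR (- y^-1)) _ _ _ x x0).
    move=> y; rewrite ltr_norml => /andP[yx _]; rewrite /flat.
    by have -> : 0 < y by lra.
  have xn : x != 0 by rewrite gt_eqF.
  have hV : is_derive x (1 : R) (fun y : R => y^-1) (- x ^- 2).
    by apply: is_derive_eq; [exact: is_deriveV|rewrite /GRing.scale /= mulr1].
  have hp := is_derive1_comp (is_derive_poly p x^-1) hV.
  have hN : is_derive x (1 : R) (fun y : R => - y^-1) (- (- x ^- 2)) by exact: is_deriveN.
  have he := @is_derive1_comp R expR (fun y => - y^-1) x _ _ (is_derive_expR _) hN.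
  have hm := is_deriveM hp he.
  have hm' : is_derive x (1 : R) (fun y => p.[y^-1] * expR (- y^-1)) _ := hm.
  refine (@is_derive_eq _ _ _ _ _ _ _ _ hm' _) => {hp he hm hm'} /=.
  rewrite /GRing.scale /= hornerM hornerXn hornerD hornerN exprVn; ring.
have [c c0 hc] := poly_le_expR (p * 'X^2).
have fp0 y : y <= 0 -> flat p y = 0 by rewrite /flat; case: ltP.
have fpc y : `|flat p y| <= c * y ^+ 2.
  have [y0|/fp0->] := ltP 0 y; last by rewrite normr0 mulr_ge0 ?sqr_ge0.
  have yn : y != 0 by rewrite gt_eqF.
  have yV : 0 <= y^-1 by rewrite invr_ge0 ltW.
  have := hc _ yV; rewrite /flat y0 hornerM hornerXn !normrM.
  rewrite (ger0_norm (expR_ge0 _)) (ger0_norm yV) => h.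
  have h2 : 0 <= y ^+ 2 * expR (- y^-1) by rewrite mulr_ge0 ?sqr_ge0 ?expR_ge0.
  have := ler_wpM2r h2 h; have eE : expR y^-1 * expR (- y^-1) = 1.
    by rewrite -expRD subrr expR0.
  have -> : c * expR y^-1 * (y ^+ 2 * expR (- y^-1)) =
    c * y ^+ 2 * (expR y^-1 * expR (- y^-1)) by ring.
  rewrite eE mulr1; apply: le_trans.
  by rewrite le_eqVlt; apply/orP; left; apply/eqP; field.
apply/is_deriveP => e e0; have [->|xn] := eqVneq x 0.
  have c1 : 0 < c + 1 by lra.
  exists (e / (c + 1)); first by rewrite divr_gt0.
  move=> y; rewrite subr0 ltr_pdivlMr // => yd.
  rewrite (fp0 0) // subr0 mul0r subr0; apply: le_trans (fpc y) _.
  rewrite -real_normK ?num_real // -[_ ^+ 2]/(_ * _) mulrA ler_wpM2r //.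
  by have := normr_ge0 y; lra.
have x0' : x < 0 by rewrite lt_neqAle xn.
exists (- x); first by rewrite oppr_gt0.
move=> y; rewrite ltr_norml => /andP[_ yx].
rewrite !fp0 //; last by lra.
by rewrite !subrr mul0r subr0 normr0 mulr_ge0 // ltW.
Qed.

Lemma iter_derivable_flat n p : iter_derivable n (flat p).
Proof.
elim: n p => [//|n IH] p; exists (flat ('X^2 * (p - p^`()))) => [t|]; last exact: IH.
exact: is_derive_flat.
Qed.

Lemma is_derive_mono f f' (a b : R) : a <= b -> (forall t : R, is_derive t 1 f (f' t)) ->
  (forall t, a < t -> t < b -> 0 <= f' t) -> f a <= f b.
Proof.
rewrite le_eqVlt => /predU1P[-> //|ab] f'P f'0.
have fc : {within `[a, b], continuous f}.
  by apply: continuous_subspaceT => t; exact: is_derive_continuous (f'P t).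
have [c /[!in_itv] /= /andP[ac cb] fE] := MVT ab (fun t _ => f'P t) fc.
by rewrite -subr_ge0 fE mulr_ge0 ?f'0 // subr_ge0 ltW.
Qed.

Lemma antiderivative f (c : R) : continuous f -> (forall t, t <= c -> f t = 0) ->
  exists2 g : R -> R, (forall t : R, is_derive t 1 g (f t)) & forall t, t <= c -> g t = 0.
Proof.
move=> fc f0; pose g x := \int[lebesgue_measure]_(t in `[c - 1, x]) f t.
have g0 t : t <= c -> g t = 0.
  move=> tc; rewrite /g /Rintegral integral0_eq // => s /=.
  by rewrite in_itv /= => /andP[_ st]; rewrite f0 // (le_trans st).
exists g => // t; have [tc|ct] := ltP t c.
  rewrite f0 ?(ltW tc) //.
  have tc' : 0 < c - t by rewrite subr_gt0.
  apply: (@is_derive_local (fun=> 0) _ _ _ _ tc').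
    by move=> y; rewrite ltr_norml => /andP[_ yt]; rewrite g0 //; lra.
have [] := @continuous_FTC1_closed R f (c - 1) t (t + 1).
- lra.
- apply: continuous_compact_integrable; first exact: segment_compact.
  by apply: continuous_subspaceT.
- lra.
- exact: fc.
by move=> dg dgE; split; [exact: dg|rewrite -derive1E; exact: dgE].
Qed.

Lemma is_derive_lin f f' g g' (a b : R) : (forall t : R, is_derive t 1 f (f' t)) ->
  (forall t : R, is_derive t 1 g (g' t)) ->
  forall t : R, is_derive t 1 (fun t => a * f t + b * g t) (a * f' t + b * g' t).
Proof.
by move=> fP gP t; apply: is_deriveD; apply: is_deriveZ.
Qed.

Lemma is_derive_shift f f' (x : R) : (forall t : R, is_derive t 1 f (f' t)) ->
  forall t : R, is_derive t 1 (fun t => f (t - x)) (f' (t - x)).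
Proof.
move=> fP t; have := @is_derive_affine f f' 1 (- x) fP t.
by rewrite !mul1r; under eq_fun do rewrite mul1r.
Qed.

Lemma smooth_lin f g (a b : R) : smooth f -> smooth g ->
  smooth (fun t => a * f t + b * g t).
Proof.
move=> fs gs n; apply: iter_derivableD; apply: iter_derivableM => //;
  exact: iter_derivable_cst.
Qed.

Lemma smooth_shift f (x : R) : smooth f -> smooth (fun t => f (t - x)).
Proof.
move=> fs n; have := @iter_derivable_affine n f 1 (- x) (fs n).
by under eq_fun do rewrite mul1r.
Qed.

(** [S1] is the primitive of the mollifier [rho], hence a smooth step, and [S2]
    the primitive of [S1], hence a smooth ramp. *)
Record smooth_step_spec (e : R) (rho S1 S2 : R -> R) : Prop := {
  step_derive : forall t : R, is_derive t 1 S1 (rho t);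
  ramp_derive : forall t : R, is_derive t 1 S2 (S1 t);
  step_smooth : smooth S1;
  ramp_smooth : smooth S2;
  mollifier_continuous : continuous rho;
  mollifier_ge0 : forall t, 0 <= rho t;
  mollifier_out : forall t, e <= `|t| -> rho t = 0;
  step_left : forall t, t <= - e -> S1 t = 0;
  step_right : forall t, e <= t -> S1 t = 1;
  step_mono : forall s t, s <= t -> S1 s <= S1 t;
  step_bound : forall t, 0 <= S1 t /\ S1 t <= 1;
  ramp_left : forall t, t <= - e -> S2 t = 0;
  ramp_right : forall s t, e <= s -> e <= t -> S2 t - S2 s = t - s
}.

(** The mollifier is a normalized product of two flat functions, positive on
    [(- e, e)] and zero elsewhere. *)
Lemma smooth_step (e : R) : 0 < e ->
  exists rho S1 S2 : R -> R, smooth_step_spec e rho S1 S2.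
Proof.
move=> e0; pose r t := flat 1 (1 * t + e) * flat 1 (- 1 * t + e).
have flat_ge0 x : 0 <= flat 1 x.
  by rewrite /flat; case: ltP => // _; rewrite hornerC mul1r expR_ge0.
have flat0 x : x <= 0 -> flat 1 x = 0 by rewrite /flat; case: ltP.
have flat_gt0 x : 0 < x -> 0 < flat 1 x.
  by move=> x0; rewrite /flat x0 hornerC mul1r expR_gt0.
have rs : smooth r.
  by move=> n; apply: iter_derivableM; apply: iter_derivable_affine; exact: iter_derivable_flat.
have r0 t : 0 <= r t by rewrite mulr_ge0.
have rout t : e <= `|t| -> r t = 0.
  rewrite ler_normr /r => /orP[te|te].
    by rewrite [flat 1 (- 1 * t + e)]flat0 ?mulr0 //; lra.
  by rewrite flat0 ?mul0r //; lra.
have rc : continuous r.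
  move=> t; have [r' r'P _] := rs 1; exact: is_derive_continuous (r'P t).
have rl t : t <= - e -> r t = 0 by move=> te; apply: rout; rewrite ler_normr; apply/orP; right; lra.
have [S SP S0] := antiderivative rc rl.
have Scst t : e <= t -> S t = S e.
  move=> et; apply/le_anti/andP; split; last by apply: is_derive_mono.
  rewrite -lerN2; apply: (@is_derive_mono (fun t => - S t) (fun t => - r t)) => //.
  move=> s es _; rewrite rout ?oppr0 // ler_normr; apply/orP; left; exact: ltW.
have m0 : 0 < S e.
  have Sc : {within `[- e, e], continuous S}.
    by apply: continuous_subspaceT => t; exact: is_derive_continuous (SP t).
  have ee : - e < e by lra.
  have [c /[!in_itv] /= /andP[ec ce] SE] := MVT ee (fun t _ => SP t) Sc.
  have := SE; rewrite (S0 (- e)) // subr0 => ->; rewrite mulr_gt0 //; last by lra.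
  by rewrite mulr_gt0 //; apply: flat_gt0; lra.
pose rho t := (S e)^-1 * r t; pose S1 t := (S e)^-1 * S t.
have mulP (c : R) (f f' : R -> R) : (forall t : R, is_derive t 1 f (f' t)) ->
    forall t : R, is_derive t 1 (fun t => c * f t) (c * f' t).
  by move=> fP t; exact: is_deriveZ.
have S1P : forall t : R, is_derive t 1 S1 (rho t) by exact: mulP.
have S10 t : t <= - e -> S1 t = 0 by move=> te; rewrite /S1 (S0 t) // mulr0.
have S1c : continuous S1 by move=> t; exact: is_derive_continuous (S1P t).
have [S2 S2P S20] := antiderivative S1c S10.
have rhos : smooth rho by move=> n; apply: iter_derivableM; [exact: iter_derivable_cst|].
have S1s : smooth S1 by case=> [//|n]; exists rho.
have rho0 t : 0 <= rho t by rewrite mulr_ge0 // invr_ge0 ltW.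
have S11 t : e <= t -> S1 t = 1 by move=> te; rewrite /S1 Scst // mulVf // gt_eqF.
have S1mono s t : s <= t -> S1 s <= S1 t by move=> st; exact: is_derive_mono S1P _.
exists rho, S1, S2; split=> //.
- by case=> [//|n]; exists S1.
- by move=> t; have [r' r'P _] := rhos 1; exact: is_derive_continuous (r'P t).
- by move=> t te; rewrite /rho rout // mulr0.
- move=> t; split.
    have h : Num.min t (- e) <= t by rewrite ge_min lexx.
    by rewrite -(S10 (Num.min t (- e))) ?S1mono // ge_min lexx orbT.
  have h : t <= Num.max t e by rewrite le_max lexx.
  by rewrite -(S11 (Num.max t e)) ?S1mono // le_max lexx orbT.
- suff h s t : e <= s -> s <= t -> S2 t - S2 s = t - s.
    by move=> s t es et; case: (leP s t) => [|/ltW] st; [exact: h|have := h t s et st; lra].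
  move=> es st; have dl (c : R) : forall t : R, is_derive t 1 (fun t => c * S2 t + - c * t) (c * S1 t + - c * 1).
    by apply: is_derive_lin => // u; exact: is_derive_id.
  have S11' u : s < u -> S1 u = 1 by move=> su; apply: S11; lra.
  have h1 := is_derive_mono st (dl 1); have h2 := is_derive_mono st (dl (- 1)).
  have {}h1 := h1 (fun u su _ => ltac:(by rewrite S11' //; lra)).
  have {}h2 := h2 (fun u su _ => ltac:(by rewrite S11' //; lra)).
  lra.
Qed.

End Smooth.

(** * Weak derivatives tested against smooth steps *)

Section Testing.
Context {R : realType}.
Local Notation mu := (@lebesgue_measure R).

Lemma continuous_itv_integrable (f : R -> R) (c d : R) : continuous f ->
  mu.-integrable `[c, d] (EFin \o f).
Proof.
move=> fc; apply: continuous_compact_integrable; first exact: segment_compact.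
exact: continuous_subspaceT.
Qed.

Lemma FTC_itv (f g : R -> R) (c d : R) : c < d ->
  (forall t : R, is_derive t 1 g (f t)) -> continuous f ->
  (\int[mu]_(t in `[c, d]) (f t)%:E = (g d - g c)%:E)%E.
Proof.
move=> cd gP fc; rewrite (@continuous_FTC2 _ f g) ?EFinB //.
- exact: continuous_subspaceT.
- split.
  + by move=> t _; have [] := gP t.
  + by apply: cvg_at_right_filter; exact: is_derive_continuous (gP c).
  + by apply: cvg_at_left_filter; exact: is_derive_continuous (gP d).
- by move=> t _; rewrite derive1E; have [] := gP t.
Qed.

Lemma integral_support (J : set R) (h : R -> R) (c d : R) : measurable J ->
  `[c, d] `<=` J -> (forall t, J t -> ~ `[c, d]%classic t -> h t = 0) -> continuous h ->
  mu.-integrable J (EFin \o h) /\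
  (\int[mu]_(t in J) (h t)%:E = \int[mu]_(t in `[c, d]) (h t)%:E)%E.
Proof.
move=> mJ cdJ h0 hc.
have mI : measurable (`[c, d]%classic : set R) by exact: measurable_itv.
have E : (EFin \o h) \_ J = (EFin \o h) \_ `[c, d].
  apply/funext => t; rewrite !patchE.
  case: ifPn => [/set_mem Jt|/negP nJt]; case: ifPn => //.
    by move=> /negP It; rewrite /= h0 // => It'; apply: It; rewrite inE.
  by move=> /set_mem /cdJ Jt; case: nJt; rewrite inE.
split.
  apply/(@integrable_mkcond _ _ _ mu J _ mJ); rewrite E.
  by apply/(@integrable_mkcond _ _ _ mu _ _ mI); exact: continuous_itv_integrable.
by rewrite integral_mkcond [RHS]integral_mkcond E.
Qed.

Lemma test_functionI (J : set R) (eta : R -> R) (c d : R) :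
  smooth eta -> `[c, d] `<=` J^° -> (forall t, ~ `[c, d]%classic t -> eta t = 0) ->
  test_function J eta.
Proof.
move=> es cdJ e0; have sub : closure [set t | eta t != 0] `<=` `[c, d].
  have cl : closed (`[c, d]%classic : set R) by exact: interval_closed.
  rewrite [X in _ `<=` X](closure_id _).1 //; apply: closure_subset => t /eqP et.
  by apply: contrapT => /e0.
split=> [n t||]; first exact: iter_derivable_derive1n.
- apply: subclosed_compact sub; [exact: closed_closure|exact: segment_compact].
- exact: subset_trans cdJ.
Qed.

Lemma subset_interior_itv (J : set R) (a b c d : R) : a < c -> d < b ->
  `[a, b] `<=` J -> `[c, d] `<=` J^°.
Proof.
move=> ac db abJ; have op : open (`]a, b[%classic : set R) by exact: interval_open.
have sub : `]a, b[ `<=` J by apply: subset_trans abJ; exact: subset_itv_oo_cc.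
apply: (@subset_trans _ `]a, b[%classic); last by rewrite -open_subsetE.
by move=> t; rewrite /= !in_itv /= => /andP[? ?]; apply/andP; split; lra.
Qed.

Lemma outside_itv (c d t : R) : ~ `[c, d]%classic t -> t < c \/ d < t.
Proof.
by rewrite /= in_itv /= => /negP; rewrite negb_and -!ltNge => /orP[]; [left|right].
Qed.

Lemma continuous_shift (f : R -> R) (x : R) : continuous f ->
  continuous (fun t => f (t - x)).
Proof.
move=> fc t; apply: (@continuous_comp _ _ _ (fun t => t - x) f); last exact: fc.
by apply: cvgB; [exact: cvg_id|exact: cvg_cst].
Qed.

Lemma continuous_lin (f g : R -> R) (a b : R) : continuous f -> continuous g ->
  continuous (fun t => a * f t + b * g t).
Proof.
by move=> fc gc t; apply: cvgD; apply: cvgM; try exact: cvg_cst; [exact: fc|exact: gc].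
Qed.

Lemma smooth_continuous (f : R -> R) : smooth f -> continuous f.
Proof. by move=> /(_ 1)[f' f'P _] t; exact: is_derive_continuous (f'P t). Qed.

End Testing.

Section WeakComparison.
Context {R : realType} {K : numFieldType} (F : scalar_field R K).
Variables (V : normedModType K) (l : V -> R).
Hypothesis hl : real_functional F l.
Local Notation mu := (@lebesgue_measure R).
Variables (J : set R) (f g : R -> V) (k : R -> R).
Hypothesis mJ : measurable J.
Hypothesis kc : continuous k.
Hypothesis lf : forall t, J t -> l (f t) = k t.

(** The integrals are compared through explicit primitives [G] and [H] of a
    lower and an upper bound. *)
Lemma weak_derivative_compare (n : nat) (eta etan G G' H H' : R -> R) (c d m : R) :
  weak_derivative F n J f g -> c < d -> `[c, d] `<=` J^° -> smooth eta ->
  derive1n n eta = etan -> continuous etan ->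
  (forall t, ~ `[c, d]%classic t -> eta t = 0 /\ etan t = 0) ->
  (forall t, 0 <= eta t) ->
  {ae mu, forall t, `[c, d]%classic t -> l (g t) <= m} ->
  (forall t : R, is_derive t 1 G (G' t)) -> continuous G' ->
  (forall t : R, is_derive t 1 H (H' t)) -> continuous H' ->
  (forall t, `[c, d]%classic t -> G' t <= (-1) ^+ n * (etan t * k t)) ->
  (forall t, `[c, d]%classic t -> m * eta t <= H' t) ->
  G d - G c <= H d - H c.
Proof.
move=> wd cd cdJ es etanE etanc e0 eta0 gm GP Gc HP Hc Gle Hge.
have cdJ' : `[c, d] `<=` J by apply: subset_trans cdJ _; exact: interior_subset.
have test : test_function J eta by apply: (test_functionI es cdJ) => t It; exact: (e0 t It).1.
have [I [I1 I2]] := wd _ test.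
have ec : continuous eta by exact: smooth_continuous.
have c1 : continuous (fun t => etan t * k t) by move=> t; apply: cvgM; [exact: etanc|exact: kc].
have c2 : continuous (fun t => m * eta t) by move=> t; apply: cvgM; [exact: cvg_cst|exact: ec].
have z1 t : J t -> ~ `[c, d]%classic t -> etan t * k t = 0.
  by move=> _ It; rewrite (e0 t It).2 mul0r.
have z2 t : J t -> ~ `[c, d]%classic t -> m * eta t = 0.
  by move=> _ It; rewrite (e0 t It).1 mulr0.
have [i1 E1] := integral_support mJ cdJ' z1 c1.
have [i2 E2] := integral_support mJ cdJ' z2 c2.
have h1 := bochner_functional_eq mJ hl I1 i1.
have {h1} h1 : (\int[mu]_(t in J) (etan t * k t)%:E = (l I)%:E)%E.
  by apply: h1 => t Jt; rewrite (functionalZ hl) etanE lf.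
have h2 : ((l ((-1) ^+ n *: I))%:E <= \int[mu]_(t in J) (m * eta t)%:E)%E.
  apply: (bochner_functional_le mJ hl I2 i2); apply: ae_mono gm => t gt Jt.
  rewrite (functionalZ hl) [leRHS]mulrC.
  have [It|nIt] := pselect (`[c, d]%classic t); first by rewrite ler_wpM2l ?gt.
  by rewrite (e0 t nIt).1 !mul0r.
rewrite -(ofR_sign F) (functionalZ hl) E2 in h2; rewrite E1 in h1.
have h3 : ((G d - G c)%:E <= ((-1) ^+ n * l I)%:E)%E.
  rewrite -(FTC_itv cd GP Gc) EFinM -h1 -integralZl //; last exact: continuous_itv_integrable.
  apply: le_integral => //; first exact: continuous_itv_integrable.
    apply: continuous_itv_integrable => t.
    by apply: (@cvgM _ _ _ _ (fun=> (-1) ^+ n)); [exact: cvg_cst|exact: c1].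
  by move=> t /set_mem It; rewrite lee_fin Gle.
have h4 : (\int[mu]_(t in `[c, d]) (m * eta t)%:E <= (H d - H c)%:E)%E.
  rewrite -(FTC_itv cd HP Hc).
  apply: le_integral => //; try exact: continuous_itv_integrable.
  by move=> t /set_mem It; rewrite lee_fin Hge.
by rewrite -lee_fin (le_trans h3) // (le_trans h2).
Qed.

End WeakComparison.

Section WeakEstimates.
Context {R : realType} {K : numFieldType} (F : scalar_field R K).
Variables (V : normedModType K) (l : V -> R).
Hypothesis hl : real_functional F l.
Local Notation mu := (@lebesgue_measure R).
Variables (J : set R) (f g : R -> V) (k : R -> R).
Hypothesis mJ : measurable J.
Hypothesis kc : continuous k.
Hypothesis lf : forall t, J t -> l (f t) = k t.

Lemma continuous_at_bound (x e : R) : 0 < e -> exists2 d : R, 0 < d &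
  forall t, `|t - x| < d -> k x - e <= k t /\ k t <= k x + e.
Proof.
move=> e0; have kx : k t @[t --> x] --> k x by exact: kc.
move/cvgrPdist_le in kx.
have /nbhs_ballP[d /= d0 dP] := kx e e0.
exists d => // t tx; have := dP t; rewrite /ball /= distrC => /(_ tx).
rewrite ler_norml; lra.
Qed.

Lemma mollified_bounds (rho : R -> R) (x e d t : R) :
  (forall t, 0 <= rho t) -> (forall t, d <= `|t| -> rho t = 0) ->
  (forall t, `|t - x| < d -> k x - e <= k t /\ k t <= k x + e) ->
  rho (t - x) * (k x - e) <= rho (t - x) * k t /\
  rho (t - x) * k t <= rho (t - x) * (k x + e).
Proof.
move=> rho0 rhod kx; have [tx|tx] := ltP `|t - x| d; last by rewrite rhod // !mul0r.
by have [h1 h2] := kx t tx; rewrite !ler_wpM2l.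
Qed.

(** The test function is the indicator of [[a, b]] with smoothed ends. *)
Lemma weak_derivative1_le (a b r m : R) : weak_derivative F 1 J f g ->
  a < b -> 0 < r -> `[a - r, b + r] `<=` J ->
  {ae mu, forall t, `[a - r, b + r]%classic t -> l (g t) <= m} ->
  k b - k a <= m * (b - a).
Proof.
move=> wd ab r0 abJ gm; apply: (@le_eps _ _ _ 2) => e e0.
have [da da0 daP] := continuous_at_bound a e0.
have [db db0 dbP] := continuous_at_bound b e0.
have r20 : 0 < r / 2 by rewrite divr_gt0.
have [d [d0 d1 d2 d3]] := pos_below3 da0 db0 r20.
have [rho [S1 [S2 st]]] := smooth_step d0.
pose c := a - d; pose D := b + d.
pose eta t := 1 * S1 (t - a) + - 1 * S1 (t - b).
pose eta1 t := 1 * rho (t - a) + - 1 * rho (t - b).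
have rc (x : R) := continuous_shift (x := x) (mollifier_continuous st).
have etaP : forall t : R, is_derive t 1 eta (eta1 t).
  by apply: is_derive_lin; apply: is_derive_shift; exact: step_derive st.
have etas : smooth eta by apply: smooth_lin; apply: smooth_shift; exact: step_smooth st.
have eta1E : derive1n 1 eta = eta1.
  by rewrite derive1n1; apply/funext => t; rewrite derive1E; have [] := etaP t.
have S1c : continuous S1 by exact: smooth_continuous (step_smooth st).
have S1xc (x : R) : continuous (fun t => S1 (t - x)).
  by apply: smooth_continuous; apply: smooth_shift; exact: step_smooth st.
have cd : c < D by rewrite /c /D; lra.
have cdJ : `[c, D] `<=` J^°.
  by apply: subset_interior_itv abJ; rewrite /c /D; lra.
have out := @outside_itv R c D.
have := @weak_derivative_compare R K F V l hl J f g k mJ kc lf 1 eta eta1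
  (fun t => (k b - e) * S1 (t - b) + - (k a + e) * S1 (t - a))
  (fun t => (k b - e) * rho (t - b) + - (k a + e) * rho (t - a))
  (fun t => m * S2 (t - a) + - m * S2 (t - b))
  (fun t => m * S1 (t - a) + - m * S1 (t - b)) c D m wd cd cdJ etas eta1E.
rewrite (step_left st (t := c - b)) ?(step_left st (t := c - a)) ?(step_right st (t := D - b))
  ?(step_right st (t := D - a)) ?(ramp_left st (t := c - a)) ?(ramp_left st (t := c - b));
  rewrite /c /D; try lra.
rewrite -/c -/D => h.
have eta1c : continuous eta1 by exact: continuous_lin.
have {h} := h eta1c _ _ _ _ _ _ _ _ _.
have hr := ramp_right st (s := D - b) (t := D - a).
have {}hr : S2 (D - a) - S2 (D - b) = b - a by rewrite hr /D;
  move: ab; goal_lra.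
have hm : m * S2 (D - a) - m * S2 (D - b) = m * (b - a) by rewrite -mulrBr hr.
move=> h; suff : (k b - e) * 1 + - (k a + e) * 1 - ((k b - e) * 0 + - (k a + e) * 0) <=
  m * S2 (D - a) + - m * S2 (D - b) - (m * 0 + - m * 0) by goal_lra.
apply: h.
- move=> t /out[tc|Dt]; rewrite /eta /eta1.
    rewrite !(step_left st) ?(mollifier_out st (t := t - a)) ?(mollifier_out st (t := t - b));
      rewrite ?mulr0 ?addr0 // ?ler_normr; rewrite /c in tc; try (apply/orP; right); lra.
  rewrite !(step_right st) ?(mollifier_out st (t := t - a)) ?(mollifier_out st (t := t - b));
    rewrite ?mulr0 ?addr0 ?mulr1 ?subrr // ?ler_normr; rewrite /D in Dt; try (apply/orP; left); lra.
- move=> t; rewrite /eta; have := step_mono st (s := t - b) (t := t - a);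
    move: ab; goal_lra.
- apply: ae_mono gm => t h /= /[!in_itv] /= /andP[ct tD]; apply: h.
  by rewrite /= in_itv /=; rewrite /c /D in ct tD; move: d0 d3 ct tD; goal_lra.
- by apply: is_derive_lin; apply: is_derive_shift; exact: step_derive st.
- by apply: continuous_lin; exact: rc.
- by apply: is_derive_lin; apply: is_derive_shift; exact: ramp_derive st.
- exact: continuous_lin.
- move=> t _; rewrite /eta1 expr1.
  have [] := @mollified_bounds rho a e d t (mollifier_ge0 st) (mollifier_out st) _.
    by move=> s sa; apply: daP; lra.
  have [] := @mollified_bounds rho b e d t (mollifier_ge0 st) (mollifier_out st) _.
    by move=> s sa; apply: dbP; lra.
  goal_lra.
- by move=> t _; rewrite /eta; lra.
Qed.

(** The test function is a difference of two smoothed ramps of length [h]. *)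
Lemma weak_derivative2_le (a b h r m : R) : weak_derivative F 2 J f g ->
  a <= b -> 0 < h -> 0 < r -> 0 <= m -> `[a - r, b + h + r] `<=` J ->
  {ae mu, forall t, `[a - r, b + h + r]%classic t -> l (g t) <= m} ->
  k a - k (a + h) - k b + k (b + h) <= m * h * (b - a + h).
Proof.
move=> wd ab h0 r0 m0 abJ gm.
have aah : a <= a + h by lra.
have bbh : b <= b + h by lra.
have ahbh : a + h <= b + h by lra.
have abh : a <= b + h by lra.
apply: (@le_eps _ _ _ (4 + m * h * 2)) => e e0.
have [da da0 daP] := continuous_at_bound a e0.
have [db db0 dbP] := continuous_at_bound b e0.
have [dc dc0 dcP] := continuous_at_bound (a + h) e0.
have [dd dd0 ddP] := continuous_at_bound (b + h) e0.
have r20 : 0 < r / 2 by rewrite divr_gt0.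
have [d' [d0' da' db' dr']] := pos_below3 da0 db0 r20.
have [d'' [d0'' dc' dd' de']] := pos_below3 dc0 dd0 e0.
have [d [d0 d1 d2]] := pos_below2 d0' d0''.
have [rho [S1 [S2 st]]] := smooth_step d0.
pose c := a - d; pose D := b + h + d.
have rc (x : R) := continuous_shift (x := x) (mollifier_continuous st).
have S1xc (x : R) : continuous (fun t => S1 (t - x)).
  by apply: smooth_continuous; apply: smooth_shift; exact: step_smooth st.
pose comb (p q u v : R) (w : R -> R) t :=
  1 * (p * w (t - a) + q * w (t - (a + h))) + 1 * (u * w (t - b) + v * w (t - (b + h))).
have combD p q u v (w w' : R -> R) : (forall t : R, is_derive t 1 w (w' t)) ->
    forall t : R, is_derive t 1 (comb p q u v w) (comb p q u v w' t).
  by move=> wP; apply: is_derive_lin; apply: is_derive_lin; exact: is_derive_shift.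
have combC p q u v (w : R -> R) : continuous w -> continuous (comb p q u v w).
  move=> wc; apply: continuous_lin; apply: continuous_lin; exact: continuous_shift.
pose eta := comb 1 (- 1) (- 1) 1 S2.
pose eta1 := comb 1 (- 1) (- 1) 1 S1.
pose eta2 := comb 1 (- 1) (- 1) 1 rho.
have etaP := combD 1 (- 1) (- 1) 1 _ _ (ramp_derive st).
have eta1P := combD 1 (- 1) (- 1) 1 _ _ (step_derive st).
have etas : smooth eta.
  by apply: smooth_lin; apply: smooth_lin; apply: smooth_shift; exact: ramp_smooth st.
have eta2E : derive1n 2 eta = eta2.
  have E (w w' : R -> R) : (forall t : R, is_derive t 1 w (w' t)) -> derive1 w = w'.
    by move=> wP; apply/funext => t; rewrite derive1E; have [] := wP t.
  by rewrite derive1nS derive1n1 (E _ _ etaP) (E _ _ eta1P).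
have cd : c < D by rewrite /c /D; move: abh d0; goal_lra.
have cdJ : `[c, D] `<=` J^° by apply: subset_interior_itv abJ; rewrite /c /D; lra.
pose ramp t := S2 t - S2 (t - h).
have etaE t : eta t = ramp (t - a) - ramp (t - b).
  have -> : eta t = S2 (t - a) - S2 (t - (a + h)) - S2 (t - b) + S2 (t - (b + h)).
    by rewrite /eta /comb; ring.
  by rewrite /ramp !opprD !addrA; ring.
have rampP : forall t : R, is_derive t 1 ramp (S1 t - S1 (t - h)).
  move=> t; have := is_derive_lin 1 (- 1) (ramp_derive st) (is_derive_shift h (ramp_derive st)) t.
  rewrite !mul1r !mulN1r; apply: is_derive_local ltr01 _ => y _.
  by rewrite /ramp mul1r mulN1r.
have ramp_mono s t : s <= t -> ramp s <= ramp t.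
  move=> st'; apply: is_derive_mono st' rampP _ => u _ _.
  by have := step_mono st (s := u - h) (t := u); move: bbh; goal_lra.
have S2_mono s t : s <= t -> S2 s <= S2 t.
  by move=> st'; apply: is_derive_mono st' (ramp_derive st) _ => u _ _; have := step_bound st u;
    goal_lra.
have ramp_bound t : 0 <= ramp t /\ ramp t <= h.
  split; first by rewrite subr_ge0 S2_mono //; move: bbh; goal_lra.
  have th : t - h <= t by move: bbh; goal_lra.
  have := is_derive_mono th (is_derive_lin 1 (- 1) (@is_derive_id _ _ ^~ 1) (ramp_derive st)).
  move=> /(_ (fun u _ _ => ltac:(by have := step_bound st u; lra))).
  by rewrite /ramp; goal_lra.
have eta0 t : 0 <= eta t.
  by rewrite etaE subr_ge0 ramp_mono //; move: ahbh; goal_lra.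
have etah t : eta t <= h.
  by rewrite etaE; have := ramp_bound (t - a); have := ramp_bound (t - b);
    goal_lra.
have rl t x : t < c -> a <= x -> t - x <= - d by rewrite /c; goal_lra.
have rr t x : D < t -> x <= b + h -> d <= t - x by rewrite /D; goal_lra.
have rout t x : (t < c /\ a <= x) \/ (D < t /\ x <= b + h) -> rho (t - x) = 0.
  move=> [[tc ax]|[Dt xb]]; apply: (mollifier_out st); rewrite ler_normr.
    by apply/orP; right; have := rl _ _ tc ax; goal_lra.
  by apply/orP; left; exact: rr.
have ramp0 t x : t < c -> a <= x -> ramp (t - x) = 0.
  by move=> tc ax; have := rl _ _ tc ax; rewrite /ramp => h1; rewrite !(ramp_left st) ?subrr //; lra.
have ramph t x : D < t -> x <= b -> ramp (t - x) = h.
  move=> Dt xb; rewrite /ramp (ramp_right st) ?opprB; first by ring.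
    by rewrite -addrA -opprD rr //; move: xb; goal_lra.
  by rewrite rr //; move: bbh xb; goal_lra.
have out t : ~ `[c, D]%classic t -> eta t = 0 /\ eta2 t = 0.
  move=> /outside_itv ct; split.
    by rewrite etaE; case: ct => ct; [rewrite !ramp0|rewrite !ramph]; rewrite ?subrr //; lra.
  have rz x : a <= x -> x <= b + h -> rho (t - x) = 0.
    by move=> ax xb; apply: rout; case: ct; [left|right].
  have [z1 z2 z3 z4] : [/\ rho (t - a) = 0, rho (t - (a + h)) = 0, rho (t - b) = 0 &
    rho (t - (b + h)) = 0] by split; apply: rz.
  by rewrite /eta2 /comb z1 z2 z3 z4; ring.
have := @weak_derivative_compare R K F V l hl J f g k mJ kc lf 2 eta eta2
  (comb (k a - e) (- (k (a + h) + e)) (- (k b + e)) (k (b + h) - e) S1)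
  (comb (k a - e) (- (k (a + h) + e)) (- (k b + e)) (k (b + h) - e) rho)
  (fun t => m * h * t + 0 * t) (fun t => m * h * 1 + 0 * 1) c D m wd cd cdJ etas eta2E.
have Sc x : a <= x -> S1 (c - x) = 0.
  by move=> ax; apply: (step_left st); rewrite /c; lra.
have SD x : x <= b + h -> S1 (D - x) = 1.
  by move=> xb; apply: (step_right st); rewrite /D; lra.
have combc p q u v : comb p q u v S1 c = 0.
  have [z1 z2 z3 z4] : [/\ S1 (c - a) = 0, S1 (c - (a + h)) = 0, S1 (c - b) = 0 &
    S1 (c - (b + h)) = 0] by split; apply: Sc.
  by rewrite /comb z1 z2 z3 z4; ring.
have combE p q u v : comb p q u v S1 D = p + q + u + v.
  have [z1 z2 z3 z4] : [/\ S1 (D - a) = 1, S1 (D - (a + h)) = 1, S1 (D - b) = 1 &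
    S1 (D - (b + h)) = 1] by split; apply: SD.
  by rewrite /comb z1 z2 z3 z4; ring.
rewrite combc combE subr0.
move=> main; have {}main := main (combC _ _ _ _ _ (mollifier_continuous st)) out eta0 _
  (combD _ _ _ _ _ _ (step_derive st)) (combC _ _ _ _ _ (mollifier_continuous st))
  (is_derive_lin _ _ (@is_derive_id _ _ ^~ 1) (@is_derive_id _ _ ^~ 1)) _ _ _.
have hd : m * h * d <= m * h * e by rewrite ler_wpM2l ?mulr_ge0 ?(ltW h0) //;
  move: de' d2; goal_lra.
suff : k a - e + - (k (a + h) + e) + - (k b + e) + (k (b + h) - e) <=
  m * h * D + 0 * D - (m * h * c + 0 * c).
  by rewrite /D /c; move: hd; goal_lra.
apply: main.
- apply: ae_mono gm => t ht /= /[!in_itv] /= /andP[ct tD]; apply: ht.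
  by rewrite /= in_itv /=; rewrite /c /D in ct tD;
    move: dr' d0 d1 ct tD; goal_lra.
- by move=> t; apply: cvg_cst.
- move=> t _; rewrite sqrrN expr1n mul1r.
  have [] := @mollified_bounds rho a e d t (mollifier_ge0 st) (mollifier_out st) _.
    by move=> s sa; apply: daP; lra.
  have [] := @mollified_bounds rho b e d t (mollifier_ge0 st) (mollifier_out st) _.
    by move=> s sa; apply: dbP; lra.
  have [] := @mollified_bounds rho (a + h) e d t (mollifier_ge0 st) (mollifier_out st) _.
    by move=> s sa; apply: dcP; lra.
  have [] := @mollified_bounds rho (b + h) e d t (mollifier_ge0 st) (mollifier_out st) _.
    by move=> s sa; apply: ddP; lra.
  by rewrite /eta2 /comb; goal_lra.
- by move=> t _; have := ler_wpM2l m0 (etah t); goal_lra.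
Qed.

End WeakEstimates.

(** * Regularity of Sobolev functions of one variable *)

(** Bounded real-linear maps into a real Hilbert space: through such maps all
    the Sobolev functions at hand are considered, whatever their codomain. *)
Record real_operator {R : realType} {K : numFieldType} (F : scalar_field R K)
    (V : normedModType K) (H : rhilbert R) (A : V -> H) : Prop := RealOperator {
  operatorD : forall x y, A (x + y) = A x + A y;
  operatorZ : forall a x, A (ofR F a *: x) = a *: A x;
  operator_bound : exists2 c : R, 0 <= c & forall x, nm (A x) <= c * rnorm F x
}.

Section OperatorTheory.
Context {R : realType} {K : numFieldType} (F : scalar_field R K).
Variables (V : normedModType K) (H : rhilbert R) (A : V -> H).
Hypothesis hA : real_operator F A.

Lemma operatorN x : A (- x) = - A x.
Proof.
have := operatorZ hA (- 1) x; rewrite scaleN1r => <-; congr A.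
by rewrite -[- 1](expr1 (-1)) ofR_sign expr1 scaleN1r.
Qed.

Lemma operatorB x y : A (x - y) = A x - A y.
Proof. by rewrite (operatorD hA) operatorN. Qed.

Lemma dot_operator_functional (w : H) : real_functional F (fun x => dot (A x) w).
Proof.
have [c c0 hc] := operator_bound hA; split=> [x y|a x|].
- by rewrite (operatorD hA) dotDl.
- by rewrite (operatorZ hA) dotZl.
- exists (c * nm w); first by rewrite mulr_ge0 // nm_ge0.
  move=> x; apply: le_trans (dot_abs _ _) _.
  by rewrite mulrAC ler_wpM2r ?nm_ge0.
Qed.

End OperatorTheory.

(** The norm is recovered from the scalar products, which reduces vector-valued
    estimates to real-valued ones. *)
Lemma nm_le_dual {R : realType} {H : rhilbert R} (x : H) (c : R) : 0 <= c ->
  (forall w, dot x w <= c * nm w) -> nm x <= c.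
Proof.
move=> c0 /(_ x); have [->|x0] := eqVneq x 0; first by rewrite nm0.
rewrite -sqr_nm -[_ ^+ 2]/(_ * _) ler_pM2r // lt_neqAle nm_ge0 andbT eq_sym.
by apply/eqP => /nm_eq0 /eqP; rewrite (negbTE x0).
Qed.

Section Regularity.
Context {R : realType} {K : numFieldType} (F : scalar_field R K).
Variables (V : normedModType K) (H : rhilbert R) (A : V -> H).
Hypothesis hA : real_operator F A.
Local Notation mu := (@lebesgue_measure R).

Lemma within_continuousP (J : set R) (f : R -> V) : {within J, continuous f} ->
  forall x e : R, J x -> 0 < e -> exists2 d : R, 0 < d &
  forall y, J y -> `|y - x| < d -> rnorm F (f y - f x) < e.
Proof.
move=> /subspace_continuousP fc x e Jx e0.
have fx : \forall y \near within J (nbhs x), rnorm F (f y - f x) < e.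
  exact: (cvg_rnormP F _ _).1 (fc x Jx) e e0.
have /nbhs_ballP[d /= d0 dP] : \forall y \near x, J y -> rnorm F (f y - f x) < e.
  by rewrite near_withinE in fx.
by exists d => // y Jy yx; apply: dP => //; rewrite /ball /= distrC.
Qed.

Variables (J : set R) (clamp : R -> R) (f g : R -> V).
Hypothesis mJ : measurable J.
Hypothesis clampJ : forall t, J (clamp t).
Hypothesis clampE : forall t, J t -> clamp t = t.
Hypothesis clamp_le : forall s t, `|clamp s - clamp t| <= `|s - t|.
Hypothesis fc : {within J, continuous f}.

Lemma operator_continuous_eps x (e : R) : J x -> 0 < e -> exists2 d : R, 0 < d &
  forall y, J y -> `|y - x| < d -> nm (A (f y) - A (f x)) < e.
Proof.
move=> Jx e0; have [c c0 hc] := operator_bound hA.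
have c1 : 0 < c + 1 by lra.
have ec : 0 < e / (c + 1) by rewrite divr_gt0.
have [d d0 dP] := within_continuousP fc Jx ec.
exists d => // y Jy yx; rewrite -(operatorB hA); apply: le_lt_trans (hc _) _.
have := dP y Jy yx; rewrite ltr_pdivlMr //; have := rnorm_ge0 F (f y - f x); lra.
Qed.

Lemma dot_clamp_continuous (w : H) : continuous (fun t => dot (A (f (clamp t))) w).
Proof.
move=> x; apply/(cvg_rnormP (@RealScalars R)) => e e0.
have w1 : 0 < nm w + 1 by have := nm_ge0 w; lra.
have ew : 0 < e / (nm w + 1) by rewrite divr_gt0.
have [d d0 dP] := operator_continuous_eps (clampJ x) ew.
apply/nbhs_ballP; exists d => // y; rewrite /ball /= distrC => yx.
rewrite /rnorm /= -dotNl -dotDl; apply: le_lt_trans (dot_abs _ _) _.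
have := dP _ (clampJ y) (le_lt_trans (clamp_le _ _) yx).
rewrite ltr_pdivlMr //; have := nm_ge0 (A (f (clamp y)) - A (f (clamp x))); lra.
Qed.

Lemma weak_derivative1_estimate (a b r M : R) (v : H) :
  weak_derivative F 1 J f g -> a < b -> 0 < r -> 0 <= M -> `[a - r, b + r] `<=` J ->
  {ae mu, forall t, `[a - r, b + r]%classic t -> nm (A (g t) - v) <= M} ->
  nm (A (f b) - A (f a) - (b - a) *: v) <= M * (b - a).
Proof.
move=> wd ab r0 M0 abJ gM.
apply: nm_le_dual => [|w]; first by rewrite mulr_ge0 // subr_ge0 ltW.
have Ja : J a by apply: abJ; rewrite /= in_itv /=; lra.
have Jb : J b by apply: abJ; rewrite /= in_itv /=; lra.
have lf t : J t -> dot (A (f t)) w = dot (A (f (clamp t))) w by move=> Jt; rewrite clampE.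
have kc : continuous (fun t => dot (A (f (clamp t))) w) by exact: dot_clamp_continuous.
have := @weak_derivative1_le R K F V _ (dot_operator_functional hA w) J f g
  _ mJ kc lf a b r (dot v w + M * nm w) wd ab r0 abJ.
rewrite !clampE // => h; rewrite !(dotDl, dotNl, dotZl).
suff : dot (A (f b)) w - dot (A (f a)) w <= (dot v w + M * nm w) * (b - a) by lra.
apply: h; apply: ae_mono gM => t ht It.
have := le_trans (dot_le (A (g t) - v) w) (ler_wpM2r (nm_ge0 w) (ht It)).
rewrite dotDl dotNl; lra.
Qed.

Lemma weak_derivative2_estimate (a b h r M : R) :
  weak_derivative F 2 J f g -> a <= b -> 0 < h -> 0 < r -> 0 <= M ->
  `[a - r, b + h + r] `<=` J ->
  {ae mu, forall t, `[a - r, b + h + r]%classic t -> nm (A (g t)) <= M} ->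
  nm (A (f a) - A (f (a + h)) - A (f b) + A (f (b + h))) <= M * h * (b - a + h).
Proof.
move=> wd ab h0 r0 M0 abJ gM.
apply: nm_le_dual => [|w].
  by rewrite !mulr_ge0 ?(ltW h0) //; lra.
have J4 t : a <= t -> t <= b + h -> J t.
  by move=> ta tb; apply: abJ; rewrite /= in_itv /=; lra.
have lf t : J t -> dot (A (f t)) w = dot (A (f (clamp t))) w by move=> Jt; rewrite clampE.
have M0w : 0 <= M * nm w by rewrite mulr_ge0 // nm_ge0.
have kc : continuous (fun t => dot (A (f (clamp t))) w) by exact: dot_clamp_continuous.
have := @weak_derivative2_le R K F V _ (dot_operator_functional hA w) J f g
  _ mJ kc lf a b h r (M * nm w) wd ab h0 r0 M0w abJ.
rewrite !clampE; try (apply: J4; lra).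
move=> hh; rewrite !(dotDl, dotNl).
suff : dot (A (f a)) w - dot (A (f (a + h))) w - dot (A (f b)) w + dot (A (f (b + h))) w
  <= M * nm w * h * (b - a + h) by lra.
apply: hh; apply: ae_mono gM => t ht It.
exact: le_trans (dot_le (A (g t)) w) (ler_wpM2r (nm_ge0 w) (ht It)).
Qed.

End Regularity.

Section SecondDifferences.
Context {R : realType} {H : rhilbert R}.
Variables (q : R -> H) (M : R).
Hypothesis M0 : 0 <= M.
Hypothesis qM : forall a b h : R, 0 <= a -> a <= b -> 0 < h ->
  nm (q a - q (a + h) - q b + q (b + h)) <= M * h * (b - a + h).
Hypothesis qc : forall t e : R, 0 <= t -> 0 < e -> exists2 d : R, 0 < d &
  forall s, 0 <= s -> `|s - t| < d -> nm (q s - q t) < e.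

Let p n : R := (1 / 2) ^+ n.
Let D n s := (p n)^-1 *: (q (s + p n) - q s).

Lemma dyadic_gt0 n : 0 < p n.
Proof. by rewrite exprn_gt0 // divr_gt0. Qed.

Lemma dyadicS n : p n = p n.+1 + p n.+1.
Proof. by rewrite /p exprSr; lra. Qed.

Lemma dyadic_small (e : R) : 0 < e -> exists n, p n < e.
Proof. by move=> e0; apply: expr_small => //; lra. Qed.

(** Consecutive dyadic quotients differ by a rescaled second difference. *)
Lemma dyadic_quotient_step n s : 0 <= s -> nm (D n s - D n.+1 s) <= M * (p n - p n.+1).
Proof.
move=> s0; have h0 := dyadic_gt0 n.+1; have M0' := M0.
have sh : s <= s + p n.+1 by lra.
have := qM s0 sh h0; move: (dyadicS n) h0; rewrite /D => ->; set h := p n.+1; clearbody h.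
move=> h0 b; have hh0 : 0 < h + h by lra.
rewrite !addrA.
have -> : (h + h)^-1 *: (q (s + h + h) - q s) - h^-1 *: (q (s + h) - q s) =
    (h + h)^-1 *: (q s - q (s + h) - q (s + h) + q (s + h + h)).
  by vfield; rewrite ?gt_eqF.
rewrite nmZ gtr0_norm ?invr_gt0 // mulrC ler_pdivrMr //.
by apply: (le_trans b); lra.
Qed.

Lemma dyadic_quotient_cauchy n m s : 0 <= s -> (n <= m)%N ->
  nm (D n s - D m s) <= M * (p n - p m).
Proof.
move=> s0; elim: m => [|m IH]; first by rewrite leqn0 => /eqP->; rewrite !subrr nm0 mulr0.
rewrite leq_eqVlt => /predU1P[->|/IH h]; first by rewrite !subrr nm0 mulr0.
have := nm_trans (D m s) (D n s) (D m.+1 s); have := dyadic_quotient_step m s0; lra.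
Qed.

Lemma dyadic_derivative s : 0 <= s ->
  exists v, forall n, nm (D n s - v) <= M * p n.
Proof.
move=> s0; have M0' := M0; apply: complete_rate => [e e0|n m nm_].
  have [|n hn] := @dyadic_small (e / (M + 1)); first by rewrite divr_gt0 //; lra.
  exists n; rewrite ltr_pdivlMr in hn; last by lra.
  have := dyadic_gt0 n; lra.
have := dyadic_quotient_cauchy s0 nm_; have := mulr_ge0 M0 (ltW (dyadic_gt0 m)); lra.
Qed.

(** The increments over the [N] intervals of a dyadic subdivision are compared
    with the first one by means of second differences. *)
Lemma dyadic_increment n N s : 0 <= s ->
  nm (q (s + N%:R * p n) - q s - (N%:R * p n) *: D n s) <= M * (N%:R * p n) ^+ 2.
Proof.
move=> s0; have h0 := dyadic_gt0 n; rewrite /D; move: (p n) h0 => h h0.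
have M0' := M0.
have -> : (N%:R * h) *: (h^-1 *: (q (s + h) - q s)) = N%:R *: (q (s + h) - q s).
  by vfield; rewrite gt_eqF.
elim: N => [|N IH].
  by rewrite !mul0r addr0 subrr scale0r subr0 nm0 expr0n mulr0.
have N0 : 0 <= N%:R * h by rewrite mulr_ge0 // ltW.
have sN : s <= s + N%:R * h by lra.
have b := qM s0 sN h0.
have E : s + N.+1%:R * h = s + N%:R * h + h by rewrite -natr1; ring.
rewrite E.
have -> : q (s + N%:R * h + h) - q s - N.+1%:R *: (q (s + h) - q s) =
  (q (s + N%:R * h) - q s - N%:R *: (q (s + h) - q s)) +
  (q s - q (s + h) - q (s + N%:R * h) + q (s + N%:R * h + h)).
  by rewrite -natr1; move: (N%:R : R) => x; vring.
apply: le_trans (nmD _ _) _; rewrite -natr1; move: (N%:R : R) N0 IH b => x x0 IH b.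
have := mulr_ge0 (mulr_ge0 M0' (ltW h0)) x0; lra.
Qed.

(** The derivative is the limit of dyadic difference quotients. *)
Lemma second_difference_c11 : exists q' : R -> H,
  (forall s t, 0 <= s -> s <= t ->
     nm (q t - q s - (t - s) *: q' s) <= M * (t - s) ^+ 2) /\
  (forall s t, 0 <= s -> s <= t -> nm (q' t - q' s) <= M * (t - s)).
Proof.
have M0' := M0.
have /choice[q' q'P] : forall s, exists v, 0 <= s -> forall n, nm (D n s - v) <= M * p n.
  move=> s; have [s0|s0] := leP 0 s; last by exists 0; lra.
  by have [v vP] := dyadic_derivative s0; exists v.
exists q'; split=> s t s0 st; last first.
  apply: (@le_eps _ _ _ (3 * M)) => e e0; have [n hn] := dyadic_small e0.
  have h1 := q'P s s0 n; have h2 := q'P t (le_trans s0 st) n.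
  have h0 := dyadic_gt0 n.
  have : nm (D n t - D n s) <= M * (t - s + p n).
    have := qM s0 st h0; rewrite /D; move: (p n) h0 => h h0 b.
    have -> : h^-1 *: (q (t + h) - q t) - h^-1 *: (q (s + h) - q s) =
      h^-1 *: (q s - q (s + h) - q t + q (t + h)) by vring.
    rewrite nmZ gtr0_norm ?invr_gt0 // mulrC ler_pdivrMr //; lra.
  have := nm_trans (D n s) (D n t) (q' s); have := nm_trans (D n t) (q' t) (q' s).
  rewrite (nmBC (q' t) (D n t)).
  have : M * p n <= M * e by rewrite ler_wpM2l // ltW.
  lra.
apply: (@le_eps _ _ _ (1 + M * (t - s) + nm (q' s))) => e e0.
have [d d0 dP] := qc (le_trans s0 st) e0.
have [e' [e0' ed ee]] := pos_below2 d0 e0.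
have [n hn] := dyadic_small e0'; have h0 := dyadic_gt0 n.
have h1 := q'P s s0 n; pose N := Num.trunc ((t - s) / p n).
have ts0 : 0 <= (t - s) / p n by rewrite divr_ge0 ?subr_ge0 // ltW.
have /andP[] := Num.Theory.truncn_itv ts0; rewrite -/N.
rewrite ler_pdivlMr // ltr_pdivrMr // -natr1 mulrDl mul1r => N1 N2.
have h2 := dyadic_increment n N s0.
have N0 : 0 <= N%:R * p n by rewrite mulr_ge0 // ltW.
move: (N%:R * p n) N0 N1 N2 h2 => x x0 N1 N2 h2.
have h3 : nm (q (s + x) - q t) < e.
  by apply: dP; [move: s0 ed hn x0 N1 N2; goal_lra|rewrite ltr_norml;
    move: s0 ed hn x0 N1 N2; goal_lra].
have h4 : nm (x *: D n s - x *: q' s) <= x * (M * p n).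
  by rewrite -scalerBr nmZ ger0_norm // ler_wpM2l.
have h5 : nm (x *: q' s - (t - s) *: q' s) <= p n * nm (q' s).
  rewrite -scalerBl nmZ ler_wpM2r ?nm_ge0 // ler_norml; lra.
have -> : q t - q s - (t - s) *: q' s = (q t - q (s + x)) + ((q (s + x) - q s - x *: D n s)
  + ((x *: D n s - x *: q' s) + (x *: q' s - (t - s) *: q' s))).
  by move: (D n s) => z; vring.
have h6 : M * x ^+ 2 <= M * (t - s) ^+ 2 by rewrite ler_wpM2l // lerXn2r ?nnegrE //;
  move: x0 N1; goal_lra.
have h7 : x * (M * p n) <= (t - s) * (M * e).
  by apply: ler_pM => //; [rewrite mulr_ge0 // ltW|rewrite ler_wpM2l //;
    move: ee hn; goal_lra].
have h8 : p n * nm (q' s) <= e * nm (q' s) by rewrite ler_wpM2r ?nm_ge0 //;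
  move: ee hn; goal_lra.
apply: le_trans (nmD _ _) _; rewrite nmBC.
have := nmD (q (s + x) - q s - x *: D n s) ((x *: D n s - x *: q' s) + (x *: q' s - (t - s) *: q' s)).
have := nmD (x *: D n s - x *: q' s) (x *: q' s - (t - s) *: q' s).
lra.
Qed.

End SecondDifferences.

Section SobolevFunctions.
Context {R : realType} {K : numFieldType} (F : scalar_field R K).
Variables (V : normedModType K) (H : rhilbert R) (A : V -> H).
Hypothesis hA : real_operator F A.
Local Notation mu := (@lebesgue_measure R).
Local Notation halfline := (`[0, +oo[%classic : set R).

(** Second differences are bounded by the essential bound of the second weak
    derivative; [f] is extended to the left of 0 by a constant, as the estimates
    ask for continuity on the whole line. *)
Lemma Winfty2_c11 (f : R -> V) : Winfty F 2 halfline f ->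
  {within halfline, continuous f} -> exists (q' : R -> H) (M : R), [/\ 0 <= M,
  (forall s t, 0 <= s -> s <= t ->
     nm (A (f t) - A (f s) - (t - s) *: q' s) <= M * (t - s) ^+ 2) &
  (forall s t, 0 <= s -> s <= t -> nm (q' t - q' s) <= M * (t - s))].
Proof.
move=> [_ /(_ 2%N isT)[g [[_ [M0 gM]] wd]]] fc.
have [c c0 hc] := operator_bound hA.
pose M := c * `|M0|; have MM : 0 <= M by rewrite mulr_ge0.
have Jle t : halfline t <-> 0 <= t by rewrite /= in_itv /= andbT.
have mJ : measurable (halfline : set R) by exact: measurable_itv.
pose clamp (t : R) := Num.max t 0.
have clampJ t : halfline (clamp t) by apply/Jle; rewrite /clamp le_max lexx orbT.
have clampE t : halfline t -> clamp t = t by move=> /Jle t0; exact/max_idPl.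
have clamp_le s t : `|clamp s - clamp t| <= `|s - t|.
  have := ler_norm (s - t); have := ler_norm (t - s); rewrite (distrC t s) /clamp.
  move: `|s - t| => r h1 h2.
  by case: (leP s 0) => ?; case: (leP t 0) => ?; rewrite ler_norml; lra.
have qc := operator_continuous_eps hA fc.
have [] := @second_difference_c11 R H (A \o f) M MM.
- move=> a b h a0 ab h0; apply: (@le_eps _ _ _ 4) => e e0.
  have cont t : 0 <= t -> exists2 d : R, 0 < d &
      forall s, 0 <= s -> `|s - t| < d -> nm (A (f s) - A (f t)) < e.
    move=> t0; have [d d0 dP] := qc t e ((Jle t).2 t0) e0.
    by exists d => // s s0; apply: dP; exact/Jle.
  have b0 := le_trans a0 ab.
  have [da da0 daP] := cont a a0; have [db db0 dbP] := cont b b0.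
  have [dc dc0 dcP] := cont (a + h) (addr_ge0 a0 (ltW h0)).
  have [dd dd0 ddP] := cont (b + h) (addr_ge0 b0 (ltW h0)).
  have [d' [d0' da' db']] := pos_below2 da0 db0.
  have [d [d0 d1 d2 d3]] := pos_below3 dc0 dd0 d0'.
  have d20 : 0 < d / 2 by rewrite divr_gt0.
  have near x y : d <= y -> `|x + d / 2 - x| < y.
    by move=> dy; rewrite addrAC subrr add0r gtr0_norm //;
      move: d20 dy; goal_lra.
  have h1 : nm (A (f (a + d / 2)) - A (f a)) < e by apply: daP; [move: a0 da' d0 d3; goal_lra|apply: near;
    move: a0 da' d0 d3; goal_lra].
  have h2 : nm (A (f (b + d / 2)) - A (f b)) < e by apply: dbP; [move: b0 db' d3 d20; goal_lra|apply: near;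
    move: b0 db' d3 d20; goal_lra].
  have h3 : nm (A (f (a + h + d / 2)) - A (f (a + h))) < e.
    by apply: dcP; [move: a0 h0 d1 d20; goal_lra|apply: near;
      move: a0 h0 d1 d20; goal_lra].
  have h4 : nm (A (f (b + h + d / 2)) - A (f (b + h))) < e.
    by apply: ddP; [move: a0 ab h0 d2 d20; goal_lra|apply: near;
      move: a0 ab h0 d2 d20; goal_lra].
  have sub : `[a + d / 2 - d / 2, b + d / 2 + h + d / 2] `<=` halfline.
    by move=> t /=; rewrite !in_itv /= andbT; move: a0; goal_lra.
  have := @weak_derivative2_estimate R K F V H A hA halfline clamp f g mJ clampJ clampE
    clamp_le fc (a + d / 2) (b + d / 2) h (d / 2) M wd _ h0 d20 MM sub _.
  rewrite lerD2r => /(_ ab) h5.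
  have {}h5 : nm (A (f (a + d / 2)) - A (f (a + h + d / 2)) - A (f (b + d / 2)) +
    A (f (b + h + d / 2))) <= M * h * (b - a + h).
    have -> : a + h + d / 2 = a + d / 2 + h by ring.
    have -> : b + h + d / 2 = b + d / 2 + h by ring.
    have -> : b - a + h = b + d / 2 - (a + d / 2) + h by ring.
    apply: h5; apply: ae_mono gM => t gt It.
    apply: le_trans (hc _) _; rewrite ler_wpM2l //.
    by apply: le_trans (gt (sub _ It)) (ler_norm _).
  rewrite /=; move: h1 h2 h3 h4 h5.
  move: (A (f a)) (A (f b)) (A (f (a + h))) (A (f (b + h))) (A (f (a + d / 2)))
    (A (f (b + d / 2))) (A (f (a + h + d / 2))) (A (f (b + h + d / 2))) => x1 x2 x3 x4 y1 y2 y3 y4.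
  move=> h1 h2 h3 h4 h5.
  have -> : x1 - x3 - x2 + x4 = (y1 - y3 - y2 + y4) + ((x1 - y1) + (- (x3 - y3) +
    (- (x2 - y2) + (x4 - y4)))) by vring.
  have := nmD (y1 - y3 - y2 + y4) ((x1 - y1) + (- (x3 - y3) + (- (x2 - y2) + (x4 - y4)))).
  have := nmD (x1 - y1) (- (x3 - y3) + (- (x2 - y2) + (x4 - y4))).
  have := nmD (- (x3 - y3)) (- (x2 - y2) + (x4 - y4)).
  have := nmD (- (x2 - y2)) (x4 - y4).
  rewrite !nmN (nmBC x1 y1) (nmBC x2 y2) (nmBC x3 y3) (nmBC x4 y4);
    move: h1 h2 h3 h4 h5; goal_lra.
- move=> t e t0 e0; have [d d0 dP] := qc t e ((Jle t).2 t0) e0.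
  by exists d => // s s0; apply: dP; exact/Jle.
by move=> q' [h1 h2]; exists q', M.
Qed.

Variable T : R.
Hypothesis T0 : 0 < T.
Let clamp (t : R) := Num.max 0 (Num.min t T).

Lemma clamp_itv t : `[0, T]%classic (clamp t).
Proof.
rewrite /clamp /= in_itv /=; have T0' := T0.
by case: (leP t T) => ?; [case: (leP 0 t) => ?|case: (leP 0 T) => ?];
  apply/andP; split; lra.
Qed.

Lemma clamp_id t : `[0, T]%classic t -> clamp t = t.
Proof.
by rewrite /= in_itv /= => /andP[t0 tT]; rewrite /clamp (min_idPl tT); exact/max_idPr.
Qed.

Lemma clamp_nonexpansive s t : `|clamp s - clamp t| <= `|s - t|.
Proof.
have T0' := T0; have := ler_norm (s - t); have := ler_norm (t - s).
rewrite (distrC t s) /clamp; move: `|s - t| => r h1 h2.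
case: (leP s T) => ?; case: (leP t T) => ?;
  case: (leP 0 s) => ?; case: (leP 0 t) => ?; case: (leP 0 T) => ?;
  rewrite ler_norml; lra.
Qed.

Variable f : R -> V.
Hypothesis fc : {within `[0, T], continuous f}.

(** The estimate holds between interior points, which leave room for the test
    functions, and passes to the ends by continuity. *)
Lemma Winfty1_lipschitz : Winfty F 1 `[0, T]%classic f -> exists2 L : R, 0 <= L &
  forall s t, 0 <= s -> s <= t -> t <= T -> nm (A (f t) - A (f s)) <= L * (t - s).
Proof.
move=> [_ /(_ 1%N isT)[g [[_ [M0 gM]] wd]]].
have [c c0 hc] := operator_bound hA.
pose M := c * `|M0|; have MM : 0 <= M by rewrite mulr_ge0.
exists M => // s t s0; rewrite le_eqVlt => /predU1P[->|st] tT.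
  by rewrite !subrr nm0 mulr0.
apply: (@le_eps _ _ _ 2) => e e0.
have mJ : measurable (`[0, T]%classic : set R) by exact: measurable_itv.
have JI x : 0 <= x -> x <= T -> `[0, T]%classic x by rewrite /= in_itv /= => -> ->.
have qc x (x0 : 0 <= x) (xT : x <= T) := operator_continuous_eps hA fc (JI x x0 xT) e0.
have sT : s <= T by lra.
have t0 : 0 <= t by lra.
have [ds ds0 dsP] := qc s s0 sT.
have [dt dt0 dtP] := qc t t0 tT.
have ts0 : 0 < (t - s) / 4 by rewrite divr_gt0 // subr_gt0.
have [d [d0 d1 d2 d3]] := pos_below3 ds0 dt0 ts0.
have d20 : 0 < d / 2 by rewrite divr_gt0.
have h1 : nm (A (f (s + d / 2)) - A (f s)) < e.
  by apply: dsP; [apply: JI; move: s0 tT d0 d1 d3; goal_lra|rewrite ltr_norml;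
    move: s0 tT d0 d1 d3; goal_lra].
have h2 : nm (A (f (t - d / 2)) - A (f t)) < e.
  by apply: dtP; [apply: JI; move: s0 tT d0 d2 d3; goal_lra|rewrite ltr_norml;
    move: s0 tT d0 d2 d3; goal_lra].
have sub : `[s + d / 2 - d / 2, t - d / 2 + d / 2] `<=` `[0, T]%classic.
  by move=> x /=; rewrite !in_itv /=; move: s0 tT; goal_lra.
have st' : s + d / 2 < t - d / 2 by move: d3 d20; goal_lra.
have := @weak_derivative1_estimate R K F V H A hA _ clamp f g mJ clamp_itv clamp_id
    clamp_nonexpansive fc _ _ _ M 0 wd st' d20 MM sub _.
rewrite scaler0 subr0 => h3.
have {}h3 : nm (A (f (t - d / 2)) - A (f (s + d / 2))) <= M * (t - d / 2 - (s + d / 2)).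
  apply: h3; apply: ae_mono gM => x gx Ix; rewrite subr0.
  apply: le_trans (hc _) _; rewrite ler_wpM2l //.
  by apply: le_trans (gx (sub _ Ix)) (ler_norm _).
have := nm_trans (A (f (t - d / 2))) (A (f t)) (A (f s)).
have := nm_trans (A (f (s + d / 2))) (A (f (t - d / 2))) (A (f s)).
rewrite (nmBC (A (f t)) (A (f (t - d / 2)))).
have := mulr_ge0 MM (ltW d0); move: h1 h2 h3; goal_lra.
Qed.

Lemma weak_derivative_pointwise (g : R -> V) t : weak_derivative F 1 `[0, T]%classic f g ->
  0 < t -> t < T -> {for t, continuous g} -> forall e : R, 0 < e ->
  exists2 eta : R, 0 < eta & forall t', t <= t' -> t' < t + eta ->
    nm (A (f t') - A (f t) - (t' - t) *: A (g t)) <= e * (t' - t).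
Proof.
move=> wd t0 tT gc e e0; have [c c0 hc] := operator_bound hA.
have c1 : 0 < c + 1 by lra.
have ec : 0 < e / (c + 1) by rewrite divr_gt0.
have /cvg_rnormP-/(_ _ F _ ec) /nbhs_ballP[d' /= d0' dP] := gc.
have Tt0 : 0 < T - t by rewrite subr_gt0.
have [d [d0 d1 d2 d3]] := pos_below3 d0' t0 Tt0.
have d20 : 0 < d / 2 by rewrite divr_gt0.
exists (d / 2) => // t'; rewrite le_eqVlt => /predU1P[->|tt'] t'd.
  by rewrite !subrr scale0r subr0 nm0 mulr0.
have mJ : measurable (`[0, T]%classic : set R) by exact: measurable_itv.
have sub : `[t - d / 2, t' + d / 2] `<=` `[0, T]%classic.
  by move=> x /=; rewrite !in_itv /=; lra.
apply: (@weak_derivative1_estimate R K F V H A hA _ clamp f g mJ clamp_itv clamp_id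
    clamp_nonexpansive fc _ _ _ e _ wd tt' d20 (ltW e0) sub).
apply: ae_everywhere => x /= /[!in_itv] /= Ix; rewrite -(operatorB hA).
apply: le_trans (hc _) _.
have := dP x; rewrite /ball /= ltr_norml => h.
have {}h : rnorm F (g x - g t) < e / (c + 1) by apply: h; lra.
rewrite ltr_pdivlMr // in h; have := rnorm_ge0 F (g x - g t); lra.
Qed.

End SobolevFunctions.

(** * Bochner integrals of right-continuous functions *)

Section RightContinuous.
Context {R : realType} {K : numFieldType} (F : scalar_field R K).
Variables (V : normedModType K) (T : R).
Hypothesis T0 : 0 < T.
Local Notation mu := (@lebesgue_measure R).
Local Notation J := (`[0, T]%classic : set R).
Implicit Types f : R -> V.

Definition right_continuous f := forall t e : R, 0 <= t -> t < T -> 0 < e ->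
  exists2 d : R, 0 < d & forall t', t <= t' -> t' < t + d -> t' < T ->
  rnorm F (f t' - f t) < e.

(** The value at [t] is taken at the next point of the grid, on the right of
    [t]. *)
Definition right_step f (n : nat) (t : R) : V :=
  let h := T / n.+1%:R in
  if t == T then f T else
  if (0 <= t) && ((Num.trunc (t / h)).+1 < n.+1)%N
  then f ((Num.trunc (t / h)).+1%:R * h) else 0.

Lemma measurable_J : measurable J.
Proof. exact: measurable_itv. Qed.

Lemma measure_J : (mu J < +oo)%E.
Proof. by rewrite lebesgue_measure_itv /= lte_fin; case: ifP => // _; rewrite ltry. Qed.

Lemma right_step_simple f n : simple (right_step f n).
Proof.
pose h := T / n.+1%:R.
have h0 : 0 < h by rewrite divr_gt0.
split.
  apply: (@sub_finite_set _ _ [set` f T :: 0 :: [seq f (j.+1%:R * h) | j <- iota 0 n]]);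
    last exact: finite_seq.
  move=> _ [t _ <-]; rewrite /right_step /=; case: eqP => _; first by rewrite inE eqxx.
  case: ifP => [/andP[_ kn]|_]; last by rewrite !inE eqxx orbT.
  rewrite !inE; apply/orP; right; apply/orP; right.
  by apply: (map_f (fun j => f (j.+1%:R * h))); rewrite mem_iota.
move=> v v0.
pose I (j : nat) := (`[(j%:R * h : R), (j.+1%:R * h : R)[%classic : set R) `\` [set T].
have E : right_step f n @^-1` [set v] = [set t | t = T /\ f T = v] `|`
    \bigcup_(j in [set j | (j < n)%N /\ f (j.+1%:R * h) = v]) I j.
  apply/seteqP; split=> t.
    rewrite /right_step /= -/h; case: eqP => [-> fT|tT]; first by left.
    case: ifP => [/andP[t0 kn] fv|_ v00]; last by move: v0; rewrite -v00 eqxx.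
    right; exists (Num.trunc (t / h)); first by split.
    have /andP[] := Num.Theory.truncn_itv (divr_ge0 t0 (ltW h0)).
    by rewrite ler_pdivlMr // ltr_pdivrMr // => k1 k2; split=> //=; rewrite in_itv /= k1.
  case=> [[-> <-]|[j [jn fj] [/=]]]; first by rewrite /= /right_step eqxx.
  rewrite in_itv /= => /andP[k1 k2] /eqP tT; rewrite /right_step (negbTE tT) -/h.
  have -> : Num.trunc (t / h) = j.
    by apply: Num.Theory.truncn_def; rewrite ler_pdivlMr // ltr_pdivrMr // k1.
  rewrite ltnS jn andbT (le_trans _ k1) //.
  by rewrite mulr_ge0 // ltW.
have mE : measurable (right_step f n @^-1` [set v]).
  rewrite E; apply: measurableU.
    have [fT|nfT] := pselect (f T = v).
      have -> : [set t : R | t = T /\ f T = v] = [set T] by apply/seteqP; split=> t //= -[].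
      exact: measurable_set1.
    have -> : [set t : R | t = T /\ f T = v] = set0 by apply/seteqP; split=> t //= -[].
    exact: measurable0.
  apply: fin_bigcup_measurable.
    apply: (@sub_finite_set _ _ `I_n) => [j []//|]; exact: finite_II.
  by move=> j _; apply: measurableD; [exact: measurable_itv|exact: measurable_set1].
split=> //; apply: le_lt_trans measure_J; apply: le_measure; rewrite ?inE //.
move=> t; rewrite /right_step /= in_itv /= -/h; have T0' := T0.
case: eqP => [-> _|tT]; first by rewrite lexx ltW.
case: ifP => [/andP[t0 kn] _|_ v00]; last by move: v0; rewrite -v00 eqxx.
rewrite t0 /=; have /andP[_] := Num.Theory.truncn_itv (divr_ge0 t0 (ltW h0)).
rewrite ltr_pdivrMr // => /ltW /le_trans; apply.
have -> : T = n.+1%:R * h by rewrite /h mulrC divfK // pnatr_eq0.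
by rewrite ler_pM2r // ler_nat ltnW.
Qed.

Lemma right_step_cvg f t : right_continuous f -> J t ->
  right_step f n t @[n --> \oo] --> f t.
Proof.
rewrite /= in_itv /= => fr /andP[t0]; rewrite le_eqVlt => /predU1P[->|tT].
  have -> : (fun n => right_step f n T) = (fun=> f T).
    by apply/funext => n; rewrite /right_step eqxx.
  exact: cvg_cst.
apply/(cvg_seq_rnormP F) => e e0; have [d d0 dP] := fr t e t0 tT e0.
have T0' := T0; have Tt : 0 < T - t by lra.
have [d' [d0' d1 d2]] := pos_below2 d0 Tt.
have [|N hN] := @inv_small R (d' / T); first by rewrite divr_gt0.
exists N => n Nn; rewrite /right_step; set h := T / n.+1%:R.
have h0 : 0 < h by rewrite divr_gt0.
have hd : h < d'.
  rewrite /h -ltr_pdivlMl // mulrC; apply: le_lt_trans hN.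
  by rewrite lef_pV2 ?posrE // ler_nat.
have TE : T = n.+1%:R * h by rewrite /h mulrC divfK // pnatr_eq0.
rewrite lt_eqF // t0.
have /andP[] := Num.Theory.truncn_itv (divr_ge0 t0 (ltW h0)).
rewrite ler_pdivlMr // ltr_pdivrMr //; move: (Num.trunc _) => k k1 k2.
have k3 : k.+1%:R * h <= t + h by rewrite -natr1 mulrDl mul1r; lra.
have k4 : k.+1%:R * h < T by lra.
have -> : (k.+1 < n.+1)%N by rewrite -(ltr_nat R) -(ltr_pM2r h0) -TE.
by apply: dP => //; lra.
Qed.

Lemma right_step_near f t (e : R) : right_continuous f -> J t -> 0 < e ->
  \forall n \near \oo, rnorm F (right_step f n t - f t) < e.
Proof. move=> fr Jt e0; exact: (cvg_rnormP F _ _).1 (right_step_cvg fr Jt) _ e0. Qed.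

Lemma right_step_bound f M n t : (forall t, J t -> rnorm F (f t) <= M) ->
  rnorm F (right_step f n t) <= M.
Proof.
move=> fM; have T0' := T0.
have JT : J T by rewrite /= in_itv /= lexx ltW.
have M0 : 0 <= M by exact: le_trans (rnorm_ge0 _ _) (fM T JT).
rewrite /right_step; case: eqP => _; first exact: fM.
case: ifP => [/andP[_ kn]|_]; last by rewrite rnorm0.
apply: fM; rewrite /= in_itv /=; apply/andP; split.
  by rewrite mulr_ge0 // divr_ge0 // ltW.
by rewrite mulrCA ler_piMr ?(ltW T0') // ler_pdivrMr // mul1r ler_nat ltnW.
Qed.

Lemma right_continuous_functional_measurable f l : right_continuous f ->
  real_functional F l -> measurable_fun J (fun t => l (f t)).
Proof.
move=> fr hl; apply: (@measurable_fun_cvg _ _ _ J (fun n t => l (right_step f n t))).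
  move=> n; apply: measurable_funTS.
  apply: (@simple_comp2 R K V (right_step f n) (right_step f n) (fun v _ => l v));
    exact: right_step_simple.
move=> t Jt; have [c c0 hc] := functional_bound hl.
apply/(cvg_rnormP (@RealScalars R)) => e e0; have c1 : 0 < c + 1 by lra.
have ec : 0 < e / (c + 1) by rewrite divr_gt0.
have := right_step_near fr Jt ec.
apply: filterS => n; rewrite ltr_pdivlMr // /rnorm /= -(functionalB hl) => h.
apply: le_lt_trans (hc _) _; have := rnorm_ge0 F (right_step f n t - f t).
by rewrite /rnorm in h *; lra.
Qed.

Lemma bounded_integrable_J (h : R -> R) (M : R) : measurable_fun J h ->
  (forall t, J t -> `|h t| <= M) -> mu.-integrable J (EFin \o h).
Proof.
move=> mh hM; apply: measurable_bounded_integrable => //; first exact: measure_J.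
exists M; split; first exact: num_real.
by move=> y My t Jt; apply: le_trans (hM t Jt) (ltW My).
Qed.

Lemma right_continuous_functional_integrable f l M : right_continuous f ->
  (forall t, J t -> rnorm F (f t) <= M) -> real_functional F l ->
  mu.-integrable J (EFin \o (fun t => l (f t))).
Proof.
move=> fr fM hl; have [c c0 hc] := functional_bound hl.
apply: (@bounded_integrable_J _ (c * M)).
  exact: right_continuous_functional_measurable.
by move=> t Jt; apply: le_trans (hc _) _; rewrite ler_wpM2l // fM.
Qed.

(** The distance to a step function is measurable as a limit of distances of
    step functions, although [f] itself need not be a Borel function. *)
Lemma right_step_L1 f M : right_continuous f ->
  (forall t, J t -> rnorm F (f t) <= M) ->
  (forall n, mu.-integrable J (fun t => (rnorm F (f t - right_step f n t))%:E)) /\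
  (\int[mu]_(t in J) (rnorm F (f t - right_step f n t))%:E)%E @[n --> \oo] --> 0%E.
Proof.
move=> fr fM.
have mF n : measurable_fun J (fun t => rnorm F (f t - right_step f n t)).
  apply: (@measurable_fun_cvg _ _ _ J
    (fun m t => rnorm F (right_step f m t - right_step f n t))).
    move=> m; apply: measurable_funTS.
    apply: (@simple_comp2 R K V _ _ (fun v w => rnorm F (v - w))); exact: right_step_simple.
  move=> t Jt; apply/(cvg_rnormP (@RealScalars R)) => e e0.
  have := right_step_near fr Jt e0.
  apply: filterS => m h; rewrite {1}/rnorm /= ltr_norml.
  have := rnormD F (right_step f m t - f t) (f t - right_step f n t).
  have := rnormD F (f t - right_step f m t) (right_step f m t - right_step f n t).
  rewrite !addrA !subrK (rnormBC F (f t) (right_step f m t)); lra.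
have Mint : mu.-integrable J (EFin \o (fun=> 2 * M)).
  apply: (@bounded_integrable_J _ (2 * M)); first exact: measurable_cst.
  move=> t Jt; have := fM t Jt; have := rnorm_ge0 F (f t) => h1 h2.
  by rewrite ger0_norm //; lra.
have bound n t : J t -> rnorm F (f t - right_step f n t) <= 2 * M.
  move=> Jt; apply: le_trans (rnormD _ _ _) _; rewrite rnormN.
  have := fM t Jt; have := right_step_bound n t fM; lra.
have FJ n : mu.-integrable J (fun t => (rnorm F (f t - right_step f n t))%:E).
  apply: (@bounded_integrable_J _ (2 * M)); first exact: mF.
  by move=> t Jt; rewrite ger0_norm ?rnorm_ge0 // bound.
split=> //.
have [] := @dominated_convergence _ _ _ mu J measurable_J
  (fun n t => (rnorm F (f t - right_step f n t))%:E) (cst 0%E) (EFin \o (fun=> 2 * M)).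
- by move=> n; apply/measurable_EFinP; exact: mF.
- exact: measurable_cst.
- apply: ae_everywhere => t Jt; apply: cvg_EFin; first by near=> n.
  apply/(cvg_rnormP (@RealScalars R)) => e e0.
  have := right_step_near fr Jt e0.
  apply: filterS => m; rewrite {2}/rnorm /= subr0 ger0_norm ?rnorm_ge0 //.
  by rewrite rnormBC.
- exact: Mint.
- apply: ae_everywhere => t n Jt /=; rewrite lee_fin ger0_norm ?rnorm_ge0 //.
  exact: bound.
by move=> _ _; rewrite integral0.
Unshelve. all: by end_near.
Qed.

Lemma right_continuous_strongly_measurable f : right_continuous f ->
  strongly_measurable J f.
Proof.
move=> fr; exists (right_step f); split=> [n|]; first exact: right_step_simple.
by apply: ae_everywhere => t Jt; exact: right_step_cvg.
Qed.

End RightContinuous.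

Section RightDerivative.
Context {R : realType}.
Variable T : R.
Hypothesis T0 : 0 < T.
Local Notation mu := (@lebesgue_measure R).
Local Notation J := (`[0, T]%classic : set R).
(** The difference of the indefinite integral of [k] and of [P] has a
    nonpositive Dini derivative, whence it decreases. *)
Lemma right_derivative_integral_le (P k : R -> R) (L M : R) :
  mu.-integrable J (EFin \o k) -> 0 <= L -> 0 <= M ->
  (forall t, J t -> k t <= M) ->
  (forall t e : R, 0 <= t -> t < T -> 0 < e -> exists2 d : R, 0 < d &
    forall t', t <= t' -> t' < t + d -> t' < T -> k t' <= k t + e) ->
  (forall s t, 0 <= s -> s <= t -> t <= T -> `|P t - P s| <= L * (t - s)) ->
  (forall t e : R, 0 <= t -> t < T -> 0 < e -> exists2 d : R, 0 < d &
    forall t', t <= t' -> t' < t + d -> t' < T ->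
    (k t - e) * (t' - t) <= P t' - P t) ->
  \int[mu]_(t in J) k t <= P T - P 0.
Proof.
move=> kint L0 M0 kM kr PL PD; have T0' := T0.
pose H t := \int[mu]_(s in `[0, t]) k s.
have kI s t (b : bool) : 0 <= s -> t <= T ->
    mu.-integrable [set` Interval (BSide b s) (BRight t)] (EFin \o k).
  move=> s0 tT; apply: integrableS kint; [exact: measurable_itv|exact: measurable_itv|].
  move=> u; rewrite /= !in_itv /= => /andP[su ut]; apply/andP; split; last by lra.
  by move: su; case: b => /=; lra.
have Hle s t c : 0 <= s -> s <= t -> t <= T -> (forall u, s <= u -> u <= t -> k u <= c) ->
    H t - H s <= c * (t - s).
  move=> s0 st tT kc; have t0 := le_trans s0 st.
  have cint : mu.-integrable `]s, t] (EFin \o (fun=> c)).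
    have cc : continuous (fun _ : R => c) by move=> ?; exact: cvg_cst.
    have := @continuous_itv_integrable R (fun=> c) s t cc.
    apply: integrableS; [exact: measurable_itv|exact: measurable_itv|].
    exact: subset_itv_oc_cc.
  rewrite /H (Rintegral_itvB (kI 0 t true (lexx 0) tT)) ?bnd_simp //.
  have mI : measurable (`]s, t]%classic : set R) by exact: measurable_itv.
  have -> : c * (t - s) = \int[mu]_(u in `]s, t]) c.
    have muE : mu `]s, t]%classic = (t - s)%:E.
      rewrite lebesgue_measure_itv /= lte_fin.
      by case: ltP => // ts; rewrite (_ : t = s) ?subrr //; apply/le_anti; rewrite ts st.
    rewrite (Rintegral_cst mu mI) -[t - s]/(fine (t - s)%:E); congr (c * fine _).
    exact: esym muE.
  have h := @le_Rintegral _ _ _ mu `]s, t]%classic k (fun=> c) mI (kI s t false s0 tT) cint.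
  apply: h.
  by move=> u /=; rewrite in_itv /= => /andP[/ltW su ut]; exact: kc.
have H0 : H 0 = 0.
  by rewrite /H set_itv1 Rintegral_set1.
suff : H T - P T <= H 0 - P 0 by rewrite H0 /H; lra.
apply: (@dini_nonincreasing R (fun t => H t - P t) 0 T (M + L) set0).
- lra.
- lra.
- move=> s t s0 st tT; have h1 := PL s t s0 st tT.
  have := Hle s t M s0 st tT; move: h1; rewrite ler_norml => /andP[h1 _] h2.
  have : H t - H s <= M * (t - s).
    by apply: h2 => u su ut; apply: kM; rewrite /= in_itv /=; lra.
  lra.
- exact: negligible_set0.
- move=> t t0 tT _ e e0; have e20 : 0 < e / 4 by rewrite divr_gt0.
  have [d1 d10 d1P] := kr t _ t0 tT e20.
  have [d2 d20 d2P] := PD t _ t0 tT e20.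
  have Tt : 0 < T - t by lra.
  have [d [d0 dd1 dd2 dT]] := pos_below3 d10 d20 Tt.
  exists d => // t' tt' t'd t'T.
  have h1 : H t' - H t <= (k t + e / 4) * (t' - t).
    by apply: Hle => // u tu ut; apply: d1P => //; lra.
  have h2 : (k t - e / 4) * (t' - t) <= P t' - P t by apply: d2P => //;
    move: dd2 dT t'd; goal_lra.
  have : 0 <= e * (t' - t) by rewrite mulr_ge0 ?subr_ge0 // ltW.
  move: h1 h2; goal_lra.
Qed.

Lemma continuous_bounded_J (h : R -> R) : continuous h ->
  exists2 B : R, 0 <= B & forall t, J t -> `|h t| <= B.
Proof.
move=> hc; have T0' := ltW T0.
have nc : {within J, continuous (fun t => `|h t|)}.
  apply: continuous_subspaceT => t; apply: (@cvg_norm _ R^o _ _ _ h (h t)); exact: hc.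
have [c _ cP] := EVT_max T0' nc.
by exists `|h c| => // t Jt; apply: cP.
Qed.

Lemma test_function_ends (eta : R -> R) : test_function J eta -> eta 0 = 0 /\ eta T = 0.
Proof.
move=> [_ _ sub]; have T0' := T0.
have h t : ~ J^° t -> eta t = 0.
  move=> nJ; apply: contrapT => /eqP et; apply: nJ; apply: sub; exact: subset_closure.
split; apply: h => /nbhs_ballP[r /= r0 /(_ _)] hr.
  have := hr (- (r / 2)); rewrite /ball /= in_itv /= sub0r opprK => hh.
  have : `|r / 2| < r by rewrite ger0_norm; lra.
  move=> /hh; lra.
have := hr (T + r / 2); rewrite /ball /= in_itv /= => hh.
have : `|T - (T + r / 2)| < r by rewrite ltr_norml; lra.
move=> /hh; lra.
Qed.

(** Both inequalities follow from [right_derivative_integral_le], applied to [P]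
    and to its opposite. *)
Lemma right_derivative_integral (P k : R -> R) (L M : R) :
  mu.-integrable J (EFin \o k) -> 0 <= L -> 0 <= M ->
  (forall t, J t -> `|k t| <= M) ->
  (forall t e : R, 0 <= t -> t < T -> 0 < e -> exists2 d : R, 0 < d &
    forall t', t <= t' -> t' < t + d -> t' < T -> `|k t' - k t| <= e) ->
  (forall s t, 0 <= s -> s <= t -> t <= T -> `|P t - P s| <= L * (t - s)) ->
  (forall t e : R, 0 <= t -> t < T -> 0 < e -> exists2 d : R, 0 < d &
    forall t', t <= t' -> t' < t + d -> t' < T ->
    `|P t' - P t - k t * (t' - t)| <= e * (t' - t)) ->
  \int[mu]_(t in J) k t = P T - P 0.
Proof.
move=> kint L0 M0 kM kr PL PD; apply/le_anti/andP; split.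
  apply: (@right_derivative_integral_le P k L M) => //.
  - by move=> t /kM; rewrite ler_norml => /andP[].
  - move=> t e t0 tT e0; have [d d0 dP] := kr t e t0 tT e0; exists d => // t' h1 h2 h3.
    by have := dP t' h1 h2 h3; rewrite ler_norml; goal_lra.
  - move=> t e t0 tT e0; have [d d0 dP] := PD t e t0 tT e0; exists d => // t' h1 h2 h3.
    by have := dP t' h1 h2 h3; rewrite ler_norml; lra.
have NE : \int[mu]_(t in J) (- k t) = - \int[mu]_(t in J) k t.
  have -> : (fun t => - k t) = (fun t => - 1 * k t) by apply/funext => t; rewrite mulN1r.
  by rewrite (@RintegralZl _ _ _ mu J k (- 1) (measurable_J T) kint) mulN1r.
suff : \int[mu]_(t in J) (- k t) <= - P T - - P 0.
  by rewrite NE opprK (addrC (- P T)) -opprB lerN2.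
apply: (@right_derivative_integral_le (fun t => - P t) (fun t => - k t) L M) => //.
- exact: (integrableN kint).
- by move=> t /kM; rewrite ler_norml; lra.
- move=> t e t0 tT e0; have [d d0 dP] := kr t e t0 tT e0; exists d => // t' h1 h2 h3.
  by have := dP t' h1 h2 h3; rewrite ler_norml; lra.
- by move=> s t s0 st tT; rewrite -opprD normrN; exact: PL.
- move=> t e t0 tT e0; have [d d0 dP] := PD t e t0 tT e0; exists d => // t' h1 h2 h3.
  by have := dP t' h1 h2 h3; rewrite ler_norml; lra.
Qed.

End RightDerivative.

Section RealifyOperator.
Context {R : realType} {K : numFieldType} {F : scalar_field R K}.
Variable X : hilbert F.

Lemma realify_operator : real_operator F (fun x : X => x : realify X).
Proof.
split=> //; exists 1; first exact: ler01.
by move=> x; rewrite mul1r nm_realify.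
Qed.

Lemma dot_realify_functional (w : realify X) :
  real_functional F (fun x : X => dot (x : realify X) w).
Proof. exact: dot_operator_functional realify_operator w. Qed.

End RealifyOperator.

Section BochnerRight.
Context {R : realType} {K : numFieldType} {F : scalar_field R K}.
Variables (X : hilbert F) (T : R).
Hypothesis T0 : 0 < T.
Local Notation mu := (@lebesgue_measure R).
Local Notation J := (`[0, T]%classic : set R).
Local Notation toR x := (x : realify X).

Lemma simple_integral_dist (f s s' : R -> X) (a b : R) :
  simple s -> simple s' ->
  mu.-integrable J (fun t => (rnorm F (f t - s t))%:E) ->
  mu.-integrable J (fun t => (rnorm F (f t - s' t))%:E) ->
  (\int[mu]_(t in J) (rnorm F (f t - s t))%:E <= a%:E)%E ->
  (\int[mu]_(t in J) (rnorm F (f t - s' t))%:E <= b%:E)%E ->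
  rnorm F (simple_integral F J s - simple_integral F J s') <= a + b.
Proof.
move=> ss ss' is_ is'_ sa s'b.
have mJ := measurable_J T.
have a0 : 0 <= a.
  rewrite -lee_fin (le_trans _ sa) //; apply: integral_ge0 => t _.
  by rewrite lee_fin rnorm_ge0.
have b0 : 0 <= b.
  rewrite -lee_fin (le_trans _ s'b) //; apply: integral_ge0 => t _.
  by rewrite lee_fin rnorm_ge0.
rewrite -nm_realify; apply: nm_le_dual => [|w]; first exact: addr_ge0.
have hl := dot_realify_functional w.
have [i1 E1] := simple_functional_integral mJ ss hl.
have [i2 E2] := simple_functional_integral mJ ss' hl.
rewrite (functionalB hl) lerBlDr -lee_fin -E1 EFinD -E2 addeC.
pose g t := ((rnorm F (f t - s t))%:E + (rnorm F (f t - s' t))%:E)%E.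
have ig : mu.-integrable J g by exact: integrableD.
have igw : mu.-integrable J (fun t => (nm w)%:E * g t)%E by exact: integrableZl.
apply: (@le_trans _ _ (\int[mu]_(t in J) ((dot (toR (s' t)) w)%:E + (nm w)%:E * g t))%E).
  apply: le_integral => //; first exact: integrableD.
  move=> t _; rewrite /g.
  have -> : ((nm w)%:E * ((rnorm F (f t - s t))%:E + (rnorm F (f t - s' t))%:E) =
    (nm w * (rnorm F (f t - s t) + rnorm F (f t - s' t)))%:E)%E by [].
  rewrite -EFinD lee_fin -lerBlDl.
  have := dot_le (toR (s t) - toR (s' t)) w; rewrite dotDl dotNl => /le_trans; apply.
  rewrite mulrC ler_wpM2l ?nm_ge0 // nm_realify.
  have -> : (s t - s' t : X) = (f t - s' t) - (f t - s t) by rewrite opprB [RHS]addrC addrA subrK.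
  by apply: le_trans (rnormD _ _ _) _; rewrite rnormN addrC.
rewrite integralD // leeD2l // integralZl // integralD //.
rewrite [in leRHS]mulrC EFinM lee_pmul ?nm_ge0 ?lee_fin ?nm_ge0 //.
  by apply: adde_ge0; apply: integral_ge0 => t _; rewrite lee_fin rnorm_ge0.
by rewrite EFinD leeD.
Qed.

Lemma bochner_right_continuous (f : R -> X) (M : R) : right_continuous F T f ->
  (forall t, J t -> rnorm F (f t) <= M) -> exists I, bochner_integral F J f I.
Proof.
move=> fr fM; have [iL1 cL1] := right_step_L1 T0 fr fM.
have ss n := right_step_simple T0 f n.
have close e : 0 < e -> exists N, forall n, (N <= n)%N ->
    (\int[mu]_(t in J) (rnorm F (f t - right_step T f n t))%:E <= e%:E)%E.
  move=> e0; have [N _ hN] := cvge0_lt e0 cL1.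
  by exists N => n Nn; apply: ltW; exact: hN.
have [I hI] : exists I, vcvg (@rnorm R K F X)
    (fun n => simple_integral F J (right_step T f n)) I.
  apply: rnorm_complete => e e0; have e30 : 0 < e / 3 by rewrite divr_gt0.
  have [N hN] := close _ e30; exists N => m n Nm Nn.
  have := simple_integral_dist (ss m) (ss n) (iL1 m) (iL1 n) (hN m Nm) (hN n Nn).
  by move=> /le_lt_trans; apply; lra.
exists I; split; first exact: (right_continuous_strongly_measurable T0 fr).
by exists (right_step T f); split=> //; exact/(cvg_seq_rnormP F).
Qed.

Lemma right_continuous_Linfty (f : R -> X) (M : R) : right_continuous F T f ->
  (forall t, J t -> rnorm F (f t) <= M) -> Linfty F J f.
Proof.
move=> fr fM; split; first exact: (right_continuous_strongly_measurable T0 fr).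
by exists M; exact: ae_everywhere.
Qed.

Lemma right_continuous_scale (c : R -> R) (f : R -> X) (M : R) : continuous c ->
  right_continuous F T f -> (forall t, J t -> rnorm F (f t) <= M) ->
  right_continuous F T (fun t => ofR F (c t) *: f t).
Proof.
move=> cc fr fM t e t0 tT e0.
have Jt : J t by rewrite /= in_itv /= t0 ltW.
have M0 : 0 <= M by exact: le_trans (rnorm_ge0 _ _) (fM t Jt).
have C0 : 0 < `|c t| + M + 1 by have := normr_ge0 (c t); lra.
have e1 : 0 < e / (`|c t| + M + 1) by rewrite divr_gt0.
have [e' [e'0 ee e'1]] := pos_below2 e1 ltr01.
have [d1 d10 d1P] := fr t e' t0 tT e'0.
have [d2 d20 d2P] := continuous_at_bound cc t e'0.
have [d [d0 dd1 dd2]] := pos_below2 d10 d20; exists d => // t' tt' t'd t'T.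
have -> : ofR F (c t') *: f t' - ofR F (c t) *: f t =
   ofR F (c t' - c t) *: f t' + ofR F (c t) *: (f t' - f t).
  by rewrite ofRB scalerBl scalerBr addrA subrK.
apply: le_lt_trans (rnormD _ _ _) _; rewrite !rnormZr.
have h1 : rnorm F (f t' - f t) < e' by apply: d1P => //; lra.
have h2 : `|c t' - c t| <= e'.
  by rewrite ler_norml; have := d2P t'; rewrite ltr_norml;
    move: dd2 tt' t'd; goal_lra.
have h3 : rnorm F (f t') <= M by apply: fM; rewrite /= in_itv /=;
  move: t0 tt' t'T; goal_lra.
have h4 : `|c t' - c t| * rnorm F (f t') <= e' * M.
  by apply: ler_pM => //; exact: rnorm_ge0.
have h5 : `|c t| * rnorm F (f t' - f t) <= `|c t| * e'.
  by rewrite ler_wpM2l // ltW.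
move: ee; rewrite ler_pdivlMr //; lra.
Qed.

Variables (x xd : R -> X) (L M : R).
Hypothesis L0 : 0 <= L.
Hypothesis xL : forall s t, 0 <= s -> s <= t -> t <= T -> rnorm F (x t - x s) <= L * (t - s).
Hypothesis xM : forall t, J t -> rnorm F (x t) <= M.
Hypothesis xdM : forall t, J t -> rnorm F (xd t) <= M.
Hypothesis xdr : right_continuous F T xd.
Hypothesis xD : forall t e : R, 0 <= t -> t < T -> 0 < e -> exists2 d : R, 0 < d &
  forall t', t <= t' -> t' < t + d -> t' < T ->
  rnorm F (x t' - x t - ofR F (t' - t) *: xd t) <= e * (t' - t).

Lemma lipschitz_right_continuous : right_continuous F T x.
Proof.
move=> t e t0 tT e0; have L0' := L0; have L1 : 0 < L + 1 by lra.
exists (e / (L + 1)); first by rewrite divr_gt0.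
move=> t' tt' t'd t'T; have := xL t0 tt' (ltW t'T).
have : t' - t < e / (L + 1) by lra.
rewrite ltr_pdivlMr //; lra.
Qed.

(** Tested against a vector [w], the claim says that the right derivative of
    [eta t * dot (x t) w] has integral 0, as [eta] vanishes at both ends. *)
Lemma weak_derivative_right : weak_derivative F 1 J x xd.
Proof.
move=> eta test; have [ed _ _] := test.
pose eta1 := derive1 eta.
have etaP : forall t : R, is_derive t 1 eta (eta1 t).
  by move=> t; split; [exact: (ed 0%N)|rewrite /eta1 derive1E].
have eta1c : continuous eta1.
  by move=> t; apply: differentiable_continuous; apply/derivable1_diffP; exact: (ed 1%N).
have etac : continuous eta by move=> t; exact: is_derive_continuous (etaP t).
have xr := lipschitz_right_continuous.
have [B B0 BP] := continuous_bounded_J T0 etac.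
have [B1 B10 B1P] := continuous_bounded_J T0 eta1c.
have M0 : 0 <= M by apply: le_trans (rnorm_ge0 F (x 0)) (xM _); rewrite /= in_itv /= lexx ltW.
have scM (c : R -> R) (f : R -> X) (C : R) : (forall t, J t -> `|c t| <= C) ->
    (forall t, J t -> rnorm F (f t) <= M) ->
    forall t, J t -> rnorm F (ofR F (c t) *: f t) <= C * M.
  move=> cC fM t Jt; rewrite rnormZr; apply: ler_pM => //; [exact: rnorm_ge0|exact: cC|exact: fM].
have M1 := scM _ _ _ B1P xM; have M2 := scM _ _ _ BP xdM.
have r1 := right_continuous_scale eta1c xr xM; have r2 := right_continuous_scale etac xdr xdM.
have [I1 I1P] := bochner_right_continuous r1 M1.
have [I2 I2P] := bochner_right_continuous r2 M2.
exists I1; split; first by rewrite derive1n1.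
suff -> : (-1) ^+ 1 *: I1 = I2 by [].
rewrite expr1 scaleN1r; apply/eqP; rewrite eq_sym -addr_eq0; apply/eqP.
suff /vec_eq : forall w : realify X, dot (toR (I2 + I1)) w = dot (0 : realify X) w by [].
move=> w; rewrite dot0l.
pose l (v : X) := dot (toR v) w.
have hl : real_functional F l := dot_realify_functional w.
have mJ := measurable_J T.
have i1 := right_continuous_functional_integrable T0 r1 M1 hl.
have i2 := right_continuous_functional_integrable T0 r2 M2 hl.
have E1 := bochner_functional_eq mJ hl I1P i1 (fun _ _ => erefl).
have E2 := bochner_functional_eq mJ hl I2P i2 (fun _ _ => erefl).
pose p t := l (x t); pose pd t := l (xd t).
pose k t := eta t * pd t + eta1 t * p t.
have kE : EFin \o k = (fun t => (l (ofR F (eta t) *: xd t))%:E +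
    (l (ofR F (eta1 t) *: x t))%:E)%E.
  by apply/funext => t /=; rewrite !(functionalZ hl).
have ik : mu.-integrable J (EFin \o k) by rewrite kE; exact: integrableD.
have kI : \int[mu]_(t in J) k t = l (I2 + I1).
  transitivity (fine (\int[mu]_(t in J) (EFin \o k) t)); first by [].
  rewrite kE integralD //.
  by rewrite E1 E2 -EFinD /= (functionalD hl).
have [eta0 etaT] := test_function_ends T0 test.
rewrite -[LHS]/(l (I2 + I1)) -kI; pose m := nm w; have m0 : 0 <= m by exact: nm_ge0.
have dl v : `|l v| <= rnorm F v * m.
  by rewrite -nm_realify; exact: dot_abs.
have pB t : J t -> `|p t| <= M * m by move=> Jt; apply: le_trans (dl _) _; rewrite ler_wpM2r // xM.
have pL s t : 0 <= s -> s <= t -> t <= T -> `|p t - p s| <= L * m * (t - s).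
  move=> s0 st tT; rewrite /p -(functionalB hl) mulrAC; apply: le_trans (dl _) _.
  by rewrite ler_wpM2r // xL.
have etaL s t : 0 <= s -> s <= t -> t <= T -> `|eta t - eta s| <= B1 * (t - s).
  move=> s0 st tT; have B1P' u : s < u -> u < t -> - B1 <= eta1 u /\ eta1 u <= B1.
    by move=> su ut; have := B1P u; rewrite ler_norml /= in_itv /= => h; split;
      move: s0 tT su ut; goal_lra.
  have dl' (c : R) := is_derive_lin B1 c (@is_derive_id R R ^~ 1) etaP.
  have h1 : B1 * s + 1 * eta s <= B1 * t + 1 * eta t.
    by apply: (is_derive_mono st (dl' 1)) => u su ut; have := B1P' u su ut;
      goal_lra.
  have h2 : B1 * s + - 1 * eta s <= B1 * t + - 1 * eta t.
    by apply: (is_derive_mono st (dl' (- 1))) => u su ut; have := B1P' u su ut;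
      goal_lra.
  by rewrite ler_norml; move: h1 h2; goal_lra.
rewrite (@right_derivative_integral R T T0 (fun t => eta t * p t) k
  (B1 * (M * m) + B * (L * m)) (B * M * m + B1 * M * m)) //.
- by rewrite eta0 etaT !mul0r subrr.
- by rewrite addr_ge0 // !mulr_ge0.
- by rewrite addr_ge0 // !mulr_ge0.
- move=> t Jt; have := dl (ofR F (eta t) *: xd t); have := dl (ofR F (eta1 t) *: x t).
  rewrite !(functionalZ hl) => h1 h2; apply: le_trans (ler_normD _ _) _; apply: lerD.
    by apply: le_trans h2 _; rewrite ler_wpM2r // M2.
  by apply: le_trans h1 _; rewrite ler_wpM2r // M1.
- move=> t e t0 tT e0; have m1 : 0 < 2 * m + 1 by move: m0; goal_lra.
  have e1 : 0 < e / (2 * m + 1) by rewrite divr_gt0.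
  have [d1 d10 d1P] := r1 t _ t0 tT e1; have [d2 d20 d2P] := r2 t _ t0 tT e1.
  have [d [d0 dd1 dd2]] := pos_below2 d10 d20; exists d => // t' tt' t'd t'T.
  have h1 : rnorm F (ofR F (eta1 t') *: x t' - ofR F (eta1 t) *: x t) < e / (2 * m + 1).
    by apply: d1P => //; move: dd1 t'd; goal_lra.
  have h2 : rnorm F (ofR F (eta t') *: xd t' - ofR F (eta t) *: xd t) < e / (2 * m + 1).
    by apply: d2P => //; move: dd2 t'd; goal_lra.
  have -> : k t' - k t = l (ofR F (eta t') *: xd t' - ofR F (eta t) *: xd t) +
     l (ofR F (eta1 t') *: x t' - ofR F (eta1 t) *: x t).
    by rewrite !(functionalB hl) !(functionalZ hl) /k /p /pd; ring.
  apply: le_trans (ler_normD _ _) _.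
  have := dl (ofR F (eta1 t') *: x t' - ofR F (eta1 t) *: x t).
  have := dl (ofR F (eta t') *: xd t' - ofR F (eta t) *: xd t).
  have h3 := ler_wpM2r m0 (ltW h1); have h4 := ler_wpM2r m0 (ltW h2).
  have : e / (2 * m + 1) * (2 * m + 1) = e by rewrite divfK // gt_eqF.
  move: e1 h3 h4; goal_lra.
- move=> s t s0 st tT.
  have -> : eta t * p t - eta s * p s = (eta t - eta s) * p t + eta s * (p t - p s) by ring.
  have Jt : J t by rewrite /= in_itv /= tT (le_trans s0).
  have Js : J s by rewrite /= in_itv /= s0 (le_trans st).
  apply: le_trans (ler_normD _ _) _; rewrite !normrM.
  have -> : (B1 * (M * m) + B * (L * m)) * (t - s) =
    B1 * (t - s) * (M * m) + B * (L * m * (t - s)) by ring.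
  by apply: lerD; apply: ler_pM => //; [exact: etaL|exact: pB|exact: BP|exact: pL].
- move=> t e t0 tT e0.
  pose C := M * m + B1 * (L * m) + B * m.
  have C0 : 0 <= C by rewrite !addr_ge0 // !mulr_ge0.
  have C1 : 0 < C + 1 by move: C0; goal_lra.
  have e1 : 0 < e / (C + 1) by rewrite divr_gt0.
  move: (e / (C + 1)) e1 (divfK (lt0r_neq0 C1) e) => e1 e10 eE.
  have /is_deriveP/(_ e1 e10)[d1 d10 d1P] := etaP t.
  have [d2 d20 d2P] := xD t0 tT e10.
  have [d [d0 dd1 dd2 dd3]] := pos_below3 d10 d20 e10; exists d => // t' tt' t'd t'T.
  have tau0 : 0 <= t' - t by move: tt'; goal_lra.
  have h1 : `|eta t' - eta t - eta1 t * (t' - t)| <= e1 * (t' - t).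
    have := d1P t'; rewrite (ger0_norm tau0); apply; move: dd1 t'd; goal_lra.
  have h2 : `|p t' - p t - (t' - t) * pd t| <= e1 * (t' - t) * m.
    have -> : p t' - p t - (t' - t) * pd t = l (x t' - x t - ofR F (t' - t) *: xd t).
      by rewrite !(functionalB hl) (functionalZ hl).
    by apply: le_trans (dl _) _; rewrite ler_wpM2r // d2P //;
      move: dd2 t'd; goal_lra.
  have Jt : J t by rewrite /= in_itv /= t0 ltW.
  have Jt' : J t' by rewrite /= in_itv /= (le_trans t0) //= ltW.
  have h3 := pL t t' t0 tt' (ltW t'T).
  have -> : eta t' * p t' - eta t * p t - k t * (t' - t) =
    (eta t' - eta t - eta1 t * (t' - t)) * p t' + (eta1 t * ((t' - t) * (p t' - p t)) +
    eta t * (p t' - p t - (t' - t) * pd t)) by rewrite /k; ring.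
  apply: le_trans (ler_normD _ _) _.
  have := ler_normD (eta1 t * ((t' - t) * (p t' - p t))) (eta t * (p t' - p t - (t' - t) * pd t)).
  rewrite !normrM (ger0_norm tau0) => g0.
  have g1 : `|eta t' - eta t - eta1 t * (t' - t)| * `|p t'| <= e1 * (t' - t) * (M * m).
    by apply: ler_pM => //; exact: pB.
  have g2 : `|eta1 t| * ((t' - t) * `|p t' - p t|) <= B1 * ((t' - t) * (L * m * e1)).
    apply: ler_pM => //; [by rewrite mulr_ge0|exact: B1P|].
    rewrite ler_wpM2l //; apply: le_trans h3 _; rewrite ler_wpM2l ?mulr_ge0 //; lra.
  have g3 : `|eta t| * `|p t' - p t - (t' - t) * pd t| <= B * (e1 * (t' - t) * m).
    by apply: ler_pM => //; exact: BP.
  have : e1 * C * (t' - t) <= e * (t' - t).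
    rewrite ler_wpM2r // -eE ler_wpM2l ?(ltW e10) //; goal_lra.
  rewrite /C; move: g0 g1 g2 g3; goal_lra.
Qed.

Lemma Winfty1_right : Winfty F 1 J x.
Proof.
have xr := lipschitz_right_continuous.
have Lx := right_continuous_Linfty xr xM.
split=> //; case=> [_|[_|//]]; last first.
  exists xd; split; [exact: right_continuous_Linfty xdM|exact: weak_derivative_right].
exists x; split=> // eta test; have [ed _ _] := test.
have etac : continuous eta.
  by move=> t; apply: differentiable_continuous; apply/derivable1_diffP; exact: (ed 0%N).
have [B B0 BP] := continuous_bounded_J T0 etac.
have r := right_continuous_scale etac xr xM.
have rM t : J t -> rnorm F (ofR F (eta t) *: x t) <= B * M.
  move=> Jt; rewrite rnormZr; apply: ler_pM => //; first exact: rnorm_ge0.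
    exact: BP.
  exact: xM.
have [I IP] := bochner_right_continuous r rM.
by exists I; rewrite expr0 scale1r derive1n0.
Qed.

Lemma within_continuous_lipschitz : {within J, continuous x}.
Proof.
apply/subspace_continuousP => t Jt; apply/(cvg_rnormP F) => e e0.
have L0' := L0; have L1 : 0 < L + 1 by lra.
rewrite near_withinE; apply/nbhs_ballP; exists (e / (L + 1)); first by rewrite /= divr_gt0.
move=> s; rewrite /ball /= => st Js; rewrite ltr_pdivlMr // in st.
move: Jt Js; rewrite /= !in_itv /= => /andP[t0 tT] /andP[s0 sT].
have := normr_ge0 (t - s) => n0.
have [ts|/ltW ts] := leP t s.
  by have := xL t0 ts sT; rewrite distrC ger0_norm ?subr_ge0 // in st n0 *; lra.
have := xL s0 ts tT; rewrite rnormBC ger0_norm ?subr_ge0 // in st n0 *; lra.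
Qed.

End BochnerRight.

(** * The closed loop in moving coordinates *)

Section Calculus.
Context {R : realType} {H : rhilbert R}.
Variable T : R.

Definition bounded_lipschitz (f : R -> H) := exists2 c : R, 0 <= c &
  (forall t, 0 <= t -> t <= T -> nm (f t) <= c) /\
  (forall s t, 0 <= s -> s <= t -> t <= T -> nm (f t - f s) <= c * (t - s)).

Definition scalar_bounded_lipschitz (a : R -> R) := exists2 c : R, 0 <= c &
  (forall t, 0 <= t -> t <= T -> `|a t| <= c) /\
  (forall s t, 0 <= s -> s <= t -> t <= T -> `|a t - a s| <= c * (t - s)).

Definition right_derivative (f : R -> H) (t : R) (v : H) := forall e : R, 0 < e ->
  exists2 d : R, 0 < d & forall t', t <= t' -> t' < t + d -> t' < T ->
  nm (f t' - f t - (t' - t) *: v) <= e * (t' - t).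

Definition scalar_right_derivative (a : R -> R) (t b : R) := forall e : R, 0 < e ->
  exists2 d : R, 0 < d & forall t', t <= t' -> t' < t + d -> t' < T ->
  `|a t' - a t - (t' - t) * b| <= e * (t' - t).

Lemma bounded_lipschitzD f g : bounded_lipschitz f -> bounded_lipschitz g ->
  bounded_lipschitz (fun t => f t + g t).
Proof.
move=> [c c0 [c1 c2]] [d d0 [d1 d2]]; exists (c + d); first exact: addr_ge0.
split=> [t t0 tT|s t s0 st tT].
  by apply: le_trans (nmD _ _) _; rewrite lerD // ?c1 ?d1.
have -> : f t + g t - (f s + g s) = (f t - f s) + (g t - g s) by vring.
by apply: le_trans (nmD _ _) _; rewrite mulrDl lerD // ?c2 ?d2.
Qed.

Lemma bounded_lipschitzZ a f : scalar_bounded_lipschitz a -> bounded_lipschitz f ->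
  bounded_lipschitz (fun t => a t *: f t).
Proof.
move=> [c c0 [c1 c2]] [d d0 [d1 d2]]; exists (2 * c * d).
  by rewrite !mulr_ge0.
have cd := mulr_ge0 c0 d0; split=> [t t0 tT|s t s0 st tT].
  rewrite nmZ; have : `|a t| * nm (f t) <= c * d.
    by apply: ler_pM; rewrite ?nm_ge0 ?c1 ?d1.
  lra.
have -> : a t *: f t - a s *: f s = (a t - a s) *: f t + a s *: (f t - f s) by vring.
apply: le_trans (nmD _ _) _; rewrite !nmZ.
have t0 := le_trans s0 st; have sT := le_trans st tT.
have : `|a t - a s| * nm (f t) <= c * (t - s) * d.
  by apply: ler_pM; rewrite ?nm_ge0 ?c2 ?d1.
have : `|a s| * nm (f t - f s) <= c * (d * (t - s)).
  by apply: ler_pM; rewrite ?nm_ge0 ?c1 ?d2.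
lra.
Qed.

Lemma scalar_bounded_lipschitzM a b : scalar_bounded_lipschitz a ->
  scalar_bounded_lipschitz b -> scalar_bounded_lipschitz (fun t => a t * b t).
Proof.
move=> [c c0 [c1 c2]] [d d0 [d1 d2]]; exists (2 * c * d).
  by rewrite !mulr_ge0.
have cd := mulr_ge0 c0 d0; split=> [t t0 tT|s t s0 st tT].
  rewrite normrM; have : `|a t| * `|b t| <= c * d.
    by apply: ler_pM; rewrite ?c1 ?d1.
  lra.
have -> : a t * b t - a s * b s = (a t - a s) * b t + a s * (b t - b s) by ring.
apply: le_trans (ler_normD _ _) _; rewrite !normrM.
have t0 := le_trans s0 st; have sT := le_trans st tT.
have : `|a t - a s| * `|b t| <= c * (t - s) * d.
  by apply: ler_pM; rewrite ?c2 ?d1.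
have : `|a s| * `|b t - b s| <= c * (d * (t - s)).
  by apply: ler_pM; rewrite ?c1 ?d2.
lra.
Qed.

Lemma scalar_bounded_lipschitzDl (k : R) a : scalar_bounded_lipschitz a ->
  scalar_bounded_lipschitz (fun t => k + a t).
Proof.
move=> [c c0 [c1 c2]]; exists (`|k| + c); first by rewrite addr_ge0.
split=> [t t0 tT|s t s0 st tT].
  by apply: le_trans (ler_normD _ _) _; rewrite lerD2l c1.
have -> : k + a t - (k + a s) = a t - a s by ring.
by apply: le_trans (c2 s t s0 st tT) _; rewrite ler_wpM2r ?subr_ge0 // lerDr.
Qed.

Lemma scalar_bounded_lipschitzV a (m : R) : 0 < m ->
  (forall t, 0 <= t -> t <= T -> m <= a t) ->
  scalar_bounded_lipschitz a -> scalar_bounded_lipschitz (fun t => (a t)^-1).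
Proof.
move=> m0 am [c c0 [c1 c2]].
have a0 t : 0 <= t -> t <= T -> 0 < a t by move=> t0 tT; apply: lt_le_trans (am t t0 tT).
exists (m^-1 + c * (m^-1 * m^-1)).
  by rewrite addr_ge0 ?mulr_ge0 ?invr_ge0 // ltW.
have k0 : 0 <= c * (m^-1 * m^-1) by rewrite !mulr_ge0 ?invr_ge0 // ltW.
have mV : 0 <= m^-1 by rewrite invr_ge0 ltW.
have aV t : 0 <= t -> t <= T -> 0 <= (a t)^-1 /\ (a t)^-1 <= m^-1.
  by move=> t0 tT; rewrite invr_ge0 ltW ?a0 // lef_pV2 ?posrE ?a0 // am.
split=> [t t0 tT|s t s0 st tT].
  by have [h1 h2] := aV t t0 tT; rewrite ger0_norm //; lra.
have t0 := le_trans s0 st; have sT := le_trans st tT.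
have -> : (a t)^-1 - (a s)^-1 = - (a t - a s) * ((a t)^-1 * (a s)^-1).
  by field; rewrite !gt_eqF ?a0.
rewrite normrM normrN; have [h1 h2] := aV t t0 tT; have [h3 h4] := aV s s0 sT.
have : `|a t - a s| * `|(a t)^-1 * (a s)^-1| <= c * (t - s) * (m^-1 * m^-1).
  apply: ler_pM => //; first exact: c2.
  by rewrite ger0_norm ?mulr_ge0 //; apply: ler_pM.
have : 0 <= m^-1 * (t - s) by rewrite mulr_ge0 // subr_ge0.
lra.
Qed.

Lemma right_derivativeD f g t v w : right_derivative f t v ->
  right_derivative g t w -> right_derivative (fun t => f t + g t) t (v + w).
Proof.
move=> hf hg e e0; have e20 : 0 < e / 2 by rewrite divr_gt0.
have [d1 d10 d1P] := hf _ e20; have [d2 d20 d2P] := hg _ e20.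
have [d [d0 dd1 dd2]] := pos_below2 d10 d20; exists d => // t' tt' t'd t'T.
have h1 : nm (f t' - f t - (t' - t) *: v) <= e / 2 * (t' - t) by apply: d1P => //; lra.
have h2 : nm (g t' - g t - (t' - t) *: w) <= e / 2 * (t' - t) by apply: d2P => //; lra.
have -> : f t' + g t' - (f t + g t) - (t' - t) *: (v + w) =
  (f t' - f t - (t' - t) *: v) + (g t' - g t - (t' - t) *: w) by vring.
apply: le_trans (nmD _ _) _; lra.
Qed.

Lemma right_derivative_local f t v : right_derivative f t v ->
  exists2 d : R, 0 < d & forall t', t <= t' -> t' < t + d -> t' < T ->
  nm (f t' - f t) <= (nm v + 1) * (t' - t).
Proof.
move=> /(_ 1 ltr01)[d d0 dP]; exists d => // t' tt' t'd t'T.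
have := dP t' tt' t'd t'T; have := nmD (f t' - f t - (t' - t) *: v) ((t' - t) *: v).
by rewrite subrK nmZ ger0_norm ?subr_ge0 //; lra.
Qed.

Lemma right_derivativeZ a b f t v : scalar_right_derivative a t b ->
  right_derivative f t v ->
  right_derivative (fun t => a t *: f t) t (b *: f t + a t *: v).
Proof.
move=> ha hf e e0; pose C := nm (f t) + nm v + 1 + `|b| * (nm v + 1) + `|a t|.
have n1 := nm_ge0 (f t); have n2 := nm_ge0 v.
have n3 : 0 <= `|b| * (nm v + 1) by rewrite mulr_ge0 //; lra.
have n4 := normr_ge0 (a t); have C0 : 0 < C by rewrite /C; lra.
have e1 : 0 < e / C by rewrite divr_gt0.
move: (e / C) e1 (divfK (lt0r_neq0 C0) e) => e1 e10 eE.
have [d1 d10 d1P] := ha _ e10; have [d2 d20 d2P] := hf _ e10.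
have [d3 d30 d3P] := right_derivative_local hf.
have [d' [d'0 dd1 dd2 dd3]] := pos_below3 d10 d20 d30.
have [d [d0 dd' de d11]] := pos_below3 d'0 e10 (@ltr01 R); exists d => // t' tt' t'd t'T.
have tau0 : 0 <= t' - t by move: tt'; goal_lra.
have h1 : `|a t' - a t - (t' - t) * b| <= e1 * (t' - t) by apply: d1P => //;
  move: dd1 dd' t'd; goal_lra.
have h2 : nm (f t' - f t - (t' - t) *: v) <= e1 * (t' - t) by apply: d2P => //;
  move: dd2 dd' t'd; goal_lra.
have h3 : nm (f t' - f t) <= (nm v + 1) * (t' - t) by apply: d3P => //;
  move: dd3 dd' t'd; goal_lra.
have -> : a t' *: f t' - a t *: f t - (t' - t) *: (b *: f t + a t *: v) =
  (a t' - a t - (t' - t) * b) *: f t' + (((t' - t) * b) *: (f t' - f t) +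
  a t *: (f t' - f t - (t' - t) *: v)) by vring.
apply: le_trans (nmD _ _) _.
have := nmD (((t' - t) * b) *: (f t' - f t)) (a t *: (f t' - f t - (t' - t) *: v)).
rewrite !nmZ normrM (ger0_norm tau0).
have h4 : (nm v + 1) * (t' - t) <= (nm v + 1) * 1 by rewrite ler_wpM2l //;
  move: n2 d11 t'd; goal_lra.
have h5 : nm (f t') <= nm (f t) + nm v + 1.
  by have := nmD (f t' - f t) (f t); rewrite subrK; move: h3 h4; goal_lra.
have g1 : `|a t' - a t - (t' - t) * b| * nm (f t') <= e1 * (t' - t) * (nm (f t) + nm v + 1).
  by apply: ler_pM => //; exact: nm_ge0.
have g2 : (t' - t) * `|b| * nm (f t' - f t) <= (t' - t) * `|b| * ((nm v + 1) * e1).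
  rewrite ler_wpM2l ?mulr_ge0 //; apply: le_trans h3 _; rewrite ler_wpM2l //; lra.
have g3 : `|a t| * nm (f t' - f t - (t' - t) *: v) <= `|a t| * (e1 * (t' - t)).
  by rewrite ler_wpM2l.
rewrite -eE /C; move: g1 g2 g3; goal_lra.
Qed.

Lemma scalar_right_derivativeV a t (b m : R) : 0 <= t -> 0 < m ->
  (forall s, 0 <= s -> s <= T -> m <= a s) -> t < T ->
  scalar_right_derivative a t b ->
  scalar_right_derivative (fun t => (a t)^-1) t (- b * (a t)^-1 ^+ 2).
Proof.
move=> t0 m0 am tT ha e e0; have at_ := am t t0 (ltW tT).
have a0 : 0 < a t by exact: lt_le_trans at_.
pose k := m^-1 * (a t)^-1 ^+ 2; have k0 : 0 <= k.
  by rewrite mulr_ge0 ?exprn_ge0 ?invr_ge0 // ltW.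
pose C := k * (a t + `|b| * (`|b| + 1)) + 1.
have n1 : 0 <= `|b| * (`|b| + 1) by rewrite mulr_ge0 // addr_ge0.
have n2 : 0 <= k * (a t + `|b| * (`|b| + 1)) by rewrite mulr_ge0 // addr_ge0 // ltW.
have C0 : 0 < C by rewrite /C; lra.
have e1 : 0 < e / C by rewrite divr_gt0.
move: (e / C) e1 (divfK (lt0r_neq0 C0) e) => e1 e10 eE.
have [e2 [e20 e21 e2e]] := pos_below2 (@ltr01 R) e10.
have [d1 d10 d1P] := ha _ e20; have [d [d0 dd1 de]] := pos_below2 d10 e10.
exists d => // t' tt' t'd t'T.
have at' : m <= a t' by apply: am; move: t0 tt' t'T; goal_lra.
have a0' : 0 < a t' by exact: lt_le_trans at'.
have tau0 : 0 <= t' - t by move: tt'; goal_lra.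
have h1 : `|a t' - a t - (t' - t) * b| <= e2 * (t' - t) by apply: d1P => //;
  move: dd1 t'd; goal_lra.
have h2 : `|a t' - a t| <= (`|b| + 1) * (t' - t).
  have := ler_normD (a t' - a t - (t' - t) * b) ((t' - t) * b).
  rewrite subrK normrM (ger0_norm tau0).
  have : e2 * (t' - t) <= 1 * (t' - t) by rewrite ler_wpM2r.
  move: h1; goal_lra.
have -> : (a t')^-1 - (a t)^-1 - (t' - t) * (- b * (a t)^-1 ^+ 2) =
  (- ((a t' - a t - (t' - t) * b) * a t) + (t' - t) * b * (a t' - a t)) *
  ((a t')^-1 * (a t)^-1 ^+ 2) by field; rewrite !gt_eqF.
rewrite normrM [X in _ * X]ger0_norm ?mulr_ge0 ?exprn_ge0 ?invr_ge0 ?(ltW a0) ?(ltW a0') //.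
have h3 : (a t')^-1 * (a t)^-1 ^+ 2 <= k.
  by rewrite ler_wpM2r ?exprn_ge0 ?invr_ge0 ?(ltW a0) // lef_pV2 ?posrE.
have h4 : `|- ((a t' - a t - (t' - t) * b) * a t) + (t' - t) * b * (a t' - a t)| <=
  e1 * (t' - t) * (a t + `|b| * (`|b| + 1)).
  apply: le_trans (ler_normD _ _) _; rewrite normrN !normrM (ger0_norm tau0) (gtr0_norm a0).
  have g1 : `|a t' - a t - (t' - t) * b| * a t <= e1 * (t' - t) * a t.
    rewrite ler_wpM2r ?(ltW a0) //; apply: le_trans h1 _; rewrite ler_wpM2r //.
  have g2 : (t' - t) * `|b| * `|a t' - a t| <= (t' - t) * `|b| * ((`|b| + 1) * e1).
    rewrite ler_wpM2l ?mulr_ge0 //; apply: le_trans h2 _; rewrite ler_wpM2l ?addr_ge0 //; lra.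
  move: g1 g2; goal_lra.
have h5 : e1 * (t' - t) * (a t + `|b| * (`|b| + 1)) * k <= e * (t' - t).
  rewrite -eE /C; have := mulr_ge0 (ltW e10) tau0; goal_lra.
apply: le_trans h5; apply: ler_pM => //.
by rewrite mulr_ge0 ?exprn_ge0 ?invr_ge0 ?(ltW a0) ?(ltW a0').
Qed.

Lemma c11_bounded_lipschitz (q q' : R -> H) (M : R) : 0 <= M -> 0 <= T ->
  (forall s t, 0 <= s -> s <= t -> nm (q t - q s - (t - s) *: q' s) <= M * (t - s) ^+ 2) ->
  (forall s t, 0 <= s -> s <= t -> nm (q' t - q' s) <= M * (t - s)) ->
  [/\ bounded_lipschitz q, bounded_lipschitz q' &
      forall t, 0 <= t -> right_derivative q t (q' t)].
Proof.
move=> M0 T0 qT qL; have q'b t : 0 <= t -> t <= T -> nm (q' t) <= nm (q' 0) + M * T.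
  move=> t0 tT; have := qL 0 t (lexx _) t0; have := nmD (q' t - q' 0) (q' 0).
  have : M * t <= M * T by rewrite ler_wpM2l.
  by rewrite subrK subr0; lra.
have MT := mulr_ge0 M0 T0; have n0 := nm_ge0 (q' 0).
pose C := nm (q' 0) + M * T + M * T.
have C0 : 0 <= C by rewrite /C; lra.
have qlip s t : 0 <= s -> s <= t -> t <= T -> nm (q t - q s) <= C * (t - s).
  move=> s0 st tT; have h := qT s t s0 st.
  have := nmD (q t - q s - (t - s) *: q' s) ((t - s) *: q' s).
  rewrite subrK nmZ ger0_norm ?subr_ge0 // => h2.
  have h3 : (t - s) * nm (q' s) <= (t - s) * (nm (q' 0) + M * T).
    by rewrite ler_wpM2l ?subr_ge0 // q'b //; lra.
  have h4 : M * (t - s) ^+ 2 <= M * T * (t - s).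
    by rewrite -mulrA ler_wpM2l // -[_ ^+ 2]/(_ * _) ler_wpM2r ?subr_ge0 //; lra.
  rewrite /C; lra.
split.
- exists (nm (q 0) + C + C * T); first by rewrite !addr_ge0 ?nm_ge0 ?mulr_ge0.
  split=> [t t0 tT|s t s0 st tT].
    have := qlip 0 t (lexx _) t0 tT; have := nmD (q t - q 0) (q 0).
    have : C * t <= C * T by rewrite ler_wpM2l.
    by rewrite subrK subr0; lra.
  apply: le_trans (qlip s t s0 st tT) _; rewrite ler_wpM2r ?subr_ge0 //.
  by have := nm_ge0 (q 0); have := mulr_ge0 C0 T0; lra.
- exists (nm (q' 0) + M * T + M); first by lra.
  split=> [t t0 tT|s t s0 st tT]; first by have := q'b t t0 tT; lra.
  by apply: le_trans (qL s t s0 st) _; rewrite ler_wpM2r ?subr_ge0 //; lra.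
move=> t t0 e e0; have M1 : 0 < M + 1 by lra.
exists (e / (M + 1)); first by rewrite divr_gt0.
move=> t' tt' t'd _; apply: le_trans (qT t t' t0 tt') _.
rewrite -[_ ^+ 2]/(_ * _) mulrA ler_wpM2r ?subr_ge0 //.
have : t' - t < e / (M + 1) by lra.
rewrite ltr_pdivlMr //; have : 0 <= t' - t by lra.
lra.
Qed.

End Calculus.

Section MovingFrame.
Context {R : realType} {X D U : rhilbert R}.
Variables (i A : {linear D -> X}) (B C : {linear D -> U}).
Variables (ci cA cB cC alpha beta : R).
Hypothesis i_inj : injective i.
Hypothesis ib : forall x, nm (i x) <= ci * nm x.
Hypothesis Ab : forall x, nm (A x) <= cA * nm x.
Hypothesis Bb : forall x, nm (B x) <= cB * nm x.
Hypothesis Cb : forall x, nm (C x) <= cC * nm x.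
Hypothesis S1 : forall x,
  dot (A x) (i x) <= dot (B x) (C x) + alpha * nm (i x) ^+ 2.
Hypothesis ab : alpha <= beta.
Hypothesis S2 : forall z, exists x, C x = 0 /\ A x - beta *: i x = z.
Hypothesis S3 : forall v w, exists x, B x = v /\ C x = w.
Local Notation mu := (@lebesgue_measure R).

Variables (T m : R) (l l1 : R -> D) (ph ph1 : R -> R).
Hypothesis T0 : 0 < T.
Hypothesis m0 : 0 < m.
Hypothesis phm : forall t, 0 <= t -> t <= T -> m <= ph t.

Local Notation dom := (closed_loop_dom B C).

Lemma linear_bounded_lipschitz (L : {linear D -> X}) (c : R) (f : R -> D) :
  (forall x, nm (L x) <= c * nm x) -> bounded_lipschitz T f ->
  bounded_lipschitz T (fun t => L (f t)).
Proof.
move=> Lc [k k0 [k1 k2]]; have Lc' x : nm (L x) <= `|c| * nm x.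
  by apply: le_trans (Lc x) _; rewrite ler_wpM2r ?nm_ge0 // ler_norm.
exists (`|c| * k); first by rewrite mulr_ge0.
split=> [t t0 tT|s t s0 st tT].
  by apply: le_trans (Lc' _) _; rewrite ler_wpM2l // k1.
by rewrite -linearB -mulrA; apply: le_trans (Lc' _) _; rewrite ler_wpM2l // k2.
Qed.

Lemma linear_right_derivative (L : {linear D -> X}) (c : R) (f : R -> D) t v :
  (forall x, nm (L x) <= c * nm x) -> right_derivative T f t v ->
  right_derivative T (fun t => L (f t)) t (L v).
Proof.
move=> Lc hf e e0; have c1 : 0 < `|c| + 1 by have := normr_ge0 c; lra.
have e1 : 0 < e / (`|c| + 1) by rewrite divr_gt0.
have [d d0 dP] := hf _ e1; exists d => // t' tt' t'd t'T.
have := dP t' tt' t'd t'T; move: (e / (`|c| + 1)) e1 (divfK (lt0r_neq0 c1) e) => e1 e10 eE.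
have <- : L (f t' - f t - (t' - t) *: v) = L (f t') - L (f t) - (t' - t) *: L v.
  by rewrite linearB /= linearB /= linearZ.
move=> h; apply: le_trans (Lc _) _.
apply: (@le_trans _ _ ((`|c| + 1) * nm (f t' - f t - (t' - t) *: v))).
  by rewrite ler_wpM2r ?nm_ge0 //; have := ler_norm c; lra.
apply: (@le_trans _ _ ((`|c| + 1) * (e1 * (t' - t)))); first by rewrite ler_wpM2l // ltW.
by rewrite -eE; lra.
Qed.

(** In the coordinates [w = ph *: (x - l)] the feedback law does not depend on
    time, and the dynamics becomes an autonomous maximal monotone evolution with
    a Lipschitz perturbation. *)
Theorem closed_loop_existence (x0 : D) :
  bounded_lipschitz T l -> bounded_lipschitz T l1 ->
  (forall t, 0 <= t -> right_derivative T l t (l1 t)) ->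
  scalar_bounded_lipschitz T ph -> scalar_bounded_lipschitz T ph1 ->
  (forall t, 0 <= t -> scalar_right_derivative T ph t (ph1 t)) ->
  dom (ph 0 *: (x0 - l 0)) ->
  exists (x xd : R -> X) (xt : R -> D),
  [/\ x 0 = i x0, bounded_lipschitz T x,
      exists c : R, forall t, 0 <= t -> t <= T -> nm (xd t) <= c,
      (forall t, 0 <= t -> t < T -> right_derivative T x t (xd t)) &
      [/\ forall t, 0 <= t -> t < T -> forall e : R, 0 < e ->
        exists2 d : R, 0 < d & forall t', t <= t' -> t' < t + d -> t' < T ->
        nm (xd t' - xd t) < e,
      {ae mu, forall t, 0 < t < T -> forall e : R, 0 < e ->
        exists2 d : R, 0 < d & forall s, `|s - t| < d -> nm (xd s - xd t) < e} &
      forall t, 0 <= t -> t <= T ->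
        [/\ i (xt t) = x t, xd t = A (xt t) & dom (ph t *: (xt t - l t))]]].
Proof.
move=> lL l1L lD phL ph1L phD x0dom.
have T0' := T0; have m0' := m0.
have ph_gt0 t : 0 <= t -> t <= T -> 0 < ph t by move=> t0 tT; apply: lt_le_trans (phm t0 tT).
have phV := scalar_bounded_lipschitzV m0 phm phL.
have cstL k : scalar_bounded_lipschitz T (fun=> k).
  exists `|k| => //; split=> // s t s0 st _.
  by rewrite subrr normr0 mulr_ge0 ?subr_ge0.
pose g t := alpha + ph1 t * (ph t)^-1.
have gL : scalar_bounded_lipschitz T g.
  by apply: scalar_bounded_lipschitzDl; exact: scalar_bounded_lipschitzM.
pose b t := ph t *: (A (l t) + - 1 *: i (l1 t)).
have AlL := linear_bounded_lipschitz Ab lL.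
have bL : bounded_lipschitz T b.
  apply: bounded_lipschitzZ => //; apply: bounded_lipschitzD => //.
  apply: (bounded_lipschitzZ (cstL (- 1))).
  exact: linear_bounded_lipschitz ib l1L.
pose tau (t : R) := Num.max 0 (Num.min t T).
have tauI t : 0 <= tau t /\ tau t <= T.
  by have := clamp_itv T0 t; rewrite /= in_itv /= => /andP.
have tauE t : 0 <= t -> t <= T -> tau t = t.
  by move=> t0 tT; apply: clamp_id; rewrite /= in_itv /= t0.
have tauL s t : `|tau s - tau t| <= `|s - t| by exact: clamp_nonexpansive.
pose G t (x : X) := g (tau t) *: x + b (tau t).
have [kg kg0 [kg1 kg2]] := gL; have [kb kb0 [kb1 kb2]] := bL.
pose L := kg + kb; have L0 : 0 <= L by exact: addr_ge0.
have gtau s t : `|g (tau t) - g (tau s)| <= kg * `|t - s|.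
  apply: (@le_trans _ _ (kg * `|tau t - tau s|)); last by rewrite ler_wpM2l.
  have [s0 sT] := tauI s; have [t0 tT] := tauI t.
  have [st|/ltW ts] := leP (tau s) (tau t).
    by rewrite [X in _ <= kg * X]ger0_norm ?subr_ge0 // kg2.
  by rewrite distrC [X in _ <= kg * X]distrC [X in _ <= kg * X]ger0_norm ?subr_ge0 // kg2.
have btau s t : nm (b (tau t) - b (tau s)) <= kb * `|t - s|.
  apply: (@le_trans _ _ (kb * `|tau t - tau s|)); last by rewrite ler_wpM2l.
  have [s0 sT] := tauI s; have [t0 tT] := tauI t.
  have [st|/ltW ts] := leP (tau s) (tau t).
    by rewrite ger0_norm ?subr_ge0 // kb2.
  by rewrite nmBC distrC ger0_norm ?subr_ge0 // kb2.
have GL s t x y : nm (G t x - G s y) <= L * nm (x - y) + L * (1 + nm x) * `|t - s|.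
  have -> : G t x - G s y = g (tau s) *: (x - y) + ((g (tau t) - g (tau s)) *: x +
      (b (tau t) - b (tau s))) by rewrite /G; vring.
  apply: le_trans (nmD _ _) _.
  have := nmD ((g (tau t) - g (tau s)) *: x) (b (tau t) - b (tau s)); rewrite !nmZ.
  have [s0 sT] := tauI s.
  have h1 : `|g (tau s)| * nm (x - y) <= kg * nm (x - y) by rewrite ler_wpM2r ?nm_ge0 // kg1.
  have h2 : `|g (tau t) - g (tau s)| * nm x <= kg * `|t - s| * nm x.
    by rewrite ler_wpM2r ?nm_ge0.
  have h3 := btau s t.
  have h4 := mulr_ge0 kb0 (nm_ge0 (x - y)).
  have h5 := mulr_ge0 (mulr_ge0 kb0 (normr_ge0 (t - s))) (nm_ge0 x).
  have h6 := mulr_ge0 kg0 (normr_ge0 (t - s)).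
  rewrite /L; move: h1 h2 h3 h4 h5 h6; goal_lra.
have hM := closed_loop_maximal_monotone i_inj ib Ab Bb Cb S1 ab S2 S3.
pose w0 := ph 0 *: (x0 - l 0).
have Mw0 : closed_loop_graph i A B C alpha (i w0) (alpha *: i w0 - A w0) by exists w0.
have [u [v sol]] := strong_solution_exists hM L0 T0 Mw0 GL.
have /choice[w wP] : forall t, exists w, 0 <= t -> t <= T ->
    [/\ dom w, i w = u t & v t = alpha *: i w - A w].
  move=> t; have [/andP[t0 tT]|/negP tN] := boolP (0 <= t <= T).
    by have [w hw] := sol_val sol t0 tT; exists w.
  by exists 0 => t0 tT; case: tN; rewrite t0.
pose xt t := (ph t)^-1 *: w t + l t.
pose x t := (ph t)^-1 *: u t + i (l t).
pose xd t := (ph t)^-1 *: (alpha *: u t + - 1 *: v t) + A (l t).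
have [cu cuP] := sol_lip sol; have [cv cvP] := sol_bound sol.
have uL : bounded_lipschitz T u.
  have cu0 : 0 <= cu * T by have := cuP 0 T (lexx _) (ltW T0) (lexx _); rewrite subr0; apply: le_trans (nm_ge0 _).
  have cu1 : 0 <= cu by rewrite pmulr_lge0 in cu0.
  exists (nm (u 0) + cu * T + cu); first by rewrite !addr_ge0 ?nm_ge0.
  split=> [t t0 tT|s t s0 st tT].
    have := cuP 0 t (lexx _) t0 tT; have := nmD (u t - u 0) (u 0); rewrite subrK subr0.
    have : cu * t <= cu * T by rewrite ler_wpM2l.
    move: cu1; goal_lra.
  apply: le_trans (cuP s t s0 st tT) _; rewrite ler_wpM2r ?subr_ge0 //.
  by have := nm_ge0 (u 0); move: cu0; goal_lra.
have ilL := linear_bounded_lipschitz ib lL.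
have puL := bounded_lipschitzZ phV uL.
have [kp kp0 [kp1 kp2]] := phV.
have [kr kr0 [_ kr2]] := bounded_lipschitzD (bounded_lipschitzZ phV
  (bounded_lipschitzZ (cstL alpha) uL)) AlL.
have cv0 : 0 <= cv by apply: le_trans (nm_ge0 _) (cvP 0 (lexx _) (ltW T0)).
pose K := kr + kp * cv; have K0 : 0 <= K by rewrite addr_ge0 ?mulr_ge0.
have xd_dist s t : 0 <= s -> s <= T -> 0 <= t -> t <= T ->
    nm (xd s - xd t) <= K * `|s - t| + kp * nm (v s - v t).
  move=> s0 sT t0 tT.
  have h1 : nm ((ph s)^-1 *: (alpha *: u s) + A (l s) -
      ((ph t)^-1 *: (alpha *: u t) + A (l t))) <= kr * `|s - t|.
    have [st|/ltW ts] := leP t s; first by rewrite ger0_norm ?subr_ge0 // kr2.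
    by rewrite nmBC distrC ger0_norm ?subr_ge0 // kr2.
  have h2 : `|(ph s)^-1 - (ph t)^-1| <= kp * `|s - t|.
    have [st|/ltW ts] := leP t s.
      by rewrite [X in _ <= kp * X]ger0_norm ?subr_ge0 // kp2.
    by rewrite distrC [X in _ <= kp * X]distrC [X in _ <= kp * X]ger0_norm ?subr_ge0 // kp2.
  have -> : xd s - xd t = ((ph s)^-1 *: (alpha *: u s) + A (l s) -
      ((ph t)^-1 *: (alpha *: u t) + A (l t))) - ((ph s)^-1 *: (v s - v t) +
      ((ph s)^-1 - (ph t)^-1) *: v t) by rewrite /xd; vring.
  apply: le_trans (nmB _ _) _.
  have := nmD ((ph s)^-1 *: (v s - v t)) (((ph s)^-1 - (ph t)^-1) *: v t); rewrite !nmZ.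
  have h3 : `|(ph s)^-1| * nm (v s - v t) <= kp * nm (v s - v t).
    by rewrite ler_wpM2r ?nm_ge0 // kp1.
  have h4 : `|(ph s)^-1 - (ph t)^-1| * nm (v t) <= kp * `|s - t| * cv.
    by apply: ler_pM; rewrite ?nm_ge0 // cvP.
  rewrite /K; move: h1 h3 h4; goal_lra.
have small (e : R) : 0 < e -> exists2 e' : R, 0 < e' & (K + kp) * e' < e.
  move=> e0; have c1 : 0 < K + kp + 1 by move: kp0 K0; goal_lra.
  exists (e / (K + kp + 1)); first by rewrite divr_gt0.
  by rewrite mulrA ltr_pdivrMr // mulrC ltr_pM2l //; goal_lra.
exists x, xd, xt; split.
- rewrite /x (sol_init sol) /w0 linearZ /= scalerA mulVf; last by rewrite gt_eqF // ph_gt0 // ltW.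
  by rewrite scale1r linearB /= subrK.
- exact: (bounded_lipschitzD puL ilL).
- have [kA kA0 [kA1 _]] := AlL; have [ku ku0 [ku1 _]] := uL.
  exists (kp * (`|alpha| * ku + cv) + kA) => t t0 tT.
  apply: le_trans (nmD _ _) _; apply: lerD; last exact: kA1.
  rewrite nmZ; apply: ler_pM; rewrite ?nm_ge0 ?kp1 //.
  apply: le_trans (nmD _ _) _; apply: lerD; rewrite nmZ.
    by rewrite ler_wpM2l // ku1.
  by rewrite normrN normr1 mul1r; exact: cvP.
- move=> t t0 tT.
  have urd : right_derivative T u t (G t (u t) - v t).
    move=> e e0; have [d d0 dP] := sol_rder sol t0 tT e0.
    by exists d => // t' tt' t'd t'T; apply: dP => //; exact: ltW.
  have prd := scalar_right_derivativeV t0 m0 phm tT (phD t t0).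
  have := right_derivativeD (right_derivativeZ prd urd)
    (linear_right_derivative ib (lD t t0)).
  suff -> : (- ph1 t * (ph t)^-1 ^+ 2) *: u t + (ph t)^-1 *: (G t (u t) - v t) + i (l1 t) = xd t.
    by [].
  have p0 : ph t != 0 by rewrite gt_eqF // ph_gt0 // ltW.
  rewrite /G tauE ?(ltW tT) // /g /b /xd; move: (ph t) p0 => p p0.
  by vfield.
- split.
  + move=> t t0 tT e e0; have [e' e'0 e'e] := small e e0.
    have [d1 d10 d1P] := sol_rcont sol t0 tT e'0.
    have [d [d0 dd1 de]] := pos_below2 d10 e'0.
    exists d => // t' tt' t'd t'T.
    apply: le_lt_trans (xd_dist t' t (le_trans t0 tt') (ltW t'T) t0 (ltW tT)) _.
    have h1 : nm (v t' - v t) < e' by apply: d1P => //; move: dd1 t'd; goal_lra.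
    have h2 : K * `|t' - t| <= K * e'.
      by rewrite ler_wpM2l // ger0_norm ?subr_ge0 //; move: de t'd; goal_lra.
    have h3 : kp * nm (v t' - v t) <= kp * e' by rewrite ler_wpM2l // ltW.
    move: e'e h2 h3; goal_lra.
  + apply: ae_mono (sol_cont sol) => t hv tI e e0; have [e' e'0 e'e] := small e e0.
    have [d1 d10 d1P] := hv tI e' e'0; move: tI => /andP[t0 tT].
    have Tt : 0 < T - t by move: tT; goal_lra.
    have [d' [d'0 dt dT]] := pos_below2 t0 Tt.
    have [d [d0 dd1 de dd']] := pos_below3 d10 e'0 d'0.
    exists d => // s sd; have h1 : nm (v s - v t) < e' by apply: d1P; lra.
    have h2 : K * `|s - t| <= K * e' by rewrite ler_wpM2l //;
      move: de sd; goal_lra.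
    have h3 : kp * nm (v s - v t) <= kp * e' by rewrite ler_wpM2l // ltW.
    move: sd; rewrite ltr_norml => /andP[s1 s2].
    have s0 : 0 <= s by move: dt dd' s1; goal_lra.
    have sT : s <= T by move: dT dd' s2; goal_lra.
    by apply: le_lt_trans (xd_dist s t s0 sT (ltW t0) (ltW tT)) _;
      move: e'e h2 h3; goal_lra.
  + move=> t t0 tT; have [wd wu vE] := wP t t0 tT; split.
    * by rewrite /xt /x linearD linearZ /= wu.
    * have -> : A (xt t) = (ph t)^-1 *: A (w t) + A (l t) by rewrite /xt linearD /= linearZ.
      rewrite /xd vE -wu; congr (_ *: _ + _); vring.
    * have p0 : ph t != 0 by rewrite gt_eqF // ph_gt0.
      by rewrite /xt addrK scalerA divff // scale1r.
Qed.

(** The feedback law is monotone, so that the distance of two solutions grows at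
    most exponentially. *)
Theorem closed_loop_uniqueness (x z : R -> X) (N : set R) (c : R) :
  mu.-negligible N -> x 0 = z 0 ->
  (forall s t, 0 <= s -> s <= t -> t <= T -> nm (x t - x s) <= c * (t - s)) ->
  (forall s t, 0 <= s -> s <= t -> t <= T -> nm (z t - z s) <= c * (t - s)) ->
  (forall t, 0 < t -> t < T -> ~ N t -> exists xt zt : D,
    [/\ i xt = x t, i zt = z t, right_derivative T x t (A xt), right_derivative T z t (A zt) &
        dom (ph t *: (xt - l t)) /\ dom (ph t *: (zt - l t))]) ->
  forall t, 0 <= t -> t <= T -> z t = x t.
Proof.
move=> N0 xz0 xL zL sol.
pose r t := nm (x t - z t) ^+ 2; pose dd t := x t - z t.
have T0' := T0; have m0' := m0.
have c0 : 0 <= c.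
  have := xL 0 T (lexx _) (ltW T0) (lexx _); rewrite subr0 => /(le_trans (nm_ge0 _)).
  by rewrite pmulr_lge0.
have ddL s t : 0 <= s -> s <= t -> t <= T -> nm (dd t - dd s) <= 2 * c * (t - s).
  move=> s0 st tT; have -> : dd t - dd s = (x t - x s) - (z t - z s) by rewrite /dd; vring.
  apply: le_trans (nmB _ _) _; have := xL s t s0 st tT; have := zL s t s0 st tT; lra.
have dd0 : dd 0 = 0 by rewrite /dd xz0 subrr.
have ddB t : 0 <= t -> t <= T -> nm (dd t) <= 2 * c * T.
  move=> t0 tT; have := ddL 0 t (lexx _) t0 tT; rewrite dd0 !subr0 => /le_trans; apply.
  by rewrite ler_wpM2l // mulr_ge0.
have cT : 0 <= c * T by rewrite mulr_ge0 // ltW.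
have rE s t : r t - r s = 2 * dot (dd s) (dd t - dd s) + nm (dd t - dd s) ^+ 2.
  rewrite /r -/(dd t) -/(dd s) !sqr_nm; move: (dd t) (dd s) => p q; rewrite !(dotDl, dotDr, dotNl, dotNr) (dotC q p); ring.
move=> t t0 tT; suff : r t = 0.
  by rewrite /r => /eqP; rewrite sqrf_eq0 => /eqP/nm_eq0/eqP; rewrite subr_eq0 => /eqP.
have N1 : mu.-negligible (N `|` [set 0]).
  apply: negligibleU => //; exact: negligible_point.
pose L := 2 * (2 * c * T) * (2 * c) + (2 * c) * (2 * c * T).
apply: (@gronwall_ae R r t L (2 * `|alpha|) (N `|` [set 0])) => //.
- by move=> s _ _; rewrite sqr_ge0.
- by rewrite /r -/(dd 0) dd0 nm0 expr0n.
- move=> s s' s0 ss' s'T; rewrite rE; apply: le_trans (ler_normD _ _) _.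
  have s'T' : s' <= T by lra.
  have sT : s <= T by lra.
  have h1 := ddL s s' s0 ss' s'T'; have h2 := ddB s s0 sT.
  have h3 : `|2 * dot (dd s) (dd s' - dd s)| <= 2 * (2 * c * T * (2 * c * (s' - s))).
    rewrite normrM ger0_norm // ler_wpM2l //; apply: le_trans (dot_abs _ _) _.
    by apply: ler_pM; rewrite ?nm_ge0.
  have h4 : nm (dd s' - dd s) ^+ 2 <= 2 * c * (s' - s) * (2 * c * T).
    rewrite -[_ ^+ 2]/(_ * _); apply: ler_pM; rewrite ?nm_ge0 //.
    by apply: le_trans h1 _; rewrite ler_wpM2l ?mulr_ge0 //; lra.
  by rewrite (ger0_norm (sqr_ge0 _)) /L; move: h3 h4; goal_lra.
move=> s s0 sT nN e e0.
have s_gt0 : 0 < s.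
  by rewrite lt_neqAle s0 andbT eq_sym; apply/eqP => s00; apply: nN; right.
have sT' : s < T by lra.
have [xt [zt [xtE ztE xD zD [d1 d2]]]] := sol s s_gt0 sT' (fun h => nN (or_introl h)).
have key : dot (A (xt - zt)) (i (xt - zt)) <= alpha * nm (dd s) ^+ 2.
  have := closed_loop_dissipative S1 d1 d2.
  have -> : ph s *: (xt - l s) - ph s *: (zt - l s) = ph s *: (xt - zt) by vring.
  rewrite !linearZ /= dotZl dotZr nmZ exprMn real_normK ?num_real //.
  have p0 : 0 < ph s by apply: lt_le_trans (phm _ _) => //; lra.
  have iE : i (xt - zt) = dd s by rewrite linearB /= xtE ztE.
  rewrite iE => h; have p2 : 0 < ph s ^+ 2 by rewrite exprn_gt0.
  by rewrite -(ler_pM2l p2); move: h; rewrite -[X in X * dot _ _ <= _]/(ph s * ph s); lra.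
pose K := 8 * (c * T) + 4 * c ^+ 2; have K0 : 0 <= K.
  by rewrite addr_ge0 // mulr_ge0 // sqr_ge0.
have K1 : 0 < K + 1 by move: K0; goal_lra.
have e1 : 0 < e / (K + 1) by rewrite divr_gt0.
move: (e / (K + 1)) e1 (divfK (lt0r_neq0 K1) e) => e1 e10 eE.
have [dx dx0 dxP] := xD _ e10; have [dz dz0 dzP] := zD _ e10.
have Ts : 0 < T - s by move: sT'; goal_lra.
have [d' [d'0 dd1 dd2]] := pos_below2 dx0 dz0.
have [d [d0 dd' de dT]] := pos_below3 d'0 e10 Ts.
exists d => // s' ss' s'd s't.
have h1 : nm (x s' - x s - (s' - s) *: A xt) <= e1 * (s' - s) by apply: dxP => //;
  move: dd1 dd' dT s'd; goal_lra.
have h2 : nm (z s' - z s - (s' - s) *: A zt) <= e1 * (s' - s) by apply: dzP => //;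
  move: dd2 dd' dT s'd; goal_lra.
have s'T : s' <= T by move: dT s'd; goal_lra.
have h3 := ddL s s' s0 ss' s'T; have h4 := ddB s s0 (ltW sT').
have tau0 : 0 <= s' - s by move: ss'; goal_lra.
pose err := (x s' - x s - (s' - s) *: A xt) - (z s' - z s - (s' - s) *: A zt).
have errE : dd s' - dd s = (s' - s) *: A (xt - zt) + err.
  have -> : A (xt - zt) = A xt - A zt by rewrite linearB.
  by rewrite /err /dd; vring.
have h5 : nm err <= 2 * (e1 * (s' - s)) by apply: le_trans (nmB _ _) _;
  move: h1 h2; goal_lra.
have h6 : nm (dd s' - dd s) ^+ 2 <= 2 * c * (s' - s) * (2 * c * e1).
  rewrite -[_ ^+ 2]/(_ * _); apply: ler_pM; rewrite ?nm_ge0 //.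
  by apply: le_trans h3 _; rewrite ler_wpM2l ?mulr_ge0 //; lra.
have h7 : dot (dd s) err <= 2 * c * T * (2 * (e1 * (s' - s))).
  by apply: le_trans (dot_le _ _) _; apply: ler_pM; rewrite ?nm_ge0.
have iE : i (xt - zt) = dd s by rewrite raddfB /= xtE ztE.
have h8 : dot (dd s) (A (xt - zt)) <= `|alpha| * r s.
  rewrite dotC -{1}iE; apply: le_trans key _.
  by rewrite ler_wpM2r ?sqr_ge0 // ler_norm.
have h9 := ler_wpM2l tau0 h8.
rewrite rE {1}errE dotDr dotZr -eE.
have : e1 * K * (s' - s) <= e1 * (K + 1) * (s' - s).
  by rewrite ler_wpM2r // ler_wpM2l ?(ltW e10) //; goal_lra.
rewrite /K; move: h6 h7 h9; goal_lra.
Qed.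

End MovingFrame.

(** * The closed-loop system *)

Section RealLine.
Variable R : realType.
Implicit Types x y z : R^o.

Lemma real_line_sqrt x : Num.sqrt (x * x) = rnorm (@RealScalars R) x.
Proof. by rewrite -[x * x]/(x ^+ 2) sqrtr_sqr. Qed.

Lemma real_line_eq0 x : x * x = 0 -> x = 0.
Proof. by move=> /eqP; rewrite mulf_eq0 orbb => /eqP. Qed.

Lemma real_line_complete (u : nat -> R^o) :
  vcauchy (fun x : R^o => Num.sqrt (x * x)) u ->
  exists l, vcvg (fun x : R^o => Num.sqrt (x * x)) u l.
Proof.
have -> : (fun x : R^o => Num.sqrt (x * x)) = @rnorm R R (@RealScalars R) R^o.
  by apply/funext => x; exact: real_line_sqrt.
exact: rnorm_complete.
Qed.

Definition real_line : rhilbert R :=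
  @RHilbert R R^o (fun x y => x * y) (@mulrC R) (fun x y z => mulrDl x y z)
    (fun a x y => esym (mulrA a x y)) (fun x => sqr_ge0 x)
    real_line_eq0 real_line_complete.

Lemma nm_real_line (x : real_line) : nm x = `|x : R|.
Proof. exact: real_line_sqrt. Qed.

Lemma real_line_operator :
  real_operator (@RealScalars R) (fun x : R^o => x : real_line).
Proof.
split=> //; exists 1; first exact: ler01.
by move=> x; rewrite mul1r nm_real_line.
Qed.

End RealLine.

Lemma linear_coordinates {R : realType} {V W : rhilbert R} (L : {linear V -> W})
    (a : R) x y z : L (a *: (x - (y + z))) = a *: (L x - (L y + L z)).
Proof.
by rewrite linearZ; congr (_ *: _); rewrite linearB; congr (_ - _); rewrite linearD.
Qed.

Section ClosedLoop.
Context {R : realType} {K : numFieldType} {F : scalar_field R K}.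
Context {X D U : hilbert F} (S : bcs X D U).
Local Notation mu := (@lebesgue_measure R).
Local Notation i := (realify_lin (emb S)).
Local Notation A := (realify_lin (opA S)).
Local Notation B := (realify_lin (opB S)).
Local Notation C := (realify_lin (opC S)).

Lemma realify_bound {Y Z : hilbert F} (f : {linear Y -> Z}) : bounded_op F f ->
  exists c : R, forall x, nm (realify_lin f x) <= c * nm x.
Proof. by move=> [c hc]; exists c => x; rewrite !nm_realify; exact: hc. Qed.

Variables (yref : R -> U) (p : R -> K) (phi : R -> R) (x0 : D).
Variables (P : {linear realify U -> realify D}) (q0 : D).
Hypothesis BP : forall w, B (P w) = 0.
Hypothesis CP : forall w, C (P w) = w.
Let e0 := opC S x0 - yref 0.
Let b0 := opB S x0 + psi (phi 0) e0.
Hypothesis Bq0 : opB S q0 = b0.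
Hypothesis Cq0 : opC S q0 = 0.
Hypothesis phi0_gt0 : 0 < phi 0.
Hypothesis e0_lt1 : phi 0 * rnorm F e0 < 1.

(** A state with the reference signal as output and with the feedforward term
    as input. *)
Definition reference_lift (t : R) : realify D := P (yref t) + (p t *: q0 : D).

Local Notation dom := (closed_loop_dom B C).

(** The gain enters the feedback only through the scaled error [a *: e]. *)
Lemma psi_funnel (a : R) (e : U) :
  (a *: (psi a e : realify U) : realify U) = funnel (a *: (e : realify U)).
Proof.
rewrite /funnel nmZ exprMn real_normK ?num_real // nm_realify.
have -> : psi a e = ((1 - a ^+ 2 * rnorm F e ^+ 2)^-1 *: (e : realify U) : realify U).
  by rewrite /psi div1r.
by rewrite !scalerA mulrC.
Qed.

Lemma output_coordinates t (xt : D) :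
  C (phi t *: ((xt : realify D) - reference_lift t)) =
  phi t *: ((opC S xt - yref t : U) : realify U).
Proof.
apply: (etrans (linear_coordinates C _ _ _ _)).
have h1 : C (P (yref t)) = yref t by exact: CP.
have h2 : C (p t *: q0 : D) = 0 by rewrite /realify_lin linearZ /= Cq0 scaler0.
apply: (etrans (congr2 (fun a b => phi t *: ((opC S xt : realify U) - (a + b))) h1 h2)).
by rewrite addr0.
Qed.

Lemma input_coordinates t (xt : D) :
  B (phi t *: ((xt : realify D) - reference_lift t)) =
  phi t *: ((opB S xt - p t *: b0 : U) : realify U).
Proof.
apply: (etrans (linear_coordinates B _ _ _ _)).
have h1 : B (P (yref t)) = 0 by exact: BP.
have h2 : B (p t *: q0 : D) = (p t *: b0 : U) by rewrite /realify_lin linearZ /= Bq0.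
apply: (etrans (congr2 (fun a b => phi t *: ((opB S xt : realify U) - (a + b))) h1 h2)).
by rewrite add0r.
Qed.

Lemma closed_loop_atP t (xt : D) (dxt : X) : 0 < phi t ->
  closed_loop_at S yref p phi x0 t xt dxt <->
  dxt = opA S xt /\ dom (phi t *: ((xt : realify D) - reference_lift t)).
Proof.
move=> pt; have n1 : nm (C (phi t *: ((xt : realify D) - reference_lift t))) =
    phi t * rnorm F (opC S xt - yref t).
  by rewrite output_coordinates nmZ gtr0_norm // nm_realify.
have oE := output_coordinates t xt; have iE := input_coordinates t xt.
have fE : - funnel (phi t *: ((opC S xt - yref t : U) : realify U)) =
    phi t *: ((- psi (phi t) (opC S xt - yref t) : U) : realify U).
  by rewrite -psi_funnel -scalerN.
split.
  move=> [u [y [e [-> Bu Cy eE [_ [_ /= h] uE]]]]]; split=> //; split.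
    by rewrite n1 Cy -eE.
  apply: (etrans iE); apply/esym.
  apply: (etrans (congr1 (fun v => - funnel v) oE)); apply: (etrans fE).
  apply: (congr1 (fun v : realify U => phi t *: v)).
  by rewrite Bu uE Cy -eE /b0 -/e0 addrAC subrr add0r.
move=> [-> [h1 h2]]; exists (opB S xt), (opC S xt), (opC S xt - yref t).
rewrite n1 in h1; split=> //; split=> //.
have := etrans (esym iE) (etrans h2 (etrans (congr1 (fun v => - funnel v) oE) fE)).
move=> /(congr1 (fun v => (phi t)^-1 *: v)); rewrite !scalerA mulVf ?gt_eqF // !scale1r => h.
rewrite -/e0 -/b0; have : opB S xt - p t *: b0 = - psi (phi t) (opC S xt - yref t) by [].
by move=> /eqP; rewrite subr_eq addrC => /eqP.
Qed.

End ClosedLoop.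

Section Regularity.
Context {R : realType} {K : numFieldType} {F : scalar_field R K}.
Context {D : hilbert F}.
Local Notation halfline := (`[0, +oo[%classic : set R).
Variable T : R.
Hypothesis T0 : 0 <= T.

Lemma scale_operator (q0 : D) :
  real_operator F (fun k : K^o => (k *: q0 : realify D)).
Proof.
split=> [x y|a x|]; [exact: (scalerDl q0 x y)|exact: esym (scalerA (ofR F a) x q0)|].
exists (rnorm F q0); first exact: rnorm_ge0.
by move=> k; rewrite nm_realify rnormZ mulrC.
Qed.

Lemma linear_operator {U : hilbert F} (P : {linear realify U -> realify D}) (c : R) :
  0 <= c -> (forall w, nm (P w) <= c * nm w) ->
  real_operator F (fun y : U => P y).
Proof.
move=> c0 hc; split=> [x y|a x|]; [exact: (linearD P)|exact: linearZ|].
by exists c => // x; rewrite -nm_realify.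
Qed.

Lemma funnel_class_regular (phi : R -> R^o) : funnel_class phi ->
  (exists2 m : R, 0 < m & forall t, 0 <= t -> m <= phi t) /\
  exists phi1 : R -> R, [/\ scalar_bounded_lipschitz T phi,
    scalar_bounded_lipschitz T phi1 &
    forall t, 0 <= t -> scalar_right_derivative T phi t (phi1 t)].
Proof.
move=> [W cont infp]; split.
  exists (inf [set (phi t : R) | t in halfline]) => // t t0.
  apply: ge_inf; last by exists t => //; rewrite /= in_itv /= t0.
  apply: contrapT => nlb; move: infp; rewrite inf_out ?ltxx // => -[_]; exact: nlb.
have [q' [M [M0 h1 h2]]] := Winfty2_c11 (real_line_operator R) W cont.
have [[c c0 [a1 a2]] [d d0 [b1 b2]] e] :=
  @c11_bounded_lipschitz R (real_line R) T (fun t => phi t : real_line R) q' M M0 T0 h1 h2.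
exists q'; split.
- by exists c => //; split=> [t t0 tT|s t s0 st tT];
    rewrite -nm_real_line; [exact: a1|exact: a2].
- by exists d => //; split=> [t t0 tT|s t s0 st tT];
    rewrite -nm_real_line; [exact: b1|exact: b2].
- move=> t t0 eps eps0; have [r r0 rP] := e t t0 eps eps0.
  by exists r => // t' h3 h4 h5; have := rP t' h3 h4 h5; rewrite nm_real_line.
Qed.

Lemma reference_lift_regular {U : hilbert F} (yref : R -> U) (p : R -> K^o)
    (P : {linear realify U -> realify D}) (c : R) (q0 : D) :
  0 <= c -> (forall w, nm (P w) <= c * nm w) ->
  controller_C1 yref -> @controller_C2 R K F p ->
  exists l1 : R -> realify D, [/\ bounded_lipschitz T (reference_lift yref p P q0),
    bounded_lipschitz T l1 &
    forall t, 0 <= t -> right_derivative T (reference_lift yref p P q0) t (l1 t)].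
Proof.
move=> c0 hc [Wy cy] [Wp cp _ _].
have [y' [M [M0 h1 h2]]] := Winfty2_c11 (linear_operator c0 hc) Wy cy.
have [a1 a2 a3] := c11_bounded_lipschitz M0 T0 h1 h2.
have [p' [M' [M'0 h1' h2']]] := Winfty2_c11 (scale_operator q0) Wp cp.
have [b1 b2 b3] := c11_bounded_lipschitz M'0 T0 h1' h2'.
exists (fun t => y' t + p' t); split; [exact: bounded_lipschitzD|exact: bounded_lipschitzD|].
by move=> t t0; apply: right_derivativeD; [exact: a3|exact: b3].
Qed.

End Regularity.

Section MainResult.
Context {R : realType} {K : numFieldType} {F : scalar_field R K}.
Context {X D U : hilbert F} (S : bcs X D U).
Variables (yref : R -> U) (p : R -> K) (phi : R -> R) (x0 : D) (T : R).
Hypothesis T0 : 0 < T.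
Hypothesis system : system_assumptions S.
Local Notation mu := (@lebesgue_measure R).
Local Notation i := (realify_lin (emb S)).
Local Notation A := (realify_lin (opA S)).
Local Notation B := (realify_lin (opB S)).
Local Notation C := (realify_lin (opC S)).

Lemma dense_admissible : dense (emb S @` admissible_initial S yref phi).
Proof.
have [[alpha [S1 [beta [ab S2]]]] S3] := system.
have i_inj : injective (i : realify D -> realify X) by exact: emb_inj.
have [ci ib] := realify_bound (emb_bounded S); have [cA Ab] := realify_bound (opA_bounded S).
have [cB Bb] := realify_bound (opB_bounded S); have [cC Cb] := realify_bound (opC_bounded S).
have S1' : forall x, dot (A x) (i x) <= dot (B x) (C x) + alpha * nm (i x) ^+ 2.
  by move=> x; rewrite nm_realify; exact: S1.
have [P [cP [cP0 PP]]] := output_lift Bb Cb S3.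
move=> Q [z Qz] oQ; have /nbhs_ballP[e /= /(ballK_real F)[e0 eE] eQ] := open_nbhs_nbhs (conj oQ Qz).
have [w Cw wz] := kernel_dense i_inj ib Ab Cb S1' ab S2
  ((z : realify X) - i (P (yref 0))) e0.
exists (emb S (P (yref 0) + w)); split; last first.
  exists (P (yref 0) + w) => //; rewrite /admissible_initial /=.
  have [_ CP _] := PP (yref 0).
  have -> : opC S (P (yref 0) + w) = yref 0.
    have C1 : opC S (P (yref 0)) = yref 0 by exact: CP.
    have C2 : opC S w = 0 by exact: Cw.
    by rewrite linearD /= C1 C2 addr0.
  by rewrite subrr rnorm0 mulr0.
apply: eQ; rewrite -ball_normE /ball_ /= (rnormE F) eE ltr_ofR rnormBC.
have -> : emb S (P (yref 0) + w) - z = emb S w - (z - emb S (P (yref 0))).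
  by rewrite linearD /= opprB addrA [in RHS](addrC (emb S w)).
by move: wz; rewrite nm_realify.
Qed.

Lemma solution_facts (x : R -> X) : closed_loop_solution S yref p phi x0 T x ->
  [/\ x 0 = emb S x0,
      exists2 L : R, 0 <= L & forall s t, 0 <= s -> s <= t -> t <= T ->
        nm ((x t : realify X) - x s) <= L * (t - s) &
      exists2 N : set R, mu.-negligible N & forall t, 0 < t -> t < T -> ~ N t ->
        exists xt dxt, [/\ emb S xt = x t, closed_loop_at S yref p phi x0 t xt dxt &
          right_derivative T (x : R -> realify X) t dxt]].
Proof.
move=> [W cont x00 [xd [wd ae]]]; split=> //.
  exact: (Winfty1_lipschitz (realify_operator X) T0 cont W).
exists (~` [set t | t \in `[0, T] -> {for t, continuous xd} /\
  exists xt : D, emb S xt = x t /\ closed_loop_at S yref p phi x0 t xt (xd t)]) => //.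
move=> t t0 tT nN; have /contrapT h := nN.
have [|cx [xt [xtE at_]]] := h; first by rewrite in_itv /= !ltW.
exists xt, (xd t); split=> //.
move=> e e0.
have [d d0 dP] := weak_derivative_pointwise (realify_operator X) T0 cont wd t0 tT cx e0.
by exists d => // t' h1 h2 _; exact: dP.
Qed.

Hypothesis controller : controller_assumptions S yref p phi x0.

(** The coordinates in which the feedback law is autonomous are set up with
    [l = reference_lift], and the abstract existence and uniqueness results are
    transported back. *)
Theorem closed_loop_wellposed : exists x : R -> X,
  closed_loop_solution S yref p phi x0 T x /\
  forall z : R -> X, closed_loop_solution S yref p phi x0 T z ->
    forall t, t \in `[0, T] -> z t = x t.
Proof.
have [[alpha [S1 [beta [ab S2]]]] S3] := system.
have [Cy Cp Cphi adm] := controller.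
have i_inj : injective (i : realify D -> realify X) by exact: emb_inj.
have [ci ib] := realify_bound (emb_bounded S); have [cA Ab] := realify_bound (opA_bounded S).
have [cB Bb] := realify_bound (opB_bounded S); have [cC Cb] := realify_bound (opC_bounded S).
have S1' : forall x, dot (A x) (i x) <= dot (B x) (C x) + alpha * nm (i x) ^+ 2.
  by move=> x; rewrite nm_realify; exact: S1.
have [P [cP [cP0 PP]]] := output_lift Bb Cb S3.
have BP w : B (P w) = 0 by case: (PP w).
have CP w : C (P w) = w by case: (PP w).
have Pb w : nm (P w) <= cP * nm w by case: (PP w).
have [q0 [Bq0 Cq0]] := S3 (opB S x0 + psi (phi 0) (opC S x0 - yref 0)) 0.
have [[m m0 phm] [phi1 [phL ph1L phD]]] := funnel_class_regular (ltW T0) Cphi.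
have [l1 [lL l1L lD]] := reference_lift_regular (ltW T0) q0 (ltW cP0) Pb Cy Cp.
have ph_gt0 t : 0 <= t -> 0 < phi t by move=> t0; apply: lt_le_trans (phm t t0).
have phi0 := ph_gt0 0 (lexx _).
have atP t xt dxt : 0 <= t -> closed_loop_at S yref p phi x0 t xt dxt <->
    dxt = opA S xt /\ closed_loop_dom B C
      (phi t *: ((xt : realify D) - reference_lift yref p P q0 t)).
  by move=> t0; apply: closed_loop_atP => //; exact: ph_gt0.
have unique x z : closed_loop_solution S yref p phi x0 T x ->
    closed_loop_solution S yref p phi x0 T z -> forall t, t \in `[0, T] -> z t = x t.
  move=> /solution_facts[x00 [L L0 xL] [N N0 NP]] /solution_facts[z00 [L' L'0 zL] [N' N'0 NP']].
  move=> t; rewrite in_itv /= => /andP[t0 tT].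
  have phmT t' : 0 <= t' -> t' <= T -> m <= phi t' by move=> t'0 _; exact: phm.
  apply: (@closed_loop_uniqueness R (realify X) (realify D) (realify U) i A B C alpha S1'
    T m (reference_lift yref p P q0) phi T0 m0 phmT x z (N `|` N') (L + L')) => //.
  - exact: negligibleU.
  - by rewrite x00 z00.
  - move=> s s' s0 ss' s'T; apply: le_trans (xL s s' s0 ss' s'T) _.
    by rewrite ler_wpM2r ?subr_ge0 // lerDl.
  - move=> s s' s0 ss' s'T; apply: le_trans (zL s s' s0 ss' s'T) _.
    by rewrite ler_wpM2r ?subr_ge0 // lerDr.
  move=> s s0 sT nN.
  have [xt [dx [xtE /(atP _ _ _ (ltW s0))[dxE xdom] xD]]] := NP s s0 sT (fun h => nN (or_introl h)).
  have [zt [dz [ztE /(atP _ _ _ (ltW s0))[dzE zdom] zD]]] := NP' s s0 sT (fun h => nN (or_intror h)).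
  by exists xt, zt; split=> //; [rewrite dxE in xD|rewrite dzE in zD].
suff [x solx] : exists x, closed_loop_solution S yref p phi x0 T x.
  by exists x; split=> // z solz; exact: unique.
have dom0 : closed_loop_dom B C
    (phi 0 *: ((x0 : realify D) - reference_lift yref p P q0 0)).
  have [_ _ _ p0] := Cp.
  suff /(atP _ _ _ (lexx 0))[] : closed_loop_at S yref p phi x0 0 x0 (opA S x0) by [].
  exists (opB S x0), (opC S x0), (opC S x0 - yref 0); split=> //; split=> //.
  by rewrite p0 scale1r addrK.
have phmT t : 0 <= t -> t <= T -> m <= phi t by move=> t0 _; exact: phm.
have [x [xd [xt [xx0 [L L0 [xB xL]] [c xdB] xD [xdr xdc xdom]]]]] :=
  closed_loop_existence i_inj ib Ab Bb Cb S1' ab S2 S3 T0 m0 phmT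
    lL l1L lD phL ph1L phD dom0.
have J t : `[0, T]%classic t -> 0 <= t /\ t <= T by rewrite /= in_itv /= => /andP.
have xL' s t : 0 <= s -> s <= t -> t <= T -> rnorm F ((x t : X) - x s) <= L * (t - s).
  by rewrite -nm_realify; exact: xL.
have xM t : `[0, T]%classic t -> rnorm F (x t : X) <= L + `|c|.
  move=> /J[t0 tT]; rewrite -nm_realify; apply: le_trans (xB t t0 tT) _.
  by rewrite lerDl.
have xdM t : `[0, T]%classic t -> rnorm F (xd t : X) <= L + `|c|.
  move=> /J[t0 tT]; rewrite -nm_realify; apply: le_trans (xdB t t0 tT) _.
  by apply: le_trans (ler_norm c) _; rewrite lerDr.
have xdr' : right_continuous F T (xd : R -> X).
  move=> t e t0 tT e0; have [d d0 dP] := xdr t t0 tT e e0.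
  by exists d => // t' h1 h2 h3; rewrite -nm_realify; exact: dP.
have xD' : forall t e : R, 0 <= t -> t < T -> 0 < e -> exists2 d : R, 0 < d &
    forall t', t <= t' -> t' < t + d -> t' < T ->
    rnorm F ((x t' : X) - x t - ofR F (t' - t) *: (xd t : X)) <= e * (t' - t).
  move=> t e t0 tT e0; have [d d0 dP] := xD t t0 tT e e0.
  by exists d => // t' h1 h2 h3; rewrite -nm_realify; exact: dP.
exists x; split=> //.
- exact: (Winfty1_right T0 L0 xL' xM xdM xdr' xD').
- have := within_continuous_lipschitz L0 xL'; exact.
exists xd; split.
  have := weak_derivative_right T0 L0 xL' xM xdM xdr' xD'; exact.
have N0 : mu.-negligible (~` [set t | 0 < t < T -> forall e : R, 0 < e ->
    exists2 d : R, 0 < d & forall s, `|s - t| < d -> nm (xd s - xd t) < e] `|` [set 0; T]).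
  apply: negligibleU; first exact: xdc.
  by apply: negligibleU; exact: negligible_point.
apply: negligibleS N0 => t /= nt; apply: contrapT => /not_orP[h1 /not_orP[h2 h3]]; apply: nt.
rewrite in_itv /= => /andP[t0 tT].
have t_gt0 : 0 < t by rewrite lt_neqAle t0 andbT eq_sym; apply/eqP.
have t_ltT : t < T by rewrite lt_neqAle tT andbT; apply/eqP.
have [xtE xdE xtdom] := xdom t t0 tT; split; last first.
  by exists (xt t); split=> //; apply/(atP _ _ _ t0); split.
move/contrapT: h1; rewrite t_gt0 t_ltT => h1.
apply/(cvg_rnormP F) => e e0; have [d d0 dP] := h1 isT e e0.
apply/nbhs_ballP; exists d => // s; rewrite /ball /= distrC => st.
by rewrite -nm_realify; exact: dP.
Qed.

End MainResult.

Theorem theorem3p4 (R : realType) (K : numFieldType) (F : scalar_field R K)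
    (X D U : hilbert F) (S : bcs X D U)
    (yref : R -> U) (p : R -> K) (phi : R -> R) (x0 : D) (T : R) :
  0 < T ->
  system_assumptions S ->
  controller_assumptions S yref p phi x0 ->
  (exists x : R -> X,
     closed_loop_solution S yref p phi x0 T x /\
     forall z : R -> X, closed_loop_solution S yref p phi x0 T z ->
       forall t, t \in `[0, T] -> z t = x t) /\
  dense (emb S @` admissible_initial S yref phi).
Proof.
move=> T0 system controller; split; first exact: closed_loop_wellposed.
exact: dense_admissible.
Qed.
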